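(* Let $a>0$ and let $S$ be the right isosceles triangle with two equal sides of length $a$ (half of a square of side length $a$). Let $N_N(t)$ and $N_D(t)$ be the eigenvalue counting functions of $-\Delta$ on $S$ with Neumann, respectively Dirichlet, boundary conditions on all of $\partial S$. Put $$\widetilde N_N(t)=\frac{a^2}{8\pi}t+\Big(\frac{2+\sqrt2}{4\pi}\Big)a\,t^{1/2}+\frac38,\qquad \widetilde N_D(t)=\frac{a^2}{8\pi}t-\Big(\frac{2+\sqrt2}{4\pi}\Big)a\,t^{1/2}+\frac38,$$ and $$A_N(t)=\frac1t\int_0^t\big(N_N(s)-\widetilde N_N(s)\big)\,ds,\qquad A_D(t)=\frac1t\int_0^t\big(N_D(s)-\widetilde N_D(s)\big)\,ds .$$ Then there is an almost periodic function $g$ of mean value zero such that both $A=A_N$ and $A=A_D$ satisfy $$A(t)=g(t^{1/2})\,t^{-1/4}+O(t^{-1/2})\qquad\text{as } t\to\infty .$$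
   Context: The eigenvalue counting function of an operator with discrete spectrum $0\le\lambda_1\le\lambda_2\le\cdots\to\infty$ (repeated according to multiplicity) is $N(t)=\#\{j:\lambda_j\le t\}$. Almost periodic means uniformly almost periodic (in the sense of Bohr): a function $g:\mathbb R\to\mathbb R$ that is a uniform limit on $\mathbb R$ of trigonometric polynomials (finite linear combinations of $x\mapsto e^{i\gamma x}$, $\gamma\in\mathbb R$). Its mean value is $\lim_{L\to\infty}\frac1L\int_0^L g(x)\,dx$. *)

(* Defs.v *)
From HB Require Import structures.
From mathcomp Require Import all_boot all_order all_algebra.
From mathcomp Require Import all_classical all_reals all_analysis.
From mathcomp Require Import complex.

Set Implicit Arguments.
Unset Strict Implicit.
Unset Printing Implicit Defensive.

Import Order.TTheory GRing.Theory Num.Theory.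
Import numFieldNormedType.Exports.

Local Open Scope classical_set_scope.
Local Open Scope ring_scope.

(** * Almost periodic functions *)

Definition trig_poly (R : realType) (p : R -> R[i]) : Prop :=
  exists (n : nat) (c : 'I_n -> R[i]) (gamma : 'I_n -> R),
    forall x, p x = \sum_(k < n)
      c k * (cos (gamma k * x) +i* sin (gamma k * x))%C.

Definition almost_periodic (R : realType) (g : R -> R) : Prop :=
  forall eps : R, 0 < eps ->
    exists2 p : R -> R[i], trig_poly p &
      forall x, `|(g x)%:C%C - p x| <= eps%:C%C.

Definition has_mean_value (R : realType) (g : R -> R) (m : R) : Prop :=
  (L^-1 * \int[lebesgue_measure]_(x in `[0, L]) g x) @[L --> +oo] --> m.

(** * The Neumann and Dirichlet Laplacians of a plane domain

    Functions on a domain [S] are represented by Borel functions on the whole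
    plane, whose values outside [S] are irrelevant, and elements of [L^2(S)] are
    considered up to equality almost everywhere on [S]. *)

Notation area := (@lebesgue_measure _ \x @lebesgue_measure _)%E (only parsing).

Section laplacian.
Context {R : realType}.

Definition L2 (S : set (R * R)) (u : R * R -> R) : Prop :=
  measurable_fun (S : set (measurableTypeR R * measurableTypeR R)) u /\
  area.-integrable S (fun z => (u z ^+ 2)%:E).

Definition dx (phi : R * R -> R) : R * R -> R := 'D_(1, 0) phi.
Definition dy (phi : R * R -> R) : R * R -> R := 'D_(0, 1) phi.

Definition C1 (phi : R * R -> R) : Prop :=
  [/\ forall z, derivable phi z (1, 0), forall z, derivable phi z (0, 1),
      continuous (dx phi) & continuous (dy phi)].

Definition C1c (S : set (R * R)) (phi : R * R -> R) : Prop :=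
  C1 phi /\ exists K : set (R * R),
    [/\ compact K, K `<=` S & forall z, ~ K z -> phi z = 0].

(** [sobolev S u ux uy]: [u] belongs to [H^1(S) = W^{1,2}(S)], with weak
    gradient [(ux, uy)]. *)
Definition sobolev (S : set (R * R)) (u ux uy : R * R -> R) : Prop :=
  [/\ L2 S u, L2 S ux, L2 S uy &
      forall phi, C1c S phi ->
        (\int[area]_(z in S) (u z * dx phi z) =
           - (\int[area]_(z in S) (ux z * phi z))) /\
        (\int[area]_(z in S) (u z * dy phi z) =
           - (\int[area]_(z in S) (uy z * phi z)))].

(** [sobolev0 S u ux uy]: moreover [u] belongs to [H^1_0(S)], the closure of
    [C^1_c(S)] in [H^1(S)]. *)
Definition sobolev0 (S : set (R * R)) (u ux uy : R * R -> R) : Prop :=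
  sobolev S u ux uy /\
  forall eps : R, 0 < eps -> exists2 phi, C1c S phi &
    (\int[area]_(z in S) ((u z - phi z) ^+ 2 + (ux z - dx phi z) ^+ 2
                          + (uy z - dy phi z) ^+ 2)) < eps.

Inductive boundary_condition := Neumann | Dirichlet.

Definition form_domain (bc : boundary_condition) (S : set (R * R)) :
    (R * R -> R) -> (R * R -> R) -> (R * R -> R) -> Prop :=
  match bc with Neumann => sobolev S | Dirichlet => sobolev0 S end.

(** [minus_laplacian bc S u f]: [u] belongs to the domain of the self-adjoint
    operator [-Delta] of [L^2(S)] with boundary condition [bc], i.e. the operator
    of the form [int_S grad u . grad v] on [H^1(S)], resp. [H^1_0(S)], and [f] is
    its image. *)
Definition minus_laplacian (bc : boundary_condition) (S : set (R * R))
    (u f : R * R -> R) : Prop :=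
  L2 S f /\ exists ux uy, form_domain bc S u ux uy /\
    forall v vx vy, form_domain bc S v vx vy ->
      (\int[area]_(z in S) (ux z * vx z + uy z * vy z)) =
      (\int[area]_(z in S) (f z * v z)).

Definition eigenfunctions (bc : boundary_condition) (S : set (R * R))
    (lambda : R) : set (R * R -> R) :=
  [set u | minus_laplacian bc S u (fun z => lambda * u z)].

Definition linearly_independent (S : set (R * R)) (n : nat)
    (u : 'I_n -> R * R -> R) : Prop :=
  forall c : 'I_n -> R,
    {ae area, forall z, S z -> \sum_(i < n) c i * u i z = 0} ->
    forall i, c i = 0.

(** Dimension of the eigenspace; it is [0] if [lambda] is not an eigenvalue. *)
Definition multiplicity (bc : boundary_condition) (S : set (R * R))
    (lambda : R) : \bar R :=
  ereal_sup [set n%:R%:E | n in [set n | exists u : 'I_n -> R * R -> R,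
    (forall i, eigenfunctions bc S lambda (u i)) /\ linearly_independent S u]].

(** [#{j : lambda_j <= t}] for the eigenvalues [lambda_j] repeated according to
    multiplicity, that is, the sum of the multiplicities of the eigenvalues
    [<= t]. *)
Definition eigenvalue_count (bc : boundary_condition) (S : set (R * R))
    (t : R) : R :=
  fine (\esum_(lambda in [set l | l <= t]) multiplicity bc S lambda).

End laplacian.

(** * The right isosceles triangle *)

Definition triangle (R : realType) (a : R) : set (R * R) :=
  [set z | [/\ 0 < z.2, z.2 < z.1 & z.1 < a]].

(** [Ntilde_N] and [Ntilde_D] differ by the sign of the perimeter term. *)
Definition Ntilde (R : realType) (bc : boundary_condition) (a t : R) : R :=
  let b := (2 + Num.sqrt 2) / (4 * pi) * a * Num.sqrt t in
  a ^+ 2 / (8 * pi) * t + (match bc with Neumann => b | Dirichlet => - b end)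
  + 3 / 8.

Definition average_error (R : realType) (bc : boundary_condition) (a t : R) : R :=
  t^-1 * \int[lebesgue_measure]_(s in `[0, t])
           (eigenvalue_count bc (triangle a) s - Ntilde bc a s).

(* Main.v *)
Require Import Defs.
From HB Require Import structures.
From mathcomp Require Import all_boot all_order all_algebra.
From mathcomp Require Import all_classical all_reals all_analysis.
From mathcomp Require Import complex measurable_realfun ring lra zify.

(** The modes of the square of side [a] that are even (Neumann) or odd (Dirichlet)
    across a diagonal,
      [trig (m x) trig (n y) +- trig (n x) trig (m y)],
    with [trig] the cosine or the sine of frequency [pi / a], are eigenfunctions of
    the triangle of eigenvalue [(pi / a)^2 (m^2 + n^2)]. They are orthogonal
    ([eigmode_orthogonal]) and complete ([modes_complete]), so that the eigenvalue
    count is a count of lattice points in an eighth of a disc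
    ([multiplicityE], [eigenvalue_countE]).

    That the modes are eigenfunctions in the weak sense rests on a Green formula
    proved with cutoffs near the boundary ([green], [bC1_sobolev0]). Completeness of the Neumann modes comes from the fact that the
    cosine series of an indicator function converges boundedly, which reduces
    orthogonality to all modes to the vanishing of integrals over rectangles
    ([neumann_complete]); the Dirichlet case follows on multiplying by the first
    Dirichlet mode ([dirichlet_complete]).

    Integrating the count turns it into the sum of [max 0 (r^2 - m^2 - n^2)] over an
    eighth of the lattice, with [r = a sqrt t / pi]. By symmetry this sum is an eighth
    of the sum over the whole lattice, plus or minus half the sums over a half-axis and
    a half-diagonal, plus a corner term ([triangle_lattice_sum]). The sums over lines
    are elementary ([line_sum]) and account for the perimeter and constant terms of
    [Ntilde].

    For the whole lattice, Poisson summation in each variable ([poisson],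
    [disc_coef_cvg]) gives the leading term [pi r^4 / 2] and, for each nonzero
    frequency [q], a multiple of [r^2 q^-2 J_2(r q)]. The asymptotic behaviour of the
    Bessel function ([bessel2_asymptotics]) makes this equal to [r^(3/2)] times an
    oscillating wave of amplitude [q^(-5/2)], up to [O(r q^(-5/2))]. Both series
    converge absolutely over the plane lattice; the first one converges uniformly, so
    that its sum is almost periodic of mean value zero, and it is the same for both
    boundary conditions ([riesz_asymptotics]). Dividing by [t], which is of order
    [r^2], gives the amplitude [t^(-1/4)] and the error [O(t^(-1/2))]. *)

Set Implicit Arguments.
Unset Strict Implicit.
Unset Printing Implicit Defensive.

Import Order.TTheory GRing.Theory Num.Theory.
Import numFieldNormedType.Exports.

Local Open Scope classical_set_scope.
Local Open Scope ring_scope.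

(** * Differentiation and integration of explicit functions *)
Section pointwise_derivation.
Context {R : realType} {V : normedModType R}.
Implicit Types (f g : V -> R) (z v : V).

Lemma der_cst (c : R) z v : is_derive z v (fun _ => c) 0.
Proof. exact: is_derive_cst. Qed.

Lemma derD f g z v a b : is_derive z v f a -> is_derive z v g b ->
  is_derive z v (fun y => f y + g y) (a + b).
Proof. by move=> ? ?; exact: is_deriveD. Qed.

Lemma derB f g z v a b : is_derive z v f a -> is_derive z v g b ->
  is_derive z v (fun y => f y - g y) (a - b).
Proof. by move=> ? ?; exact: is_deriveB. Qed.

Lemma derN f z v a : is_derive z v f a -> is_derive z v (fun y => - f y) (- a).
Proof. by move=> ?; exact: is_deriveN. Qed.

Lemma derM f g z v a b : is_derive z v f a -> is_derive z v g b ->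
  is_derive z v (fun y => f y * g y) (f z * b + g z * a).
Proof. by move=> ? ?; exact: is_deriveM. Qed.

Lemma derX f n z v a : is_derive z v f a ->
  is_derive z v (fun y => f y ^+ n) (n%:R * f z ^+ n.-1 * a).
Proof.
move=> fa; elim: n => [|n IH].
  rewrite !mul0r (_ : (fun y => f y ^+ 0) = fun=> 1); first exact: der_cst.
  by apply/funext => y; rewrite expr0.
rewrite (_ : (fun y => _) = fun y => f y * f y ^+ n); last first.
  by apply/funext => y; rewrite exprS.
rewrite (_ : _ * a = f z * (n%:R * f z ^+ n.-1 * a) + f z ^+ n * a).
  exact: derM.
by case: n {IH} => [|n]; rewrite /= ?exprS -?natr1; ring.
Qed.

Lemma der_eq f z v a b : is_derive z v f a -> a = b -> is_derive z v f b.
Proof. by move=> ? <-. Qed.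

(** A directional derivative is an ordinary one along a line; this transfers the
    one-variable chain rule to functions of the plane. *)
Lemma der_line f z v a :
  is_derive z v f a <-> is_derive (0 : R) 1 (fun h : R => f (h *: v + z)) a.
Proof.
have E : (fun h : R => h^-1 *: (f (h *: v + z) - f z)) =
   (fun h : R => h^-1 *: (f ((h *: (1:R) + 0) *: v + z) - f (0 *: v + z))).
  by apply/funext => h; rewrite addr0 scaler1 scale0r add0r.
split => -[df da]; split.
- by rewrite /derivable; have := df; rewrite /derivable /= E.
- by rewrite -da /derive /= E.
- by rewrite /derivable; have := df; rewrite /derivable /= -E.
- by rewrite -da /derive /= -E.
Qed.

Lemma der_comp (h : R -> R) f z v a b : is_derive (f z) 1 h b ->
  is_derive z v f a -> is_derive z v (fun y => h (f y)) (b * a).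
Proof.
move=> hb /der_line fa; apply/der_line.
apply: (@is_derive1_comp _ h (fun t : R => f (t *: v + z))).
by rewrite scale0r add0r.
Qed.

Lemma der_sin f z v a : is_derive z v f a ->
  is_derive z v (fun y => sin (f y)) (cos (f z) * a).
Proof. by apply: der_comp; exact: is_derive_sin. Qed.

Lemma der_cos f z v a : is_derive z v f a ->
  is_derive z v (fun y => cos (f y)) (- sin (f z) * a).
Proof. by apply: der_comp; exact: is_derive_cos. Qed.

Lemma der_sqrt f z v a : 0 < f z -> is_derive z v f a ->
  is_derive z v (fun y => Num.sqrt (f y)) ((2 * Num.sqrt (f z))^-1 * a).
Proof. by move=> fz; apply: der_comp; exact: is_derive1_sqrt. Qed.

End pointwise_derivation.

Lemma der_fst (R : realType) (z v : R * R) : is_derive z v fst v.1.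
Proof.
apply/der_line.
have -> : (fun h : R => (h *: v + z).1) = (fun h => h * v.1 + z.1) by [].
notypeclasses refine (der_eq (derD (derM _ _) _) _).
- exact: is_derive_id.
- exact: der_cst.
- exact: der_cst.
by rewrite mulr0 add0r mulr1 addr0.
Qed.

Lemma der_snd (R : realType) (z v : R * R) : is_derive z v snd v.2.
Proof.
apply/der_line.
have -> : (fun h : R => (h *: v + z).2) = (fun h => h * v.2 + z.2) by [].
notypeclasses refine (der_eq (derD (derM _ _) _) _).
- exact: is_derive_id.
- exact: der_cst.
- exact: der_cst.
by rewrite mulr0 add0r mulr1 addr0.
Qed.

(** Leaves as goal only the identity between the computed derivative and the
    expected one. The rules are chosen by matching rather than by instance
    search because functions of the plane occur in eta-reduced form. *)
Ltac der1 :=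
  lazymatch goal with
  | |- is_derive _ _ (fun y => y) _ => exact: is_derive_id
  | |- is_derive _ _ (fun y => y.1) _ => exact: der_fst
  | |- is_derive _ _ (fun y => y.2) _ => exact: der_snd
  | |- is_derive _ _ (fun y => @?f y + - @?g y) _ => notypeclasses refine (derB _ _)
  | |- is_derive _ _ (fun y => @?f y + @?g y) _ => notypeclasses refine (derD _ _)
  | |- is_derive _ _ (fun y => @?f y * @?g y) _ => notypeclasses refine (derM _ _)
  | |- is_derive _ _ (fun y => - @?f y) _ => notypeclasses refine (derN _)
  | |- is_derive _ _ (fun y => @?f y ^+ _) _ => notypeclasses refine (derX _ _)
  | |- is_derive _ _ (fun y => sin (@?f y)) _ => notypeclasses refine (der_sin _)
  | |- is_derive _ _ (fun y => cos (@?f y)) _ => notypeclasses refine (der_cos _)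
  | |- is_derive ?z ?v (GRing.mul ?c) ?d => change (is_derive z v (fun y => c * y) d)
  | |- is_derive ?z ?v (GRing.add ?c) ?d => change (is_derive z v (fun y => c + y) d)
  | |- is_derive ?z ?v (GRing.opp) ?d => change (is_derive z v (fun y => - y) d)
  | |- is_derive ?z ?v (@sin _) ?d => change (is_derive z v (fun y => sin y) d)
  | |- is_derive ?z ?v (@cos _) ?d => change (is_derive z v (fun y => cos y) d)
  | |- is_derive ?z ?v (@fst _ _) ?d => change (is_derive z v (fun y => y.1) d)
  | |- is_derive ?z ?v (@snd _ _) ?d => change (is_derive z v (fun y => y.2) d)
  | |- is_derive ?z ?v (Num.sqrt) ?d => change (is_derive z v (fun y => Num.sqrt y) d)
  | |- is_derive _ _ (fun y => _) _ => exact: der_cst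
  end.
Ltac der := notypeclasses refine (der_eq _ _); [repeat der1 | rewrite /=].

Section pointwise_continuity.
Context {R : realType} {V : topologicalType}.
Implicit Types (f g : V -> R).

Lemma cont_cst (c : R) : continuous (fun _ : V => c).
Proof. by move=> x; exact: cvg_cst. Qed.
Lemma contD f g : continuous f -> continuous g -> continuous (fun y => f y + g y).
Proof. by move=> cf cg x; apply: cvgD; [exact: cf|exact: cg]. Qed.
Lemma contB f g : continuous f -> continuous g -> continuous (fun y => f y - g y).
Proof. by move=> cf cg x; apply: cvgB; [exact: cf|exact: cg]. Qed.
Lemma contM f g : continuous f -> continuous g -> continuous (fun y => f y * g y).
Proof. by move=> cf cg x; apply: cvgM; [exact: cf|exact: cg]. Qed.
Lemma contN f : continuous f -> continuous (fun y => - f y).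
Proof. by move=> cf x; apply: cvgN; exact: cf. Qed.
Lemma cont_comp (h : R -> R) f : continuous h -> continuous f ->
  continuous (fun y => h (f y)).
Proof. by move=> ch cf x; apply: (@continuous_comp _ _ _ f h); [exact: cf|exact: ch]. Qed.
Lemma contX f n : continuous f -> continuous (fun y => f y ^+ n).
Proof. by move=> cf; apply: (@cont_comp (fun x : R => x ^+ n)) => //; exact: exprn_continuous. Qed.
Lemma cont_sin f : continuous f -> continuous (fun y => sin (f y)).
Proof. by apply: cont_comp; exact: continuous_sin. Qed.
Lemma cont_cos f : continuous f -> continuous (fun y => cos (f y)).
Proof. by apply: cont_comp; exact: continuous_cos. Qed.
Lemma cont_sqrt f : continuous f -> continuous (fun y => Num.sqrt (f y)).
Proof. by apply: cont_comp; exact: sqrt_continuous. Qed.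
Lemma cont_sum n (F : nat -> V -> R) : (forall i, continuous (F i)) ->
  continuous (fun y => \sum_(i < n) F i y).
Proof.
move=> cF; elim: n => [|n IH].
  by rewrite (_ : (fun y => _) = fun=> 0); [exact: cont_cst|apply/funext => y; rewrite big_ord0].
rewrite (_ : (fun y => _) = fun y => \sum_(i < n) F i y + F n y); first exact: contD.
by apply/funext => y; rewrite big_ord_recr.
Qed.
End pointwise_continuity.

Lemma cont_id (R : realType) : continuous (fun y : R => y).
Proof. by move=> x; exact: cvg_id. Qed.
Lemma cont_fst (R : realType) : continuous (fun y : R * R => y.1).
Proof. by move=> x; exact: cvg_fst. Qed.
Lemma cont_snd (R : realType) : continuous (fun y : R * R => y.2).
Proof. by move=> x; exact: cvg_snd. Qed.

Ltac cont1 :=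
  lazymatch goal with
  | |- continuous (fun y => y) => exact: cont_id
  | |- continuous (fun y => y.1) => exact: cont_fst
  | |- continuous (fun y => y.2) => exact: cont_snd
  | |- continuous (fun y => @?f y + - @?g y) => apply: contB
  | |- continuous (fun y => @?f y + @?g y) => apply: contD
  | |- continuous (fun y => @?f y * @?g y) => apply: contM
  | |- continuous (fun y => - @?f y) => apply: contN
  | |- continuous (fun y => @?f y ^+ _) => apply: contX
  | |- continuous (fun y => sin (@?f y)) => apply: cont_sin
  | |- continuous (fun y => cos (@?f y)) => apply: cont_cos
  | |- continuous (fun y => Num.sqrt (@?f y)) => apply: cont_sqrt
  | |- continuous (fun y => bigop.body _ _ _) => apply: cont_sum => ?
  | |- continuous (GRing.mul ?c) => change (continuous (fun y => c * y))
  | |- continuous (GRing.add ?c) => change (continuous (fun y => c + y))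
  | |- continuous (GRing.opp) => change (continuous (fun y => - y))
  | |- continuous (@sin _) => exact: continuous_sin
  | |- continuous (@cos _) => exact: continuous_cos
  | |- continuous (@fst _ _) => exact: cont_fst
  | |- continuous (@snd _ _) => exact: cont_snd
  | |- continuous (Num.sqrt) => exact: sqrt_continuous
  | |- continuous (fun y => _) => exact: cont_cst
  end.
Ltac cont := repeat cont1.

Lemma der_continuous (R : realType) (f df : R -> R) :
  (forall x : R, is_derive x 1 f (df x)) -> continuous f.
Proof.
move=> d x; apply: differentiable_continuous; apply/derivable1_diffP.
by have [] := d x.
Qed.

Section real_integral.
Context {R : realType}.
Notation mu := (@lebesgue_measure R).
Implicit Types (f g F : R -> R) (a b : R).

Lemma within_cont f (A : set R) : continuous f -> {within A, continuous f}.
Proof. exact: continuous_subspaceT. Qed.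

Lemma cont_integrable f a b : continuous f -> mu.-integrable `[a, b] (EFin \o f).
Proof.
move=> cf; apply: continuous_compact_integrable; first exact: segment_compact.
exact: within_cont.
Qed.

Definition ri a b f : R := \int[mu]_(x in `[a, b]) f x.

Lemma ri_ext a b f g : (forall x, a <= x <= b -> f x = g x) -> ri a b f = ri a b g.
Proof.
by move=> fg; apply: eq_Rintegral => x; rewrite inE /= in_itv /= => /fg.
Qed.

Lemma riD a b f g : continuous f -> continuous g ->
  ri a b (fun x => f x + g x) = ri a b f + ri a b g.
Proof. by move=> cf cg; rewrite /ri RintegralD//; exact: cont_integrable. Qed.

Lemma riB a b f g : continuous f -> continuous g ->
  ri a b (fun x => f x - g x) = ri a b f - ri a b g.
Proof. by move=> cf cg; rewrite /ri RintegralB//; exact: cont_integrable. Qed.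

Lemma riZ a b (c : R) f : continuous f -> ri a b (fun x => c * f x) = c * ri a b f.
Proof. by move=> cf; rewrite /ri RintegralZl//; exact: cont_integrable. Qed.

Lemma riZr a b (c : R) f : continuous f -> ri a b (fun x => f x * c) = ri a b f * c.
Proof. by move=> cf; rewrite /ri RintegralZr//; exact: cont_integrable. Qed.

Lemma riN a b f : continuous f -> ri a b (fun x => - f x) = - ri a b f.
Proof.
by move=> cf; rewrite -mulN1r -riZ//; apply: ri_ext => x _; rewrite mulN1r.
Qed.

Lemma ri_cst a b (c : R) : a <= b -> ri a b (fun=> c) = c * (b - a).
Proof.
rewrite /ri le_eqVlt => /predU1P[<-|ab].
  by rewrite set_itv1 Rintegral_set1 subrr mulr0.
by rewrite Rintegral_cst//= lebesgue_measure_itv/= lte_fin ab.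
Qed.

Lemma ri_sum a b n (F : nat -> R -> R) : a <= b -> (forall i, continuous (F i)) ->
  ri a b (fun x => \sum_(i < n) F i x) = \sum_(i < n) ri a b (F i).
Proof.
move=> ab cF; elim: n => [|n IH].
  rewrite big_ord0 -[RHS](mul0r (b - a)) -ri_cst//.
  by apply: ri_ext => x _; rewrite big_ord0.
rewrite big_ord_recr /= -IH -riD//; last exact: cont_sum.
by apply: ri_ext => x _; rewrite big_ord_recr.
Qed.

Lemma ri_le a b f g : continuous f -> continuous g ->
  (forall x, a <= x <= b -> f x <= g x) -> ri a b f <= ri a b g.
Proof.
move=> cf cg fg; apply: le_Rintegral => //; try exact: cont_integrable.
Qed.

Lemma ri_norm_le a b f (C : R) : a <= b -> continuous f ->
  (forall x, a <= x <= b -> `|f x| <= C) -> `|ri a b f| <= C * (b - a).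
Proof.
move=> ab cf fC; apply: (@le_trans _ _ (ri a b (fun x => `|f x|))).
  by apply: le_normr_Rintegral => //; exact: cont_integrable.
rewrite -ri_cst//; apply: ri_le => //; last exact: cont_cst.
by move=> x; apply: continuous_comp; [exact: cf|exact: norm_continuous].
Qed.

Lemma ri_same a f : ri a a f = 0.
Proof. by rewrite /ri set_itv1 Rintegral_set1. Qed.

(** Allowing [F] not to be derivable at the endpoints is what lets
    [sqrt (r^2 - x^2)] be integrated up to [x = r]. *)
Lemma ri_FTC_oo F f a b : a <= b -> continuous F -> continuous f ->
  (forall x : R, a < x < b -> is_derive x 1 F (f x)) -> ri a b f = F b - F a.
Proof.
rewrite le_eqVlt => /predU1P[<- *|ab cF cf dF]; first by rewrite ri_same subrr.
rewrite /ri /Rintegral (@continuous_FTC2 _ f F)//.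
- exact: within_cont.
- split.
  + by move=> x; rewrite in_itv /= => /dF [].
  + by apply: cvg_at_right_filter; exact: cF.
  + by apply: cvg_at_left_filter; exact: cF.
- move=> x; rewrite in_itv /= => /dF d; rewrite derive1E; exact: derive_val.
Qed.

Lemma ri_FTC F f a b : a <= b -> continuous f ->
  (forall x : R, is_derive x 1 F (f x)) -> ri a b f = F b - F a.
Proof.
move=> ab cf dF; apply: ri_FTC_oo => //; exact: (der_continuous dF).
Qed.

Lemma ri_split a b c f : a <= b -> b <= c -> continuous f ->
  ri a c f = ri a b f + ri b c f.
Proof.
move=> ab bc cf; rewrite /ri.
rewrite -(@Rintegral_itv_obnd_cbnd _ b); last first.
  apply: integrableS (cont_integrable b c cf) => //.
  exact: subset_itv_oc_cc.
rewrite -(@Rintegral_itvB _ f (BLeft a) (BRight c) b)//.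
- by rewrite addrC subrK.
- exact: cont_integrable.
Qed.

End real_integral.

(** * The Fourier staircase *)
Section monotone.
Context {R : realType}.
Implicit Types (f df : R -> R) (a b x : R).

Lemma mean_value_bound f df a b : a <= b ->
  (forall x, a <= x <= b -> is_derive x 1 f (df x)) ->
  exists2 c, a <= c <= b & f b - f a = df c * (b - a).
Proof.
rewrite le_eqVlt => /predU1P[<- _|ab d].
  by exists a; rewrite ?lexx// !subrr mulr0.
have dab x : x \in `]a, b[ -> is_derive x 1 f (df x).
  by rewrite in_itv/= => /andP[ax xb]; apply: d; rewrite !ltW.
have cf : {within `[a, b], continuous f}.
  apply: derivable_within_continuous => x; rewrite in_itv/= => xab.
  by have [] := d _ xab.
have [c] := MVT ab dab cf.
by rewrite in_itv/= => /andP[ac cb] ?; exists c => //; rewrite !ltW.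
Qed.

Lemma ge0_derive_le f df a b : a <= b ->
  (forall x, a <= x <= b -> is_derive x 1 f (df x)) ->
  (forall x, a <= x <= b -> 0 <= df x) -> f a <= f b.
Proof.
move=> ab d df0; have [c cab] := mean_value_bound ab d.
by move=> /eqP; rewrite subr_eq => /eqP ->; rewrite lerDr mulr_ge0 ?df0 ?subr_ge0.
Qed.

Lemma le0_derive_ge f df a b : a <= b ->
  (forall x, a <= x <= b -> is_derive x 1 f (df x)) ->
  (forall x, a <= x <= b -> df x <= 0) -> f b <= f a.
Proof.
move=> ab d df0; rewrite -lerN2.
apply: (@ge0_derive_le (fun x => - f x) (fun x => - df x)) => // x xab.
  by apply: derN; exact: d.
by rewrite oppr_ge0; exact: df0.
Qed.

Lemma derive_lipschitz f df (C : R) : (forall x : R, is_derive x 1 f (df x)) ->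
  (forall x, `|df x| <= C) -> forall x y, `|f x - f y| <= C * `|x - y|.
Proof.
move=> d dC x y; wlog xy : x y / y <= x.
  move=> W; case: (leP y x) => [/W //|/ltW /W]; by rewrite distrC (distrC x).
have [z zyx ->] := mean_value_bound xy (fun z _ => d z).
by rewrite normrM ler_wpM2r.
Qed.

Lemma sin_lipschitz (x y : R) : `|sin x - sin y| <= `|x - y|.
Proof.
rewrite -[leRHS]mul1r; apply: (derive_lipschitz (@is_derive_sin R)) => z.
exact: cos_max.
Qed.

Lemma sin_le_abs (x : R) : `|sin x| <= `|x|.
Proof. by have := sin_lipschitz x 0; rewrite sin0 !subr0. Qed.

Lemma sin_ge_quarter (x : R) : 0 <= x <= pi / 2 -> x / 4 <= sin x.
Proof.
move=> /andP[x0 xpi].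
have p0 := @pi_gt0 R; have p4 : (pi : R) / 2 < 2 := pihalf_lt2 R.
have [->|xn0] := eqVneq x 0; first by rewrite mul0r sin0.
have xgt0 : 0 < x by rewrite lt_def xn0.
have chalf : 2^-1 <= cos (x / 2).
  have c1 : 0 <= cos (x / 2) by apply: cos_ge0_pihalf; lra.
  have : cos x = cos (x / 2) ^+ 2 *+ 2 - 1.
    by rewrite -cos_mulr2n; congr cos; rewrite mulr2n; lra.
  have : 0 <= cos x by apply: cos_ge0_pihalf; lra.
  by move: c1; set c := cos (x / 2); nra.
have xh0 : 0 <= x / 2 by lra.
have [c /andP[c0 cx]] := mean_value_bound xh0 (fun z _ => is_derive_sin z).
rewrite sin0 !subr0 => sxh.
have : cos (x / 2) <= cos c.
  have := @ltr_cos R; case: (eqVneq c (x / 2)) => [->//|cne] H.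
  by apply: ltW; rewrite H ?in_itv/= ?lt_def ?cx ?andbT 1?eq_sym//; lra.
have : sin x = (cos (x / 2) * sin (x / 2)) *+ 2.
  by rewrite -sin_mulr2n; congr sin; rewrite mulr2n; lra.
rewrite sxh => -> cc.
have : (x / 2) * 2^-1 <= cos c * (x / 2) by rewrite mulrC ler_wpM2r//; lra.
move: chalf; set u := cos (x / 2); set v := cos c * _; nra.
Qed.
End monotone.

Section staircase.
Context {R : realType}.
Implicit Types (x t : R) (K : nat).

(** Partial Fourier sums of [floor x + 1/2]: the primitives of the Dirichlet
    kernels, hence the right weight for a summation by parts. *)
Definition stair K x : R :=
  x + \sum_(k < K) sin (2 * pi * k.+1%:R * x) / (pi * k.+1%:R).

Definition dirichlet K x : R := 1 + \sum_(k < K) 2 * cos (2 * pi * k.+1%:R * x).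

Lemma der_stair K x : is_derive x 1 (stair K) (dirichlet K x).
Proof.
elim: K => [|K IH].
  rewrite (_ : stair 0 = fun x => x).
    by rewrite /dirichlet big_ord0 addr0; exact: is_derive_id.
  by apply/funext => y; rewrite /stair big_ord0 addr0.
rewrite (_ : stair K.+1 = fun y =>
   stair K y + sin (2 * pi * K.+1%:R * y) * (pi * K.+1%:R)^-1); last first.
  by apply/funext => y; rewrite /stair big_ord_recr/= addrA.
rewrite /dirichlet big_ord_recr/= addrA -/(dirichlet K x).
notypeclasses refine (derD IH _).
der.
have Kn0 : K.+1%:R != 0 :> R by rewrite pnatr_eq0.
have pn0 : pi != 0 :> R by rewrite gt_eqF// pi_gt0.
move: pn0 Kn0; move: (pi : R) K.+1%:R => p k pn0 kn0.
by field; rewrite ?pn0 ?kn0.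
Qed.

(** The geometric sum giving the Dirichlet kernel, cleared of its denominator. *)
Lemma dirichletM K x : dirichlet K x * sin (pi * x) = sin ((2 * K + 1)%:R * pi * x).
Proof.
elim: K => [|K IH].
  by rewrite /dirichlet big_ord0 addr0 mul1r muln0 add0n mul1r.
rewrite /dirichlet big_ord_recr/= addrA -/(dirichlet K x) mulrDl {}IH.
rewrite (_ : (2 * K + 1)%:R * pi * x = 2 * pi * K.+1%:R * x - pi * x); last first.
  by rewrite natrD natrM -natr1; ring.
rewrite (_ : (2 * K.+1 + 1)%:R * pi * x = 2 * pi * K.+1%:R * x + pi * x); last first.
  by rewrite natrD natrM -natr1; ring.
by rewrite sinB sinD; ring.
Qed.

Lemma sin_natpi (n : nat) : sin (n%:R * pi) = 0 :> R.
Proof.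
elim: n => [|n IH]; first by rewrite mul0r sin0.
by rewrite -natr1 mulrDl mul1r sinD IH sinpi !(mul0r, mulr0) addr0.
Qed.

Lemma stair0 K : stair K 0 = 0.
Proof.
rewrite /stair add0r big1// => k _; by rewrite mulr0 sin0 mul0r.
Qed.

Lemma stairD1 K x : stair K (x + 1) = stair K x + 1.
Proof.
rewrite /stair addrAC; congr (_ + _ + _); apply: eq_bigr => k _; congr (_ / _).
rewrite (_ : _ * (x + 1) = 2 * pi * k.+1%:R * x + pi *+ 2 *+ k.+1).
  exact/periodicn/sinD2pi.
by rewrite -[pi *+ 2]mulr_natl -(mulr_natl _ k.+1); ring.
Qed.

Lemma stairDn K x (n : nat) : stair K (x + n%:R) = stair K x + n%:R.
Proof.
by elim: n => [|n IH]; rewrite ?addr0// -natr1 !addrA stairD1 IH.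
Qed.

Lemma stairN K x : stair K (- x) = - stair K x.
Proof.
rewrite /stair opprD; congr (_ + _); rewrite -sumrN; apply: eq_bigr => k _.
by rewrite mulrN sinN mulNr.
Qed.

Lemma stair_half K : stair K 2^-1 = 2^-1.
Proof.
have := stairD1 K (- 2^-1); rewrite stairN (_ : - 2^-1 + 1 = 2^-1 :> R); last lra.
by move=> H; lra.
Qed.

(** Adding [(cos (M t) + e) / (M sin (pi t))] with [e = 1] or [e = -1] to the partial
    sum makes it monotone on [[x, 1/2]], because the oscillating part of the
    derivative cancels; comparing with the exact value [1/2] at the midpoint
    bounds the error on both sides. *)
Lemma stair_near_half K x : 0 < x <= 2^-1 ->
  `|stair K x - 2^-1| <= 2 / ((2 * K + 1)%:R * pi * sin (pi * x)).
Proof.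
move=> /andP[x0 xh]; have p0 := @pi_gt0 R.
have [M ME] : exists M, M = (2 * K + 1)%:R * pi :> R by eexists.
have M0 : 0 < M by rewrite ME mulr_gt0// ltr0n addn1.
have s0 t : x <= t <= 2^-1 -> 0 < sin (pi * t).
  move=> /andP[xt th]; apply: sin_gt0_pi.
  apply/andP; split; first by rewrite mulr_gt0// (lt_le_trans x0).
  by rewrite -[ltRHS]mulr1 ltr_pM2l//; lra.
have c0 t : x <= t <= 2^-1 -> 0 <= cos (pi * t).
  move=> /andP[xt th]; apply: cos_ge0_pihalf.
  have t0 : 0 <= t by lra.
  apply/andP; split; first by rewrite (@le_trans _ _ 0)// ?mulr_ge0//; lra.
  by rewrite ler_wpM2l//; lra.
(* The monotone correction of the partial sum. *)
pose H (e : R) t := stair K t + (cos (M * t) + e) * (sin (pi * t))^-1 / M.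
have dH e t : x <= t <= 2^-1 -> is_derive t 1 (H e)
   (- (cos (M * t) + e) * (pi * cos (pi * t)) / (M * sin (pi * t) ^+ 2)).
  move=> xt; have s0t := s0 t xt.
  have sn0 : sin (pi * t) != 0 by rewrite gt_eqF.
  have Mn0 : M != 0 by rewrite gt_eqF.
  have dinv : is_derive t 1 (fun t => (sin (pi * t))^-1)
      (- (sin (pi * t)) ^- 2 * (cos (pi * t) * pi)).
    apply: is_deriveV => //; der; ring.
  apply: (der_eq (derD (der_stair K t) (derM (derM (_ : is_derive t 1 (fun u => cos (M * u) + e) (- sin (M * t) * M)) dinv) (der_cst _ _ _)))).
    by der; ring.
  have -> : dirichlet K t = sin (M * t) / sin (pi * t).
    by rewrite ME -dirichletM mulfK.
  move: (pi : R) (cos (M * t)) (sin (M * t)) (sin (pi * t)) (cos (pi * t)) sn0.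
  by move=> p cM sM s c sn0; field; rewrite Mn0 sn0.
have Hh e : H e 2^-1 = 2^-1 + e / M.
  rewrite /H stair_half sin_pihalf invr1 mulr1.
  rewrite (_ : cos (M * 2^-1) = 0) ?add0r//.
  rewrite ME natrD natrM mulrDl mul1r mulrDl cosD cos_pihalf mulr0 sub0r.
  by rewrite (_ : 2 * K%:R * pi * 2^-1 = K%:R * pi) ?sin_natpi ?mul0r ?oppr0//; field.
have s0x : 0 < sin (pi * x) by apply: s0; rewrite lexx.
have H1 : H 1 2^-1 <= H 1 x.
  apply: (le0_derive_ge xh (fun t => @dH 1 t)) => {}t xt.
  rewrite !mulNr oppr_le0 divr_ge0//.
    by apply: mulr_ge0; [have := cos_geN1 (M * t); lra|apply: mulr_ge0; [exact: ltW|exact: c0]].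
  by rewrite mulr_ge0// ?sqr_ge0// ltW.
have H2 : H (-1) x <= H (-1) 2^-1.
  apply: (ge0_derive_le xh (fun t => @dH (-1) t)) => {}t xt.
  rewrite divr_ge0//.
    by apply: mulr_ge0; [have := cos_le1 (M * t); lra|apply: mulr_ge0; [exact: ltW|exact: c0]].
  by rewrite mulr_ge0// ?sqr_ge0// ltW.
move: H1 H2; rewrite !Hh /H.
rewrite -ME.
have -> : 2 / (M * sin (pi * x)) = 2 * ((sin (pi * x))^-1 / M).
  by rewrite invfM [_^-1 * _]mulrC.
rewrite -!mulrA.
have : 0 < M^-1 by rewrite invr_gt0.
have : 0 < (sin (pi * x))^-1 / M by rewrite divr_gt0// invr_gt0.
have := cos_le1 (M * x); have := cos_geN1 (M * x).
set c := cos _; set v := _ / M; set w := M^-1 => c1 c2 v0 w0.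
by rewrite ler_norml => h1 h2; apply/andP; split; nra.
Qed.

Lemma stair_le K x : 0 <= x -> `|stair K x| <= (2 * K + 1)%:R * x.
Proof.
move=> x0; rewrite natrD mulrDl mul1r addrC; apply: le_trans (ler_normD _ _) _.
rewrite (ger0_norm x0) lerD2l; apply: le_trans (ler_norm_sum _ _ _) _.
rewrite natrM (_ : 2 * K%:R * x = \sum_(k < K) 2 * x); last first.
  by rewrite sumr_const card_ord -[RHS]mulr_natr; ring.
apply: ler_sum => k _; have p0 := @pi_gt0 R.
have k0 : 0 < k.+1%:R :> R by [].
rewrite normrM normfV [X in _ / X]gtr0_norm ?mulr_gt0// ler_pdivrMr ?mulr_gt0//.
rewrite (le_trans (sin_le_abs _))// ger0_norm.
  by rewrite le_eqVlt; apply/orP; left; apply/eqP; ring.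
by rewrite !mulr_ge0// ltW.
Qed.

(** No Gibbs blow-up: the elementary bound [(2 K + 1) x] takes over from the previous
    one where [x] is smaller than [1 / (2 K + 1)], and the symmetry [x -> 1 - x]
    gives the other half. This makes the staircase usable under dominated
    convergence. *)
Lemma stair_bounded01 K x : 0 <= x <= 1 -> `|stair K x - 2^-1| <= 9.
Proof.
move=> /andP[x0 x1]; wlog xh : x x0 x1 / x <= 2^-1.
  move=> W; case: (leP x 2^-1) => [/W -> //|xh].
  have := W (1 - x) _ _ _; have -> : 1 - x = - x + 1 by ring.
  by rewrite stairD1 stairN -addrA -normrN (_ : - (_ + _) = stair K x - 2^-1); [apply; lra|lra].
have [Kx|Kx] := leP ((2 * K + 1)%:R * x) 1.
  apply: le_trans (ler_normB _ _) _; have := stair_le K x0.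
  by rewrite (@ger0_norm _ (2^-1))//; lra.
have p0 := @pi_gt0 R; have p2 := pi_ge2 R.
have x00 : 0 < x.
  by rewrite lt_def x0 andbT; apply/eqP => E; move: Kx; rewrite E mulr0 ltr10.
apply: le_trans (stair_near_half K _) _; first by rewrite x00.
have s1 : pi * x / 4 <= sin (pi * x).
  apply: sin_ge_quarter; apply/andP; split; first by rewrite mulr_ge0// ltW.
  by rewrite ler_wpM2l// ltW.
have pp : 1 <= pi * pi / 4 :> R by nra.
set M := (2 * K + 1)%:R : R.
have M0 : 0 < M by rewrite /M ltr0n addn1.
have h : 1 <= M * pi * sin (pi * x).
  apply: (@le_trans _ _ (M * pi * (pi * x / 4))); last first.
    by rewrite ler_wpM2l// mulr_ge0// ltW.
  rewrite (_ : _ * _ = (pi * pi / 4) * (M * x)); last by field.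
  by move: Kx pp; rewrite -/M; set u := M * x; set v := pi * pi / 4; nra.
by rewrite ler_pdivrMr; lra.
Qed.

Lemma stair_cvg01 x : 0 < x < 1 -> stair K x @[K --> \oo] --> (2^-1 : R).
Proof.
move=> /andP[x0 x1]; wlog xh : x x0 x1 / x <= 2^-1.
  move=> W; case: (leP x 2^-1) => [xh|xh]; first exact: W.
  rewrite (_ : (fun K => _) = (fun K => 1 - stair K (1 - x))); last first.
    by apply/funext => K; have := stairD1 K (-x); rewrite stairN addrC => ->; ring.
  rewrite [X in _ --> X](_ : _ = 1 - 2^-1 :> R); last lra.
  by apply: cvgB; [exact: cvg_cst|apply: W; lra].
have p0 := @pi_gt0 R.
have s0 : 0 < sin (pi * x).
  by apply: sin_gt0_pi; rewrite mulr_gt0//= -[ltRHS]mulr1 ltr_pM2l.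
apply/cvgrPdist_le => e e0; near=> K.
rewrite distrC; apply: le_trans (stair_near_half K _) _; first by rewrite x0.
rewrite ler_pdivrMr; last by rewrite !mulr_gt0// ltr0n addn1.
rewrite -ler_pdivrMl// -[leRHS]mulrA -ler_pdivrMr; last exact: mulr_gt0.
rewrite natrD natrM.
have : (e^-1 * 2) / (pi * sin (pi * x)) <= K%:R by near: K; exact: nbhs_infty_ger.
by have := ler0n R K; lra.
Unshelve. all: by end_near. Qed.

Lemma stair_bounded K x (n : nat) : n%:R <= x <= n%:R + 1 ->
  `|stair K x - (n%:R + 2^-1)| <= 9.
Proof.
move=> xn; have := @stair_bounded01 K (x - n%:R).
rewrite (_ : stair K x - _ = stair K (x - n%:R) - 2^-1); first by apply; lra.
by rewrite -[in LHS](subrK n%:R x) stairDn; ring.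
Qed.

Lemma stair_cvg x (n : nat) : n%:R < x < n%:R + 1 ->
  stair K x @[K --> \oo] --> (n%:R + 2^-1 : R).
Proof.
move=> xn; rewrite (_ : (fun K => _) = (fun K => n%:R + stair K (x - n%:R))).
  by apply: cvgD; [exact: cvg_cst|apply: stair_cvg01; lra].
by apply/funext => K; rewrite -[in LHS](subrK n%:R x) stairDn addrC.
Qed.

End staircase.

(** * Poisson summation on an interval *)
Lemma Rdominated_cvg d (T : measurableType d) (R : realType)
    (mu : {measure set T -> \bar R}) (D : set T) (f_ : nat -> T -> R)
    (f g : T -> R) : measurable D ->
  (forall n, measurable_fun D (f_ n)) -> measurable_fun D f ->
  {ae mu, forall x, D x -> f_ n x @[n --> \oo] --> f x} ->
  mu.-integrable D (EFin \o g) ->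
  (forall n x, D x -> `|f_ n x| <= g x) ->
  (\int[mu]_(x in D) f_ n x) @[n --> \oo] --> \int[mu]_(x in D) f x.
Proof.
move=> mD mf_ mf f_f ig fg.
have [||||| /integrableP[mF intf] _ lim] := @dominated_convergence _ T R mu D mD
  (fun n x => (f_ n x)%:E) (EFin \o f) (EFin \o g).
- by move=> n; apply/measurable_EFinP.
- exact/measurable_EFinP.
- by apply: filterS f_f => x h /h hx; apply: cvg_EFin => //; exact: nearW.
- exact: ig.
- by apply: aeW => x n Dx; rewrite lee_fin fg.
have intff : (\int[mu]_(x in D) (f x)%:E)%E \is a fin_num.
  apply: integrable_fin_num => //; exact/integrableP.
apply: fine_cvg.
by rewrite /Rintegral fineK.
Qed.

Lemma cvg_ext (R : realType) (u v : nat -> R) (l : R) : u =1 v ->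
  u n @[n --> \oo] --> l -> v n @[n --> \oo] --> l.
Proof. by move=> /funext ->. Qed.

Section real_sequences.
Context {R : realType}.
Implicit Types (u v : nat -> R) (a b c : R).

Lemma seq_cvgD u v a b : u n @[n --> \oo] --> a -> v n @[n --> \oo] --> b ->
  (u n + v n) @[n --> \oo] --> a + b.
Proof. exact: cvgD. Qed.

Lemma seq_cvgB u v a b : u n @[n --> \oo] --> a -> v n @[n --> \oo] --> b ->
  (u n - v n) @[n --> \oo] --> a - b.
Proof. exact: cvgB. Qed.

Lemma seq_cvgZ u c a : u n @[n --> \oo] --> a -> (c * u n) @[n --> \oo] --> c * a.
Proof. by apply: cvgM; exact: cvg_cst. Qed.

Lemma seq_cvg_sum (F : nat -> nat -> R) (l : nat -> R) (m : nat) :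
  (forall i, F i n @[n --> \oo] --> l i) ->
  (\sum_(i < m) F i n) @[n --> \oo] --> \sum_(i < m) l i.
Proof.
move=> H; elim: m => [|m IH].
  rewrite big_ord0; apply: (@cvg_ext _ (fun=> 0)) => [n|]; last exact: cvg_cst.
  by rewrite big_ord0.
rewrite big_ord_recr; apply: cvg_ext (seq_cvgD IH (H m)) => n.
by rewrite big_ord_recr.
Qed.

End real_sequences.

Section poisson.
Context {R : realType}.
Notation mu := (@lebesgue_measure R).
Implicit Types (f df phi : R -> R).

Lemma cont_measurable (A : set R) phi : continuous phi -> measurable_fun A phi.
Proof.
by move=> c; apply: (measurable_funS measurableT) => //; exact: continuous_measurable_fun.
Qed.

Lemma stair_continuous K : continuous (@stair R K).
Proof. exact: der_continuous (der_stair K). Qed.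

Lemma dirichlet_continuous K : continuous (@dirichlet R K).
Proof.
apply: contD; first exact: cont_cst.
by apply: (cont_sum (F := fun i y => 2 * cos (2 * pi * i.+1%:R * y))) => k; cont.
Qed.

Lemma stair_piece phi (n : nat) (x : R) : continuous phi ->
  n%:R <= x <= n%:R + 1 ->
  ri n%:R x (fun t => phi t * stair K t) @[K --> \oo] -->
  ri n%:R x phi * (n%:R + 2^-1).
Proof.
move=> cphi /andP[nx xn]; rewrite -riZr//.
have cs K : continuous (fun t => phi t * stair K t).
  by apply: contM => //; exact: stair_continuous.
rewrite /ri; refine (@Rdominated_cvg _ _ R mu `[n%:R, x] (fun K t => phi t * stair K t)
  (fun t => phi t * (n%:R + 2^-1)) (fun t => (n%:R + 10) * `|phi t|) _ _ _ _ _ _) => //.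
- by move=> K; exact: cont_measurable.
- by apply: cont_measurable; cont.
- exists [set (n%:R : R); n%:R + 1]; split.
  + by apply: measurableU; exact: measurable_set1.
  + exact/countable_lebesgue_measure0/finite_set_countable.
  + move=> t /=; apply: contra_notP => /not_orP[/eqP tn /eqP tn1].
    rewrite in_itv/= => /andP[nt tx]; apply: cvgM; first exact: cvg_cst.
    apply: stair_cvg; rewrite !lt_neqAle eq_sym tn nt tn1/= (le_trans tx)//.
- apply: cont_integrable; apply: contM; first exact: cont_cst.
  by move=> t; apply: continuous_comp; [exact: cphi|exact: norm_continuous].
- move=> K t; rewrite /= in_itv/= => /andP[nt tx].
  rewrite normrM mulrC ler_wpM2r//.
  have := @stair_bounded R K t n; rewrite nt (le_trans tx xn) => /(_ isT).
  by have := ler0n R n; rewrite !ler_norml; lra.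
Qed.

(** Abel summation: the integral of [df] against the staircase
    [floor t + 1/2] sums the values of [f] at the integers. *)
Lemma stair_limit f df (r x : R) (n : nat) : continuous f -> continuous df ->
  (forall t : R, 0 < t < r -> is_derive t 1 f (df t)) ->
  n%:R <= x <= n%:R + 1 -> x <= r ->
  ri 0 x (fun t => df t * stair K t) @[K --> \oo] -->
  f x * (n%:R + 2^-1) - f 0 / 2 - \sum_(j < n) f j.+1%:R.
Proof.
move=> cf cdf dfd; elim: n x => [|n IH] x /andP[nx xn] xr.
  rewrite big_ord0 subr0 add0r.
  rewrite (_ : f x * _ - _ = ri 0 x df * (0%:R + 2^-1)); last first.
    have dfx t : 0 < t < x -> is_derive t 1 f (df t).
      by move=> /andP[t0 tx]; apply: dfd; rewrite t0 (lt_le_trans tx).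
    by rewrite (ri_FTC_oo nx cf cdf dfx); field.
  have H := @stair_piece df 0%N x cdf; rewrite nx xn in H.
  exact: (H isT).
have n1 : n%:R + 1 = n.+1%:R :> R by rewrite -natr1.
have n0 := ler0n R n.
have := IH n.+1%:R _ (le_trans nx xr); rewrite n1 lexx andbT -n1 lerDl ler01.
move=> /(_ isT) H1.
have H2 := @stair_piece df n.+1 x cdf; rewrite nx xn in H2.
have dfx t : n.+1%:R < t < x -> is_derive t 1 f (df t).
  move=> /andP[t0 tx]; apply: dfd; rewrite (lt_le_trans tx)// andbT.
  by rewrite (lt_trans _ t0)// -n1; lra.
have E : f n.+1%:R * (n%:R + 2^-1) - f 0 / 2 - \sum_(j < n) f j.+1%:R
    + ri n.+1%:R x df * (n.+1%:R + 2^-1)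
    = f x * (n.+1%:R + 2^-1) - f 0 / 2 - \sum_(j < n.+1) f j.+1%:R.
  by rewrite (ri_FTC_oo nx cf cdf dfx) big_ord_recr/= -n1; field.
rewrite n1 in H1 *; rewrite -E.
have H3 := seq_cvgD H1 (H2 isT).
apply: cvg_ext H3 => K; rewrite (@ri_split _ 0 n.+1%:R x)//.
by apply: contM => //; exact: stair_continuous.
Qed.

Definition cosint f (r c : R) := 2 * ri 0 r (fun x => f x * cos (c * x)).

(** Poisson summation for an even function supported in [[-r, r]], the dual series
    being summed in its natural order: integrate the Dirichlet kernel by parts
    against the staircase and let the number of terms grow. *)
Lemma poisson f df (r : R) (n : nat) : continuous f -> continuous df ->
  (forall t : R, 0 < t < r -> is_derive t 1 f (df t)) -> f r = 0 ->
  n%:R <= r <= n%:R + 1 ->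
  (cosint f r 0 + 2 * \sum_(k < K) cosint f r (2 * pi * k.+1%:R)) @[K --> \oo] -->
  f 0 + 2 * \sum_(j < n) f j.+1%:R.
Proof.
move=> cf cdf dfd freq nr.
have r0 : 0 <= r by case/andP: nr => + _; apply: le_trans.
have H := @seq_cvgZ _ _ (-2) _ (stair_limit cf cdf dfd nr (lexx r)).
have <- : -2 * (f r * (n%:R + 2^-1) - f 0 / 2 - \sum_(j < n) f j.+1%:R)
    = f 0 + 2 * \sum_(j < n) f j.+1%:R by rewrite freq; field.
apply: cvg_ext H => K.
transitivity (2 * ri 0 r (fun x => f x * dirichlet K x)).
  have -> : ri 0 r (fun x => f x * dirichlet K x) =
    ri 0 r (fun x => f x * dirichlet K x + df x * stair K x) -
    ri 0 r (fun x => df x * stair K x).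
    rewrite riD; [ring| |].
      by apply: contM => //; exact: dirichlet_continuous.
    by apply: contM => //; exact: stair_continuous.
  have dfs t : 0 < t < r -> is_derive t 1 (fun x => f x * stair K x)
      (f t * dirichlet K t + df t * stair K t).
    by move=> /dfd dx; rewrite (mulrC (df t)); apply: derM => //; exact: der_stair.
  rewrite (ri_FTC_oo r0 _ _ dfs); first by rewrite freq stair0; ring.
  - by apply: contM => //; exact: stair_continuous.
  - apply: contD; apply: contM => //; first exact: dirichlet_continuous.
    exact: stair_continuous.
have cc k : continuous (fun x => f x * cos (2 * pi * k.+1%:R * x)) by apply: contM => //; cont.
rewrite /cosint mulr_sumr.
under [in RHS]eq_bigr => k _ do rewrite mulrA -mulrA -riZ//.
rewrite -mulr_sumr -mulrDr; congr (_ * _).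
rewrite -(ri_sum _ r0 (F := fun k x => 2 * (f x * cos (2 * pi * k.+1%:R * x)))); last first.
  by move=> k; apply: contM => //; cont.
rewrite -riD; last 2 first.
- by apply: contM => //; cont.
- by apply: (cont_sum (F := fun k x => 2 * (f x * cos (2 * pi * k.+1%:R * x)))) => k; apply: contM => //; cont.
apply: ri_ext => x _; rewrite mul0r cos0 /dirichlet mulrDr mulr_sumr.
by congr (_ + _); apply: eq_bigr => k _; ring.
Qed.
End poisson.

(** * Integrals over the circle *)
Section primitive.
Context {R : realType}.
Notation mu := (@lebesgue_measure R).
Implicit Types (f g F G u du : R -> R) (a b : R).

(** Primitives on the whole line turn every change of variable below into two
    applications of the fundamental theorem. *)
Lemma primitive G : continuous G ->
  exists F : R -> R, forall x : R, is_derive x 1 F (G x).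
Proof.
move=> cG; pose F x := if 0 <= x then ri 0 x G else - ri x 0 G.
exists F => x; pose A := - (`|x| + 1).
have A0 : A <= 0 by rewrite oppr_le0 addr_ge0.
have FA y : A <= y -> F y = ri A y G - ri A 0 G.
  rewrite /F => Ay; case: ifPn => [y0|]; first by rewrite (ri_split A0 y0 cG); ring.
  by rewrite -ltNge => /ltW y0; rewrite (ri_split Ay y0 cG); ring.
have Ax : A < x by rewrite /A ltrNl (le_lt_trans (ler_norm _))// normrN ltrDl.
have x1 : x < x + 1 by rewrite ltrDl.
have [dI eI] := @continuous_FTC1_closed R G A x (x + 1) x1
  (cont_integrable A (x + 1) cG) Ax (cG x).
have dF : is_derive x 1 (fun y => ri A y G - ri A 0 G) (G x).
  have d1 : is_derive x 1 (fun y => ri A y G) (G x).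
    by split; [exact: dI|rewrite -derive1E].
  by apply: (der_eq (derB d1 (der_cst _ _ _))); rewrite subr0.
apply: near_eq_is_derive dF.
by near=> y; apply/esym/FA/ltW; near: y; exact: lt_nbhsr.
Unshelve. all: by end_near. Qed.

Lemma ri_FTC_comp G u du a b : a <= b -> continuous G -> continuous du ->
  (forall x : R, is_derive x 1 u (du x)) ->
  forall F : R -> R, (forall x : R, is_derive x 1 F (G x)) ->
  ri a b (fun x => G (u x) * du x) = F (u b) - F (u a).
Proof.
move=> ab cG cdu dudu F dF.
apply: (@ri_FTC _ (fun x => F (u x))) => //.
  by apply: contM => //; apply: cont_comp => //; exact: der_continuous dudu.
Qed.

Lemma ri_reflect f (w a b : R) : a <= b -> continuous f ->
  ri a b (fun x => f (w - x)) = ri (w - b) (w - a) f.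
Proof.
move=> ab cf; have [F dF] := primitive cf.
have wab : w - b <= w - a by lra.
rewrite (ri_FTC wab cf dF).
have du (x : R) : is_derive x 1 (fun x => w - x) (-1) by der; ring.
have := ri_FTC_comp ab cf (@cont_cst _ _ _) du dF.
have -> : ri a b (fun x => f (w - x) * -1) = - ri a b (fun x => f (w - x)).
  rewrite -riN; last by apply: cont_comp => //; cont.
  by apply: ri_ext => x _; rewrite mulrN1.
by move=> H; apply: oppr_inj; rewrite H opprB.
Qed.

Definition circ f : R := ri 0 (2 * pi) f.
Definition per f := forall x, f (x + 2 * pi) = f x.

Lemma tau_ge0 : 0 <= 2 * pi :> R.
Proof. by have := @pi_gt0 R; lra. Qed.

Lemma circ_shift f (w : R) : continuous f -> per f ->
  circ (fun x => f (x + w)) = circ f.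
Proof.
move=> cf pf; have [F dF] := primitive cf.
have dG (x : R) : is_derive x 1 (fun x => F (x + 2 * pi) - F x) 0.
  have du : is_derive x 1 (fun x => x + 2 * pi) 1 by der; ring.
  by apply: (der_eq (derB (der_comp (dF _) du) (dF x))); rewrite pf; ring.
have cst x y := @is_derive_0_is_cst R _ x y dG.
rewrite /circ (ri_FTC tau_ge0 cf dF).
have dFw (x : R) : is_derive x 1 (fun x => F (x + w)) (f (x + w)).
  have du : is_derive x 1 (fun x => x + w) 1 by der; ring.
  by apply: (der_eq (der_comp (dF _) du)); ring.
have cfw : continuous (fun x => f (x + w)) by apply: cont_comp => //; cont.
rewrite (ri_FTC tau_ge0 cfw dFw).
by have := cst w 0; rewrite !add0r (addrC w) => ->.
Qed.

Lemma circ_reflect f : continuous f -> per f ->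
  circ (fun x => f (- x)) = circ f.
Proof.
move=> cf pf; rewrite /circ.
have -> : ri 0 (2 * pi) (fun x => f (- x)) = ri 0 (2 * pi) (fun x => f (2 * pi - x)).
  by apply: ri_ext => x _; rewrite -pf addrC.
by rewrite ri_reflect ?tau_ge0// subrr subr0.
Qed.

Lemma circ_quarter f : continuous f -> per f -> (forall x, f (- x) = f x) ->
  (forall x, f (pi - x) = f x) -> circ f = 4 * ri 0 (pi / 2) f.
Proof.
move=> cf pf f1 f2; have p0 := @pi_gt0 R.
rewrite /circ (@ri_split _ 0 pi)//; [|lra|lra].
have -> : ri pi (2 * pi) f = ri 0 pi f.
  have := @ri_reflect f (2 * pi) 0 pi (ltW p0) cf.
  rewrite subr0 (_ : 2 * pi - pi = pi); last by ring.
  move=> <-; apply: ri_ext => x _; by rewrite addrC pf f1.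
rewrite (@ri_split _ 0 (pi / 2) pi)//; [|lra|lra].
have -> : ri (pi / 2) pi f = ri 0 (pi / 2) f.
  have := @ri_reflect f pi 0 (pi / 2) _ cf; rewrite subr0 (_ : pi - pi / 2 = pi / 2); last by field.
  move=> <-; last by lra.
  by apply: ri_ext => x _; rewrite f2.
by ring.
Qed.

(** A periodic primitive takes the same value at both ends of the period. *)
Lemma circ_exact F f : continuous f -> (forall x : R, is_derive x 1 F (f x)) ->
  per F -> circ f = 0.
Proof.
move=> cf dF pF; rewrite /circ (ri_FTC tau_ge0 cf dF).
by rewrite -[in F (2 * pi)](add0r (2 * pi)) pF subrr.
Qed.

Lemma circD f g : continuous f -> continuous g ->
  circ (fun x => f x + g x) = circ f + circ g.
Proof. exact: riD. Qed.

Lemma circZ (c : R) f : continuous f -> circ (fun x => c * f x) = c * circ f.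
Proof. exact: riZ. Qed.

Lemma circ_ext f g : f =1 g -> circ f = circ g.
Proof. by move=> fg; apply: ri_ext => x _; exact: fg. Qed.

Lemma sin_per (x : R) : sin (x + 2 * pi) = sin x.
Proof. by rewrite mulr_natl; exact: sinD2pi. Qed.
Lemma cos_per (x : R) : cos (x + 2 * pi) = cos x.
Proof. by rewrite mulr_natl; exact: cosD2pi. Qed.

Lemma polar (b c : R) : exists t : R,
  b = Num.sqrt (b ^+ 2 + c ^+ 2) * cos t /\ c = Num.sqrt (b ^+ 2 + c ^+ 2) * sin t.
Proof.
set q := Num.sqrt _.
have qq : q ^+ 2 = b ^+ 2 + c ^+ 2 by rewrite sqr_sqrtr// addr_ge0// sqr_ge0.
have [q0|qn0] := eqVneq q 0.
  exists 0; move: qq; rewrite q0 !mul0r expr0n/= => /esym/eqP.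
  by rewrite paddr_eq0 ?sqr_ge0// !sqrf_eq0 => /andP[/eqP -> /eqP ->].
have q0 : 0 < q by rewrite lt_def qn0 sqrtr_ge0.
have bq : -1 <= b / q <= 1.
  rewrite ler_pdivlMr// ler_pdivrMr// mulN1r mul1r -ler_norml.
  by rewrite -(ger0_norm (ltW q0)) -ler_sqr ?nnegrE// !real_normK ?num_real// qq lerDl sqr_ge0.
have cb : cos (acos (b / q)) = b / q by rewrite acosK// in_itv.
have sb : q * sin (acos (b / q)) = `|c|.
  rewrite sin_acos// -sqrtr_sqr -{1}(ger0_norm (ltW q0)) -sqrtr_sqr -sqrtrM ?sqr_ge0//.
  by congr Num.sqrt; rewrite (_ : c ^+ 2 = q ^+ 2 - b ^+ 2); [field|rewrite qq; ring].
have [c0|c0] := leP 0 c.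
  by exists (acos (b / q)); rewrite cb sb ger0_norm//; split=> //; field.
exists (- acos (b / q)); rewrite cosN sinN mulrN sb cb ltr0_norm// opprK; split=> //; field.
by [].
Qed.

End primitive.

(** * The Fourier transform of a paraboloid over a disc *)
Section disc_transform.
Context {R : realType}.
Implicit Types (b c r rho t x y z : R).

(** The Fourier transform at [c] of the parabola [rho^2 - y^2] on [[-rho, rho]],
    and, as [h3], its value at [c = 0]. Both are odd in [rho], which makes the
    integrand of [cosint_circ] symmetric on the circle. *)
Definition hc c rho : R := - (4 * rho / c ^+ 2) * cos (c * rho) + 4 / c ^+ 3 * sin (c * rho).
Definition h3 rho : R := 4 / 3 * rho ^+ 3.

Lemma cosint_parabola rho c : 0 <= rho -> c != 0 ->
  cosint (fun y => rho ^+ 2 - y ^+ 2) rho c = hc c rho.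
Proof.
move=> r0 c0; rewrite /cosint.
pose F y := (rho ^+ 2 - y ^+ 2) * sin (c * y) * c^-1
  - 2 * y * cos (c * y) * c ^- 2 + 2 * sin (c * y) * c ^- 3.
have dF x : is_derive x 1 F ((rho ^+ 2 - x ^+ 2) * cos (c * x)).
  by rewrite /F; der; field.
rewrite (ri_FTC r0 _ dF); last by cont.
by rewrite /F /hc mulr0 sin0; field.
Qed.

Lemma cosint_parabola0 rho : 0 <= rho ->
  cosint (fun y => rho ^+ 2 - y ^+ 2) rho 0 = h3 rho.
Proof.
move=> r0; rewrite /cosint.
have dF x : is_derive x 1 (fun y => rho ^+ 2 * y - y ^+ 3 * 3^-1)
   ((rho ^+ 2 - x ^+ 2) * cos (0 * x)).
  by der; rewrite mul0r cos0; field.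
rewrite (ri_FTC r0 _ dF); last by cont.
by rewrite /h3; field.
Qed.

(** Summation over one coordinate of the lattice, at fixed value of the other. *)
Lemma inner_poisson rho (n : nat) : n%:R <= rho <= n%:R + 1 ->
  (h3 rho + 2 * \sum_(k < K) hc (2 * pi * k.+1%:R) rho) @[K --> \oo] -->
  rho ^+ 2 + 2 * \sum_(j < n) (rho ^+ 2 - j.+1%:R ^+ 2).
Proof.
move=> nr; have r0 : 0 <= rho by case/andP: nr => + _; apply: le_trans.
have := @poisson R (fun y => rho ^+ 2 - y ^+ 2) (fun y => - (2 * y)) rho n.
have d y : 0 < y < rho -> is_derive y 1 (fun y => rho ^+ 2 - y ^+ 2) (- (2 * y)).
  by move=> _; der; ring.
have c1 : continuous (fun y => rho ^+ 2 - y ^+ 2) by cont.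
have c2 : continuous (fun y => - (2 * y)) by cont.
move=> /(_ c1 c2 d (subrr _) nr); rewrite expr0n/= subr0.
apply: cvg_ext => K; rewrite cosint_parabola0//; congr (_ + _ * _).
apply: eq_bigr => k _; rewrite cosint_parabola//.
by rewrite mulf_neq0 ?pnatr_eq0// mulf_neq0 ?pnatr_eq0// gt_eqF// pi_gt0.
Qed.

Lemma ri_polar (G : R -> R) r : 0 <= r -> continuous G ->
  ri 0 r G = r * ri 0 (pi / 2) (fun t => G (r * cos t) * sin t).
Proof.
move=> r0 cG; have [F dF] := primitive cG.
have p0 : 0 <= pi / 2 :> R by have := @pi_gt0 R; lra.
have du t : is_derive t 1 (fun t => r * cos t) (- (r * sin t)) by der; ring.
have cdu : continuous (fun t => - (r * sin t)) by cont.
have H := ri_FTC_comp p0 cG cdu du dF.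
have cGs : continuous (fun t => G (r * cos t) * sin t).
  by apply: contM; [apply: cont_comp => //; cont|cont].
rewrite -riZ// ; apply: oppr_inj; rewrite -[RHS]riN; last by apply: contM => //; cont.
rewrite (ri_FTC r0 cG dF) opprB.
rewrite cos_pihalf cos0 mulr0 mulr1 in H; rewrite -H.
by apply: ri_ext => t _; ring.
Qed.

Lemma sqrt_circle r t : 0 <= r -> 0 <= sin t ->
  Num.sqrt (r ^+ 2 - (r * cos t) ^+ 2) = r * sin t.
Proof.
move=> r0 s0; rewrite (_ : _ - _ = (r * sin t) ^+ 2).
  by rewrite sqrtr_sqr ger0_norm// mulr_ge0.
by rewrite !exprMn sin2cos2; ring.
Qed.

(** The substitution [x = r cos t] removes the square root; the oddness of [H]
    makes the integrand symmetric in the four quadrants. *)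
Lemma cosint_circ (H : R -> R) r b : 0 <= r -> continuous H ->
  (forall x, H (- x) = - H x) ->
  cosint (fun x => H (Num.sqrt (r ^+ 2 - x ^+ 2))) r b =
  r / 2 * circ (fun t => H (r * sin t) * sin t * cos (b * r * cos t)).
Proof.
move=> r0 cH oH; have p0 := @pi_gt0 R.
have cA : continuous (fun t => H (r * sin t) * sin t * cos (b * r * cos t)).
  by apply: contM; [apply: contM; [apply: cont_comp => //|]|]; cont.
rewrite circ_quarter//.
- rewrite /cosint ri_polar//.
    rewrite (_ : ri 0 (pi / 2) _ = ri 0 (pi / 2) (fun t => H (r * sin t) * sin t * cos (b * r * cos t))).
      by field.
    apply: ri_ext => t /andP[t0 tp]; rewrite sqrt_circle//.
      by rewrite (mulrA b); ring.
    by apply: sin_ge0_pi; rewrite t0/=; lra.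
  by apply: contM; [apply: cont_comp => //|]; cont.
- by move=> t; rewrite sin_per cos_per.
- by move=> t; rewrite sinN cosN [r * - _]mulrN oH; ring.
- by move=> t; rewrite sinB cosB sinpi cospi !mul0r !mulN1r sub0r opprK addr0 mulrN cosN.
Qed.

(** [bessel2 z / pi] is twice the Bessel function of order two. *)
Definition bessel2 z : R := circ (fun t => (sin t ^+ 2 - cos t ^+ 2) * cos (z * cos t)).

Lemma hc_odd c x : hc c (- x) = - hc c x.
Proof. by rewrite /hc !mulrN cosN sinN; ring. Qed.

Lemma hc_continuous c : continuous (hc c).
Proof. by rewrite /hc; cont. Qed.

(** Writing [(b, c) = q (cos w, sin w)] and turning the circle by [w], the phase
    [b cos t + c sin t] becomes [q cos t]; what remains is an exact derivative
    and the odd part, which integrate to zero. *)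
Lemma circ_hc r b c : 0 < r -> c != 0 ->
  circ (fun t => hc c (r * sin t) * sin t * cos (b * r * cos t)) =
  4 * r / (b ^+ 2 + c ^+ 2) * bessel2 (r * Num.sqrt (b ^+ 2 + c ^+ 2)).
Proof.
move=> r0 c0; have [w [bw cw]] := polar b c.
have q2 : Num.sqrt (b ^+ 2 + c ^+ 2) ^+ 2 = b ^+ 2 + c ^+ 2.
  by rewrite sqr_sqrtr// addr_ge0// sqr_ge0.
move: bw cw q2; set q := Num.sqrt _ => bw cw q2.
have q0 : q != 0 by apply: contraNneq c0 => qz; rewrite cw qz mul0r.
have s0 : sin w != 0 by apply: contraNneq c0 => sz; rewrite cw sz mulr0.
rewrite -{}q2.
pose E t := - (4 * r / c ^+ 2) * sin t ^+ 2 * cos (b * r * cos t + c * r * sin t)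
  + 4 / c ^+ 3 * sin t * sin (b * r * cos t + c * r * sin t).
have cE : continuous E by rewrite /E; cont.
have pE : per E by move=> t; rewrite /E sin_per cos_per.
have cEN : continuous (fun t => E (- t)) := cont_comp cE (contN (@cont_id R)).
have -> : circ (fun t => hc c (r * sin t) * sin t * cos (b * r * cos t)) = circ E.
  apply: (mulfI (_ : 2 != 0)); first by rewrite pnatr_eq0.
  transitivity (circ E + circ (fun t => E (- t))); last first.
    by rewrite circ_reflect//; ring.
  rewrite -circD// -circZ; last first.
    by rewrite /hc; cont.
  apply: circ_ext => t; rewrite /E /hc sinN cosN !mulrN !(mulrA c r).
  by rewrite sinB cosB sinD cosD; field.
pose S t := sin t * cos w + cos t * sin w.
pose E1 t := - (4 * r / c ^+ 2) * S t ^+ 2 * cos (r * q * cos t)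
  + 4 / c ^+ 3 * S t * sin (r * q * cos t).
have EE1 t : E (t + w) = E1 t.
  rewrite /E /E1 sinD cosD -/(S t).
  suff -> : b * r * (cos t * cos w - sin t * sin w) + c * r * S t = r * q * cos t by [].
  rewrite {1}bw {1}cw /S.
  transitivity (r * q * cos t * (cos w ^+ 2 + sin w ^+ 2)); first by ring.
  by rewrite cos2Dsin2 mulr1.
have cE1 : continuous E1 by rewrite /E1 /S; cont.
have pE1 : per E1 by move=> t; rewrite -!EE1 -addrA (addrC _ w) addrA pE.
have cE1N : continuous (fun t => E1 (- t)) := cont_comp cE1 (contN (@cont_id R)).
rewrite -(circ_shift w cE pE) (circ_ext EE1).
apply: (mulfI (_ : 2 != 0)); first by rewrite pnatr_eq0.
transitivity (circ E1 + circ (fun t => E1 (- t))); first by rewrite circ_reflect//; ring.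
rewrite -circD//.
(* The even part of [E1] differs from the Bessel integrand by this exact derivative. *)
pose D t := 8 * sin w / c ^+ 3 * (cos t * sin (r * q * cos t) - r * q * sin t ^+ 2 * cos (r * q * cos t)).
have D0 : circ D = 0.
  apply: (@circ_exact _ (fun t => 8 * sin w / c ^+ 3 * (sin t * sin (r * q * cos t)))).
  - by rewrite /D; cont.
  - by move=> t; rewrite /D; der; ring.
  - by move=> t; rewrite sin_per cos_per.
have cB : continuous (fun t => (sin t ^+ 2 - cos t ^+ 2) * cos (r * q * cos t)) by cont.
transitivity (circ (fun t => 8 * r / q ^+ 2 * ((sin t ^+ 2 - cos t ^+ 2) * cos (r * q * cos t)) + D t)).
  apply: circ_ext => t; rewrite /E1 /D /S sinN cosN.
  have c2w : cos w ^+ 2 = 1 - sin w ^+ 2 by rewrite sin2cos2; ring.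
  transitivity (- (8 * r / c ^+ 2) * (sin t ^+ 2 * cos w ^+ 2 + cos t ^+ 2 * sin w ^+ 2) * cos (r * q * cos t)
     + 8 / c ^+ 3 * (cos t * sin w) * sin (r * q * cos t)); first by field.
  rewrite c2w cw; move: (cos (_ * cos t)) (sin (_ * cos t)) => C1 C2.
  by field; rewrite q0 s0.
rewrite circD; [|by cont|by rewrite /D; cont].
by rewrite D0 addr0 circZ// /bessel2; field.
Qed.

Lemma cosint_hc r b c : 0 < r -> c != 0 ->
  cosint (fun x => hc c (Num.sqrt (r ^+ 2 - x ^+ 2))) r b =
  2 * r ^+ 2 / (b ^+ 2 + c ^+ 2) * bessel2 (r * Num.sqrt (b ^+ 2 + c ^+ 2)).
Proof.
move=> r0 c0; rewrite cosint_circ ?ltW//; [|exact: hc_continuous|exact: hc_odd].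
rewrite circ_hc//; field.
by rewrite paddr_eq0 ?sqr_ge0// !sqrf_eq0 (negbTE c0) andbF.
Qed.

Lemma h3_odd x : h3 (- x) = - h3 x.
Proof. by rewrite /h3; ring. Qed.

Lemma h3_continuous : continuous h3.
Proof. by rewrite /h3; cont. Qed.

(** The case [c = 0] of [cosint_hc], where the general formula for [hc] degenerates:
    the same Bessel function is reached through two exact derivatives. *)
Lemma cosint_h3 r b : 0 < r -> 0 < b ->
  cosint (fun x => h3 (Num.sqrt (r ^+ 2 - x ^+ 2))) r b =
  2 * r ^+ 2 / (b ^+ 2 + 0 ^+ 2) * bessel2 (r * Num.sqrt (b ^+ 2 + 0 ^+ 2)).
Proof.
move=> r0 b0; rewrite cosint_circ ?ltW//; [|exact: h3_continuous|exact: h3_odd].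
rewrite expr0n/= addr0 sqrtr_sqr ger0_norm ?ltW//.
have rb : r * b != 0 by rewrite mulf_neq0 ?gt_eqF.
have [r1 b1] : r != 0 /\ b != 0 by rewrite !gt_eqF.
pose D t := (sin t ^+ 4 * cos (r * b * cos t) - 3 * sin t ^+ 2 * cos t * sin (r * b * cos t) / (r * b)).
have D0 : circ D = 0.
  apply: (@circ_exact _ (fun t => - (sin t ^+ 3 * sin (r * b * cos t)) / (r * b))).
  - by rewrite /D; cont.
  - by move=> t; rewrite /D; der; field; rewrite r1 b1.
  - by move=> t; rewrite sin_per cos_per.
pose D' t := (cos t ^+ 2 - sin t ^+ 2) * cos (r * b * cos t) / (r * b) + sin t ^+ 2 * cos t * sin (r * b * cos t).
have D'0 : circ D' = 0.
  apply: (@circ_exact _ (fun t => sin t * cos t * cos (r * b * cos t) / (r * b))).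
  - by rewrite /D'; cont.
  - by move=> t; rewrite /D'; der; field; rewrite r1 b1.
  - by move=> t; rewrite sin_per cos_per.
have cB : continuous (fun t => (sin t ^+ 2 - cos t ^+ 2) * cos (r * b * cos t)) by cont.
rewrite (_ : circ _ = circ (fun t => 4 / 3 * r ^+ 3 * (D t + 3 / (r * b) * (D' t
  + (r * b)^-1 * ((sin t ^+ 2 - cos t ^+ 2) * cos (r * b * cos t)))))); last first.
  by apply: circ_ext => t; rewrite /D /D' /h3 (mulrC b); field; rewrite r1 b1.
rewrite circZ; last by rewrite /D /D'; cont.
rewrite (circD (f := D)); [|by rewrite /D; cont|by rewrite /D'; cont].
rewrite circZ; last by rewrite /D'; cont.
rewrite (circD (f := D')); [|by rewrite /D'; cont|by cont].
by rewrite D0 D'0 !add0r circZ// -/(bessel2 (r * b)); field; rewrite r1 b1.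
Qed.

Lemma cosint_h30 r : 0 < r ->
  cosint (fun x => h3 (Num.sqrt (r ^+ 2 - x ^+ 2))) r 0 = pi * r ^+ 4 / 2.
Proof.
move=> r0; rewrite cosint_circ ?ltW//; [|exact: h3_continuous|exact: h3_odd].
pose D t := sin t ^+ 4 - 3 / 8.
have D0 : circ D = 0.
  apply: (@circ_exact _ (fun t => - (sin t ^+ 3 * cos t) / 4 - 3 / 8 * (sin t * cos t))).
  - by rewrite /D; cont.
  - move=> t; rewrite /D; der.
    have c2 : cos t ^+ 2 = 1 - sin t ^+ 2 by rewrite sin2cos2; ring.
    transitivity (sin t ^+ 4 / 4 + 3 / 8 * sin t ^+ 2 - (3 / 4 * sin t ^+ 2 + 3 / 8) * cos t ^+ 2); first by field.
    by rewrite c2; field.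
  - by move=> t; rewrite sin_per cos_per.
rewrite (_ : circ _ = circ (fun t => 4 / 3 * r ^+ 3 * (D t + 3 / 8))); last first.
  by apply: circ_ext => t; rewrite /D /h3 !mul0r cos0; field.
rewrite circZ; last by rewrite /D; cont.
rewrite (circD (f := D)); [|by rewrite /D; cont|by cont].
rewrite D0 /circ ri_cst ?tau_ge0//; move: (pi : R) => p; by field.
Qed.

End disc_transform.

(** * Asymptotics of the Bessel function of order two *)
Section bessel.
Context {R : realType}.
Implicit Types (x z t : R) (w k : R -> R).

(** Differentiation under the integral sign; the phase [p] lets the same statement
    give the derivatives of both sines and cosines. *)
Lemma der_circ_cos w k (p z : R) : continuous w -> continuous k ->
  is_derive z 1 (fun z => circ (fun t => w t * cos (z * k t + p)))
    (circ (fun t => w t * (- sin (z * k t + p) * k t))).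
Proof.
move=> cw ck; pose f (z t : R) := w t * cos (z * k t + p).
have cf x : continuous (f x).
  by apply: contM => //; apply: cont_cos; apply: contD; [apply: contM => //|]; cont.
have df x t : is_derive x 1 (f ^~ t) (w t * (- sin (x * k t + p) * k t)).
  by rewrite /f; der; ring.
have E x t : (partial1of2 f x t) = w t * (- sin (x * k t + p) * k t).
  by rewrite partial1of2E; exact: derive_val.
have zI : `]z - 1, z + 1[%classic z by rewrite /= in_itv/=; lra.
have mI : measurable (`[0, 2 * pi]%classic : set (measurableTypeR R)) by exact: measurable_itv.
have H1 x : `]z - 1, z + 1[%classic x -> lebesgue_measure.-integrable `[0, 2 * pi] (EFin \o f x).
  by move=> _; exact: cont_integrable.
have H2 x t : `]z - 1, z + 1[%classic x -> `[0, 2 * pi]%classic t -> derivable (f ^~ t) x 1.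
  by move=> _ _; have [] := df x t.
pose G t := `|w t| * `|k t|.
have G0 t : 0 <= G t by rewrite mulr_ge0.
have iG : lebesgue_measure.-integrable `[0, 2 * pi] (EFin \o G).
  apply: cont_integrable; apply: contM => t.
    by apply: continuous_comp; [exact: cw|exact: norm_continuous].
  by apply: continuous_comp; [exact: ck|exact: norm_continuous].
have GE x t : `]z - 1, z + 1[%classic x -> `[0, 2 * pi]%classic t -> `|partial1of2 f x t| <= G t.
  move=> _ _; rewrite E /G normrM ler_wpM2l// normrM normrN.
  by rewrite -[leRHS]mul1r ler_wpM2r// sin_max.
have D1 := derivable_under_integral mI zI H1 H2 G0 iG GE.
have D2 := differentiation_under_integral mI zI H1 H2 G0 iG GE.
split; first exact: D1.
rewrite derive1E in D2.
apply: etrans D2 _; rewrite /circ /ri; apply: eq_Rintegral => t _; exact: E.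
Qed.

Let wt t : R := sin t ^+ 2 - cos t ^+ 2.
Let b1 z := circ (fun t => wt t * (- sin (z * cos t) * cos t)).
Let b2 z := circ (fun t => wt t * cos t * (- cos (z * cos t) * cos t)).

Let cwt : continuous wt. Proof. by rewrite /wt; cont. Qed.

Let der_bf z : is_derive z 1 bessel2 (b1 z).
Proof.
have := @der_circ_cos wt cos 0 z cwt (@continuous_cos R).
rewrite /b1; under [in X in X -> _]eq_fun do under eq_fun do rewrite addr0.
by under [in X in X -> _]circ_ext do rewrite addr0.
Qed.

Let der_b1 z : is_derive z 1 b1 (b2 z).
Proof.
have c1 : continuous (fun t => wt t * cos t) by rewrite /wt; cont.
have := @der_circ_cos (fun t => wt t * cos t) cos (pi / 2) z c1 (@continuous_cos R).
have -> : (fun z => circ (fun t => wt t * cos t * cos (z * cos t + pi / 2))) = b1.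
  by apply/funext => x; apply: circ_ext => t; rewrite cosDpihalf; ring.
by have -> : circ (fun t => wt t * cos t * (- sin (z * cos t + pi / 2) * cos t)) = b2 z
  by apply: circ_ext => t; rewrite sinDpihalf; ring.
Qed.

(** Bessel's equation of order two. The combination is the derivative of a periodic
    function of the angle. *)
Lemma bessel_ode z : z ^+ 2 * b2 z + z * b1 z + (z ^+ 2 - 4) * bessel2 z = 0.
Proof.
have c0 : continuous (fun t => (sin t ^+ 2 - cos t ^+ 2) * cos (z * cos t)) by cont.
have c1 : continuous (fun t => wt t * (- sin (z * cos t) * cos t)) by rewrite /wt; cont.
have c2 : continuous (fun t => wt t * cos t * (- cos (z * cos t) * cos t)).
  by rewrite /wt; cont.
rewrite /b2 /b1 /bessel2 -!circZ//.
have c3 : continuous (fun t => z ^+ 2 * (wt t * cos t * (- cos (z * cos t) * cos t))) by rewrite /wt; cont.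
have c4 : continuous (fun t => z * (wt t * (- sin (z * cos t) * cos t))) by rewrite /wt; cont.
rewrite -(circD c3 c4) -circD; [|by rewrite /wt; cont|by cont].
pose F t := - (wt t * (z * sin t * sin (z * cos t)) - 4 * sin t * cos t * cos (z * cos t)).
apply: (@circ_exact _ F).
- by rewrite /wt; cont.
- move=> t; rewrite /F /wt; der.
  apply/eqP; rewrite -subr_eq0; apply/eqP.
  transitivity (wt t * z ^+ 2 * cos (z * cos t) * (cos t ^+ 2 + sin t ^+ 2 - 1)).
    by rewrite /wt; ring.
  by rewrite cos2Dsin2 subrr mulr0.
- by move=> t; rewrite /F /wt sin_per cos_per.
Qed.

(** [P z - K / z] increases, [P z + K / z] decreases, and the limit is caught between
    them. *)
Lemma limit_of_small_derivative (P dP : R -> R) (K : R) :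
  (forall z, 1 <= z -> is_derive z 1 P (dP z)) ->
  (forall z, 1 <= z -> `|dP z| <= K / z ^+ 2) ->
  exists l, forall z, 1 <= z -> `|P z - l| <= K / z.
Proof.
move=> dPP bP.
have K0 : 0 <= K.
  by have := bP 1 (lexx _); rewrite expr1n divr1; apply: le_trans.
have dinv (e z : R) : 1 <= z -> is_derive z 1 (fun z => P z + e * z^-1) (dP z - e / z ^+ 2).
  move=> z1; have zn0 : z != 0 by rewrite gt_eqF// (lt_le_trans _ z1).
  have d1 : is_derive z 1 (fun z : R => z^-1) (- (z ^- 2) * 1).
    by apply: (@is_deriveV _ (fun z => z)).
  notypeclasses refine (der_eq (derD (dPP z z1) (derM (der_cst e _ _) d1)) _).
  by field.
have up y z : 1 <= y -> y <= z -> P y - K / y <= P z - K / z.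
  move=> y1 yz; rewrite -!mulNr.
  apply: (ge0_derive_le yz (f := fun z => P z + - K * z^-1) (df := fun z => dP z - - K / z ^+ 2)).
    by move=> x /andP[yx _]; apply: dinv; exact: le_trans yx.
  move=> x /andP[yx _]; have := bP x (le_trans y1 yx); rewrite ler_norml => /andP[+ _].
  by rewrite mulNr opprK => ?; lra.
have dn y z : 1 <= y -> y <= z -> P z + K / z <= P y + K / y.
  move=> y1 yz.
  apply: (le0_derive_ge yz (f := fun z => P z + K * z^-1) (df := fun z => dP z - K / z ^+ 2)).
    by move=> x /andP[yx _]; apply: dinv; exact: le_trans yx.
  move=> x /andP[yx _]; have := bP x (le_trans y1 yx); rewrite ler_norml => /andP[_ +].
  by rewrite subr_le0.
have ud y z : 1 <= y -> 1 <= z -> P y - K / y <= P z + K / z.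
  move=> y1 z1; have z0 : 0 <= K / z by rewrite divr_ge0// (le_trans _ z1).
  have y0 : 0 <= K / y by rewrite divr_ge0// (le_trans _ y1).
  have [yz|/ltW zy] := leP y z; first by have := up _ _ y1 yz; lra.
  by have := dn _ _ z1 zy; lra.
pose A := [set P z - K / z | z in [set z | 1 <= z]].
have hA : has_sup A.
  split; first by exists (P 1 - K / 1), 1 => //=.
  by exists (P 1 + K / 1) => _ [z /= z1 <-]; exact: ud.
exists (sup A) => z z1.
have h1 : sup A <= P z + K / z.
  by apply: ge_sup; [case: hA|move=> _ [y /= y1 <-]; exact: ud].
have h2 : P z - K / z <= sup A by apply: ub_le_sup; [case: hA|exists z].
by rewrite ler_norml; lra.
Qed.

(** [W = sqrt z * bessel2 z] satisfies [W'' + W = 15/4 z^-2 W], so that the energy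
    [W^2 + W'^2] is bounded and the phase-space coordinates
    [W cos z - W' sin z] and [W sin z + W' cos z] converge at rate [1/z]. *)
Lemma bessel2_asymptotics : exists al be C : R, forall z, 1 <= z ->
  `|bessel2 z - (al * cos z + be * sin z) / Num.sqrt z| <= C / z.
Proof.
pose W z := Num.sqrt z * bessel2 z.
pose V z := Num.sqrt z * b1 z + bessel2 z / (2 * Num.sqrt z).
pose k : R := 15 / 4.
have s0 z : 1 <= z -> 0 < Num.sqrt z by move=> z1; rewrite sqrtr_gt0 (lt_le_trans _ z1).
have dsq z : 1 <= z -> is_derive z 1 Num.sqrt (2 * Num.sqrt z)^-1.
  by move=> z1; apply: is_derive1_sqrt; rewrite (lt_le_trans _ z1).
have dW z : 1 <= z -> is_derive z 1 W (V z).
  move=> z1; apply: (der_eq (derM (dsq z z1) (der_bf z))); by rewrite /V; ring.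
have dV z : 1 <= z -> is_derive z 1 V (- W z + k * W z / z ^+ 2).
  move=> z1; have sz := s0 z z1.
  have d2s : is_derive z 1 (fun z => 2 * Num.sqrt z) (Num.sqrt z)^-1.
    apply: (der_eq (derM (der_cst 2 z 1) (dsq z z1))).
    by move: sz; move: (Num.sqrt z) => s sz; field; rewrite gt_eqF.
  have dis : is_derive z 1 (fun z => (2 * Num.sqrt z)^-1) (- ((2 * Num.sqrt z) ^- 2) * (Num.sqrt z)^-1).
    by apply: is_deriveV => //; rewrite mulf_neq0 ?pnatr_eq0// gt_eqF.
  apply: (der_eq (derD (derM (dsq z z1) (der_b1 z)) (derM (der_bf z) dis))).
  have ode := bessel_ode z.
  have z0 : z != 0 by rewrite gt_eqF// (lt_le_trans _ z1).
  have -> : b2 z = - (z * b1 z + (z ^+ 2 - 4) * bessel2 z) / z ^+ 2.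
    apply: (mulfI (_ : z ^+ 2 != 0)); first by rewrite expf_neq0.
    by rewrite mulrCA divff ?expf_neq0// mulr1; move: ode => /eqP; rewrite -addrA addr_eq0 => /eqP.
  rewrite /W /k.
  have zs : z = Num.sqrt z ^+ 2 by rewrite sqr_sqrtr// (le_trans _ z1).
  move: sz zs z0; move: (Num.sqrt z) (b1 z) (bessel2 z) => s B1 B sz -> _.
  by field; rewrite gt_eqF.
pose S z := W z ^+ 2 + V z ^+ 2.
have S0 z : 0 <= S z by rewrite addr_ge0 ?sqr_ge0.
have dS z : 1 <= z -> is_derive z 1 S (2 * k * W z * V z / z ^+ 2).
  move=> z1; apply: (der_eq (derD (derX 2 (dW z z1)) (derX 2 (dV z z1)))).
  by rewrite /=; ring.
have Sb z : 1 <= z -> S z <= S 1 * expR k.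
  move=> z1.
  (* Gronwall's inequality with the integrable coefficient [k / x^2]. *)
  pose T z := S z * expR (k * z^-1).
  have dT x : 1 <= x <= z -> is_derive x 1 T
     ((2 * W x * V x - S x) * k / x ^+ 2 * expR (k * x^-1)).
    move=> /andP[x1 _]; have xn0 : x != 0 by rewrite gt_eqF// (lt_le_trans _ x1).
    have d1 : is_derive x 1 (fun z : R => z^-1) (- (x ^- 2) * 1).
      by apply: (@is_deriveV _ (fun z => z)).
    have d2 : is_derive x 1 (fun z : R => expR (k * z^-1)) (expR (k * x^-1) * (- k / x ^+ 2)).
      apply: (der_comp (is_derive_expR _)).
      by apply: (der_eq (derM (der_cst k _ _) d1)); field.
    apply: (der_eq (derM (dS x x1) d2)); by field.
  have k0 : 0 <= k by rewrite /k; lra.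
  have H : T z <= T 1.
    apply: (le0_derive_ge z1 dT) => x /andP[x1 _].
    rewrite mulr_le0_ge0 ?expR_ge0// mulr_le0_ge0 ?invr_ge0 ?sqr_ge0// mulr_le0_ge0//.
    by rewrite /S; have := sqr_ge0 (W x - V x); nra.
  have := H; rewrite /T invr1 mulr1; apply: le_trans.
  rewrite ler_peMr// -expR0 ler_expR mulr_ge0// invr_ge0; exact: le_trans z1.
pose M := Num.sqrt (S 1 * expR k).
have WM z : 1 <= z -> `|W z| <= M.
  move=> z1; rewrite -sqrtr_sqr ler_wsqrtr// (le_trans _ (Sb z z1))// lerDl sqr_ge0 //.
pose P z := W z * cos z - V z * sin z.
pose Q z := W z * sin z + V z * cos z.
have dP z : 1 <= z -> is_derive z 1 P (- (k * W z / z ^+ 2 * sin z)).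
  move=> z1; apply: (der_eq (derB (derM (dW z z1) (is_derive_cos z)) (derM (dV z z1) (is_derive_sin z)))).
  by ring.
have dQ z : 1 <= z -> is_derive z 1 Q (k * W z / z ^+ 2 * cos z).
  move=> z1; apply: (der_eq (derD (derM (dW z z1) (is_derive_sin z)) (derM (dV z z1) (is_derive_cos z)))).
  by ring.
have kW z : 1 <= z -> `|k * W z / z ^+ 2| <= k * M / z ^+ 2.
  move=> z1; have k0 : 0 <= k by rewrite /k; lra.
  rewrite normrM normfV (ger0_norm (sqr_ge0 z)) ler_wpM2r ?invr_ge0 ?sqr_ge0//.
  by rewrite normrM ger0_norm// ler_wpM2l// WM.
have [al Pal] : exists l, forall z, 1 <= z -> `|P z - l| <= k * M / z.
  apply: limit_of_small_derivative dP _ => z z1.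
  rewrite normrN normrM -[leRHS]mulr1 ler_pM//; [exact: kW|exact: sin_max].
have [be Qbe] : exists l, forall z, 1 <= z -> `|Q z - l| <= k * M / z.
  apply: limit_of_small_derivative dQ _ => z z1.
  rewrite normrM -[leRHS]mulr1 ler_pM//; [exact: kW|exact: cos_max].
exists al, be, (2 * (k * M)) => z z1; have sz := s0 z z1.
have szn : Num.sqrt z != 0 by rewrite gt_eqF.
have -> : bessel2 z = W z / Num.sqrt z by rewrite /W mulrC mulKf.
rewrite -mulrBl normrM.
have -> : W z - (al * cos z + be * sin z) = (P z - al) * cos z + (Q z - be) * sin z.
  transitivity (W z * (cos z ^+ 2 + sin z ^+ 2) - (al * cos z + be * sin z)).
    by rewrite cos2Dsin2 mulr1.
  by rewrite /P /Q; ring.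
have h1 : `|(P z - al) * cos z + (Q z - be) * sin z| <= 2 * (k * M) / z.
  apply: le_trans (ler_normD _ _) _.
  rewrite (_ : 2 * (k * M) / z = k * M / z + k * M / z); last by ring.
  by apply: lerD; rewrite normrM -[leRHS]mulr1 ler_pM// ?Pal ?Qbe// ?cos_max ?sin_max.
apply: le_trans h1; rewrite ler_piMr// normfV gtr0_norm//.
by rewrite invf_le1// -sqrtr1 ler_wsqrtr.
Qed.

End bessel.

(** * Absolutely convergent double series *)
Section sequences_facts.
Context {R : realType}.
Implicit Types (s w u v : nat -> R).

Lemma seq_le_lim s (l B : R) (N : nat) : s n @[n --> \oo] --> l ->
  (forall n, (N <= n)%N -> s n <= B) -> l <= B.
Proof.
move=> sl sB; apply: cvgr_to_le sl _; near=> n; apply: sB; near: n; exact: nbhs_infty_ge.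
Unshelve. all: by end_near. Qed.

Lemma seq_ge_lim s (l B : R) (N : nat) : s n @[n --> \oo] --> l ->
  (forall n, (N <= n)%N -> B <= s n) -> B <= l.
Proof.
move=> sl sB; apply: cvgr_to_ge sl _; near=> n; apply: sB; near: n; exact: nbhs_infty_ge.
Unshelve. all: by end_near. Qed.

Lemma seq_norm_lim s (l c B : R) (N : nat) : s n @[n --> \oo] --> l ->
  (forall n, (N <= n)%N -> `|s n - c| <= B) -> `|l - c| <= B.
Proof.
move=> sl sB; rewrite ler_distl; apply/andP; split.
  apply: (seq_ge_lim sl (N := N)) => n /sB; rewrite ler_distl => /andP[+ _].
  by [].
by apply: (seq_le_lim sl (N := N)) => n /sB; rewrite ler_distl => /andP[].
Qed.

Lemma bounded_increasing_cvg w (B : R) : (forall n, w n <= w n.+1) ->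
  (forall n, w n <= B) -> exists2 om, w n @[n --> \oo] --> om & forall n, w n <= om.
Proof.
move=> wi wB.
have nd : nondecreasing_seq w by apply/nondecreasing_seqP.
have cw : cvgn w.
  by apply: nondecreasing_is_cvgn => //; exists B => _ [n _ <-].
exists (limn w); first exact: cw.
by move=> n; exact: nondecreasing_cvgn_le.
Qed.

(** Comparison with an increasing convergent sequence: [s + w] is again increasing
    and bounded, so that its limit minus that of [w] is the limit of [s], with the
    explicit rate that uniform convergence will require. *)
Lemma majorized_cvg s w (om : R) : w n @[n --> \oo] --> om -> (forall n, w n <= om) ->
  (forall n, `|s n.+1 - s n| <= w n.+1 - w n) ->
  exists2 l, s n @[n --> \oo] --> l & forall n, `|l - s n| <= om - w n.
Proof.
move=> wom wle sw.
have step m n : `|s (n + m)%N - s n| <= w (n + m)%N - w n.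
  elim: m => [|m IH]; first by rewrite addn0 !subrr normr0.
  rewrite addnS; have := sw (n + m)%N; move: IH; set x := s _; set y := s _.
  by rewrite !ler_distl; lra.
have [p pl pm] : exists2 p, s n + w n @[n --> \oo] --> p & forall n, s n + w n <= p.
  apply: (@bounded_increasing_cvg _ (s 0%N - w 0%N + om + om)) => n.
    by have := sw n; rewrite ler_distl; lra.
  have := step n 0%N; rewrite add0n ler_distl; have := wle n; lra.
have sl : s n @[n --> \oo] --> p - om.
  by apply: cvg_ext (seq_cvgB pl wom) => n; ring.
exists (p - om) => // n.
apply: (seq_norm_lim sl (N := n)) => m nm.
rewrite -(subnKC nm); apply: le_trans (step _ _) _.
by rewrite lerB.
Qed.

Lemma sum_le_widen (f : nat -> R) (n m : nat) : (n <= m)%N ->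
  (forall i, (n <= i)%N -> 0 <= f i) -> \sum_(i < n) f i <= \sum_(i < m) f i.
Proof.
move=> nm f0; rewrite -(subnKC nm) big_split_ord/= lerDl.
by apply: sumr_ge0 => i _; apply: f0; rewrite leq_addr.
Qed.

Section double.
Variables (F : nat -> nat -> R) (v : nat -> R) (om : R).
Hypothesis v0 : forall k, 0 <= v k.
Hypothesis Fv : forall k l, (0 < k + l)%N -> `|F k l| <= v k * v l.
Let U n := \sum_(k < n) v k.
Hypothesis Uom : U n @[n --> \oo] --> om.
Hypothesis Ule : forall n, U n <= om.

(** Rectangular partial sums, the first index summed innermost. Poisson summation
    yields the iterated sum, while almost periodicity is read on the square sums;
    domination by a product [v k * v l] lets one pass from one to the other. *)
Definition rectsum (K L : nat) := \sum_(l < L) \sum_(k < K) F k l.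

Let UU K L : \sum_(l < L) \sum_(k < K) v k * v l = U K * U L.
Proof.
by rewrite mulr_sumr; apply: eq_bigr => l _; rewrite mulr_suml.
Qed.

(** Adding or subtracting [F] to its majorant gives nonnegative terms, whose sum
    can only grow with the rectangle. *)
Lemma rectsum_diff (n K L : nat) : (0 < n)%N -> (n <= K)%N -> (n <= L)%N ->
  `|rectsum K L - rectsum n n| <= U K * U L - U n * U n.
Proof.
move=> n0 nK nL.
have H (e : R) : `|e| = 1 ->
   rectsum n n * e + U n * U n <= rectsum K L * e + U K * U L.
  move=> e1; rewrite -!UU /rectsum !mulr_suml -!big_split/=.
  have pos k l : (0 < k + l)%N -> 0 <= F k l * e + v k * v l.
    move=> kl; have : `|F k l * e| <= v k * v l by rewrite normrM e1 mulr1 Fv.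
    by rewrite ler_norml => /andP[+ _]; rewrite -subr_ge0 opprK.
  have E M N : \sum_(i < N) ((\sum_(k < M) F k i) * e + \sum_(k < M) v k * v i) =
     \sum_(l < N) \sum_(k < M) (F k l * e + v k * v l).
    by apply: eq_bigr => l _; rewrite mulr_suml -big_split.
  rewrite !E; apply: (@le_trans _ _ (\sum_(l < n) \sum_(k < K) (F k l * e + v k * v l))).
    apply: ler_sum => l _.
    apply: (@sum_le_widen (fun k => F k l * e + v k * v l)) => // k nk.
    by apply: pos; rewrite ltn_addr// (leq_trans n0).
  apply: (@sum_le_widen (fun l => \sum_(k < K) (F k l * e + v k * v l))) => // l nl.
  by apply: sumr_ge0 => k _; apply: pos; rewrite ltn_addl// (leq_trans n0).
have := H 1 (normr1 _); have := H (-1); rewrite normrN normr1 => /(_ erefl).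
by rewrite ler_norml; lra.
Qed.

Lemma rectsum_om K L : U K * U L <= om * om.
Proof.
have U0 n : 0 <= U n by apply: sumr_ge0.
by apply: ler_pM.
Qed.

Lemma iterated_sum_square (G : nat -> R) (M : R) :
  (forall l, \sum_(k < K) F k l @[K --> \oo] --> G l) ->
  \sum_(l < L) G l @[L --> \oo] --> M ->
  forall n, (0 < n)%N -> `|M - rectsum n n| <= om * om - U n * U n.
Proof.
move=> FG GM n n0; apply: (seq_norm_lim GM (N := n)) => L nL.
have HK : rectsum K L @[K --> \oo] --> \sum_(l < L) G l.
  exact: (@seq_cvg_sum R (fun l K => \sum_(k < K) F k l) G L).
apply: (seq_norm_lim HK (N := n)) => K nK.
by apply: le_trans (rectsum_diff n0 nK nL) _; rewrite lerB// rectsum_om.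
Qed.

Lemma square_sum_cvg : exists2 l, rectsum n.+1 n.+1 @[n --> \oo] --> l &
  forall n, `|l - rectsum n.+1 n.+1| <= om * om - U n.+1 * U n.+1.
Proof.
apply: (@majorized_cvg (fun n => rectsum n.+1 n.+1) (fun n => U n.+1 * U n.+1)).
- by apply: cvgM; rewrite (cvg_shiftS U).
- by move=> n; exact: rectsum_om.
- by move=> n; apply: rectsum_diff.
Qed.

Lemma majorant_gap_cvg0 : om * om - U n.+1 * U n.+1 @[n --> \oo] --> (0 : R).
Proof.
rewrite -[X in _ --> X](subrr (om * om)).
apply: cvgB; first exact: cvg_cst.
by apply: cvgM; rewrite (cvg_shiftS U).
Qed.

End double.
End sequences_facts.

Section weights.
Context {R : realType}.

(** Fourth roots by iterated square roots, so that every exponent in play is handled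
    algebraically. *)
Definition root4 (x : R) : R := Num.sqrt (Num.sqrt x).

Lemma root4_4 (x : R) : 0 <= x -> root4 x ^+ 4 = x.
Proof.
move=> x0; rewrite (exprM _ 2 2) sqr_sqrtr ?sqrtr_ge0// sqr_sqrtr//.
Qed.

Lemma root4_ge0 (x : R) : 0 <= root4 x. Proof. exact: sqrtr_ge0. Qed.

Lemma root4_gt0 (x : R) : 0 < x -> 0 < root4 x.
Proof. by move=> x0; rewrite !sqrtr_gt0. Qed.

Lemma root4M (x y : R) : 0 <= x -> root4 (x * y) = root4 x * root4 y.
Proof. by move=> x0; rewrite /root4 sqrtrM// sqrtrM// sqrtr_ge0. Qed.

Lemma ler_root4 (x y : R) : 0 <= y -> x <= y -> root4 x <= root4 y.
Proof. by move=> y0 xy; rewrite /root4 !ler_wsqrtr. Qed.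

(** [x^(5/4)] *)
Definition pow54 (x : R) : R := x * root4 x.

Lemma pow54_gt0 (x : R) : 0 < x -> 0 < pow54 x.
Proof. by move=> x0; rewrite mulr_gt0// root4_gt0. Qed.

Lemma pow54M (x y : R) : 0 <= x -> pow54 (x * y) = pow54 x * pow54 y.
Proof. by move=> x0; rewrite /pow54 root4M//; ring. Qed.

Lemma ler_pow54 (x y : R) : 0 <= x -> x <= y -> pow54 x <= pow54 y.
Proof.
move=> x0 xy; have y0 := le_trans x0 xy.
by rewrite ler_pM ?root4_ge0// ler_root4.
Qed.

(** The exponent [5/4] is half of the decay [5/2] of the Fourier coefficients of the
    paraboloid: a product of two such weights dominates them, and [5/4 > 1] makes
    the weights summable. *)
Definition weight (k : nat) : R := (pow54 (maxn 1 k)%:R)^-1.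

Lemma weight_ge0 k : 0 <= weight k.
Proof. by rewrite invr_ge0 ltW// pow54_gt0// ltr0n leq_max. Qed.

(** [k^(-5/4)] is at most four times the increment of [- k^(-1/4)]. *)
Lemma weight_telescope (k : nat) : (0 < k)%N ->
  weight k.+1 <= 4 * ((root4 k%:R)^-1 - (root4 k.+1%:R)^-1).
Proof.
move=> k0; rewrite /weight (maxn_idPr _)// /pow54.
have kp : 0 < k%:R :> R by rewrite ltr0n.
have x0 := root4_gt0 kp.
have y0 : 0 < root4 k.+1%:R :> R by rewrite root4_gt0.
have xy : root4 k%:R <= root4 k.+1%:R :> R by rewrite ler_root4// ler_nat.
have : root4 k.+1%:R ^+ 4 = root4 k%:R ^+ 4 + 1 :> R.
  by rewrite !root4_4// -natr1.
have yk : k.+1%:R = root4 k.+1%:R ^+ 4 :> R by rewrite root4_4.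
move: x0 y0 xy yk; set x := root4 k%:R; set y := root4 k.+1%:R => x0 y0 xy yk e.
rewrite [X in (X * _)^-1]yk.
have -> : 4 * (x^-1 - y^-1) = 4 * (y - x) / (x * y).
  by field; rewrite !gt_eqF.
rewrite -[leLHS]mul1r ler_pdivrMr ?mulr_gt0 ?exprn_gt0//.
rewrite mulrAC ler_pdivlMr ?mulr_gt0//.
have : 1 <= 4 * (y - x) * y ^+ 3.
  have e1 : (y - x) * (y ^+ 3 + y ^+ 2 * x + y * x ^+ 2 + x ^+ 3) = 1.
    by transitivity (y ^+ 4 - x ^+ 4); [ring|rewrite e; ring].
  rewrite -[leLHS]e1.
  rewrite (_ : 4 * (y - x) * y ^+ 3 = (y - x) * (4 * y ^+ 3)); last by ring.
  apply: ler_wpM2l; first by rewrite subr_ge0.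
  have h1 : y ^+ 2 * x <= y ^+ 3 by rewrite [leRHS]exprSr ler_wpM2l// sqr_ge0.
  have h2 : y * x ^+ 2 <= y ^+ 3.
    by rewrite [leRHS]exprS ler_wpM2l ?(ltW y0)// ler_sqr ?nnegrE// ltW.
  have h3 : x ^+ 3 <= y ^+ 3 by rewrite lerXn2r// ?nnegrE ltW.
  lra.
move=> h; rewrite mul1r.
have yx : 0 <= y ^+ 2 by rewrite sqr_ge0.
apply: (@le_trans _ _ (y * y)); first by rewrite ler_wpM2r// ltW.
rewrite (_ : _ * (y ^+ 4 * y) = (y * y) * (4 * (y - x) * y ^+ 3)); last by ring.
by rewrite ler_peMr// mulr_ge0// ltW.
Qed.

Lemma weight_sum_le (n : nat) : \sum_(k < n) weight k <= 6.
Proof.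
suff H m : \sum_(k < m.+2) weight k <= 6 - 4 / root4 m.+1%:R.
  case: n => [|[|n]]; first by rewrite big_ord0.
    rewrite big_ord1 /weight /pow54 /root4 !sqrtr1 mulr1 invr1; lra.
  by apply: le_trans (H n) _; rewrite gerBl divr_ge0// root4_ge0.
elim: m => [|m IH].
  rewrite !big_ord_recr big_ord0/= /weight /pow54 /root4 !sqrtr1 !mulr1 invr1; lra.
rewrite big_ord_recr/=; apply: le_trans (lerD IH (weight_telescope _)) _ => //.
lra.
Qed.

(** [max(1, k) max(1, l) <= k^2 + l^2] for integers that are not both zero. *)
Lemma weight_le (k l : nat) (q : R) : (0 < k + l)%N -> k%:R ^+ 2 + l%:R ^+ 2 <= q ->
  (pow54 q)^-1 <= weight k * weight l.
Proof.
move=> kl q2; rewrite /weight -invfM -pow54M//.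
have m0 (i : nat) : 0 < (maxn 1 i)%:R :> R by rewrite ltr0n leq_max.
have h : (maxn 1 k)%:R * (maxn 1 l)%:R <= q.
  apply: le_trans q2; rewrite -natrM -!natrX -natrD ler_nat.
  case: k l kl => [|k] [|l] //= _; rewrite ?maxnE; nia.
have q0 : 0 < q by apply: lt_le_trans h; rewrite mulr_gt0.
rewrite lef_pV2 ?posrE ?pow54_gt0 ?mulr_gt0//.
by rewrite ler_pow54// mulr_ge0// ltW.
Qed.
End weights.

(** * Uniform limits of oscillating trigonometric polynomials *)
Section almost_periodic.
Context {R : realType}.
Implicit Types (p g : R -> R).

(** Trigonometric polynomials without constant term: uniform limits of these are
    almost periodic and of mean value zero at the same time. *)
Inductive osc : (R -> R) -> Prop :=
| osc0 : osc (fun=> 0)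
| osc_add (a b y : R) p : y != 0 -> osc p ->
    osc (fun x => a * cos (y * x) + b * sin (y * x) + p x).

Lemma oscD p1 p2 : osc p1 -> osc p2 -> osc (fun x => p1 x + p2 x).
Proof.
move=> o1 o2; elim: o1 => [|a b y p y0 _ IH].
  by rewrite (_ : (fun x => _) = p2)//; apply/funext => x; rewrite add0r.
rewrite (_ : (fun x => _) = (fun x => a * cos (y * x) + b * sin (y * x) + (p x + p2 x))).
  exact: osc_add.
by apply/funext => x; rewrite addrA.
Qed.

Lemma osc1 (a b y : R) : y != 0 -> osc (fun x => a * cos (y * x) + b * sin (y * x)).
Proof.
move=> y0; have := osc_add a b y0 osc0.
by rewrite (_ : (fun x => _ + 0) = (fun x => a * cos (y * x) + b * sin (y * x)))//;
  apply/funext => x; rewrite addr0.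
Qed.

Lemma osc_sum (n : nat) (F : nat -> R -> R) : (forall i, osc (F i)) ->
  osc (fun x => \sum_(i < n) F i x).
Proof.
move=> oF; elim: n => [|n IH].
  rewrite (_ : (fun x => _) = fun=> 0); first exact: osc0.
  by apply/funext => x; rewrite big_ord0.
rewrite (_ : (fun x => _) = fun x => \sum_(i < n) F i x + F n x); first exact: oscD.
by apply/funext => x; rewrite big_ord_recr.
Qed.

Lemma osc_continuous p : osc p -> continuous p.
Proof.
elim=> [|a b y p' y0 _ IH]; first exact: cont_cst.
by apply: contD => //; cont.
Qed.

Lemma trig_polyD (p1 p2 : R -> R[i]) : trig_poly p1 -> trig_poly p2 ->
  trig_poly (fun x => p1 x + p2 x).
Proof.
move=> [n1 [c1 [g1 e1]]] [n2 [c2 [g2 e2]]].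
exists (n1 + n2)%N, (fun i => match fintype.split i with inl j => c1 j | inr j => c2 j end),
  (fun i => match fintype.split i with inl j => g1 j | inr j => g2 j end) => x.
rewrite big_split_ord/= e1 e2; congr (_ + _); apply: eq_bigr => k _.
  by have -> : fintype.split (lshift n2 k) = inl k by exact: (unsplitK (inl k)).
by have -> : fintype.split (rshift n1 k) = inr k by exact: (unsplitK (inr k)).
Qed.

Lemma osc_trig_poly p : osc p -> trig_poly (fun x => (p x)%:C%C).
Proof.
elim=> [|a b y q y0 _ IH].
  by exists 0%N, (fun=> 0), (fun=> 0) => x; rewrite big_ord0.
rewrite (_ : (fun x => _) = (fun x => (a * cos (y * x) + b * sin (y * x))%:C%C + (q x)%:C%C)); last first.
  by apply/funext => x; rewrite rmorphD.
apply: trig_polyD IH.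
exists 2%N, (fun i : 'I_2 => if i == 0 then (a / 2 +i* - (b / 2))%C else (a / 2 +i* (b / 2))%C),
  (fun i : 'I_2 => if i == 0 then y else - y) => x.
rewrite !big_ord_recl big_ord0/= addr0 mulNr cosN sinN.
by apply/eqP; rewrite eq_complex/=; apply/andP; split; apply/eqP; field.
Qed.

Definition osc_limit g := forall e : R, 0 < e ->
  exists2 p, osc p & forall x, `|g x - p x| <= e.

Lemma osc_limit_almost_periodic g : osc_limit g -> almost_periodic g.
Proof.
move=> H e e0; have [p op gp] := H e e0.
exists (fun x => (p x)%:C%C); first exact: osc_trig_poly.
move=> x; rewrite -rmorphB normc_def/= expr0n/= addr0 sqrtr_sqr lecR.
exact: gp.
Qed.

Lemma osc_limit_continuous g : osc_limit g -> continuous g.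
Proof.
move=> H x; apply/cvgrPdist_le => e e0.
have e3 : 0 < e / 3 by lra.
have [p /osc_continuous cp gp] := H _ e3.
have /cvgrPdist_le /(_ _ e3) := cp x.
apply: filterS => y pxy.
have := gp x; have := gp y; move: pxy; rewrite !ler_norml; lra.
Qed.

(** The primitive of an oscillating term is bounded. *)
Lemma osc_mean_bound p : osc p ->
  exists2 C, 0 <= C & forall L : R, 0 <= L -> `|ri 0 L p| <= C.
Proof.
elim=> [|a b y q y0 oq [C C0 IH]].
  by exists 0 => // L L0; rewrite ri_cst// mul0r normr0.
pose D := (`|a| + 2 * `|b|) / `|y|.
have yp : 0 < `|y| by rewrite normr_gt0.
have D0 : 0 <= D by rewrite divr_ge0// addr_ge0// mulr_ge0.
exists (D + C); first by rewrite addr_ge0.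
move=> L L0.
have c1 : continuous (fun x => a * cos (y * x) + b * sin (y * x)) by cont.
rewrite riD//; last exact: osc_continuous.
apply: le_trans (ler_normD _ _) _; apply: lerD; last exact: IH.
have dF (x : R) : is_derive x 1 (fun x => (a * sin (y * x) - b * cos (y * x)) / y) (a * cos (y * x) + b * sin (y * x)).
  by der; field.
rewrite (ri_FTC L0 c1 dF) mulr0 sin0 cos0 -mulrBl normrM normfV /D.
rewrite ler_wpM2r ?invr_ge0//.
have h1 : `|a * sin (y * L)| <= `|a| by rewrite normrM ler_piMr// sin_max.
have h2 : `|b * cos (y * L)| <= `|b| by rewrite normrM ler_piMr// cos_max.
have h3 : `|b * 1| <= `|b| by rewrite mulr1.
move: h1 h2 h3; rewrite mulr0 sub0r opprK.
set u := a * sin _; set v := b * cos _; set w := b * 1 => h1 h2 h3.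
apply: le_trans (ler_normD _ _) _; apply: le_trans (lerD (ler_normB _ _) (lexx _)) _; lra.
Qed.

Lemma osc_limit_mean g : osc_limit g -> has_mean_value g 0.
Proof.
move=> H; apply/cvgrPdist_le => e e0.
have e2 : 0 < e / 2 by lra.
have cg := osc_limit_continuous H.
have [p op gp] := H _ e2.
have cp := osc_continuous op.
have [C C0 bC] := osc_mean_bound op.
near=> L.
have L0 : 0 < L by near: L; exact: nbhs_pinfty_gt.
rewrite sub0r normrN normrM normfV (gtr0_norm L0) -/(ri 0 L g).
rewrite (_ : ri 0 L g = ri 0 L p + ri 0 L (fun x => g x - p x)); last first.
  by rewrite riB//; ring.
rewrite ler_pdivrMl//.
apply: le_trans (ler_normD _ _) _.
have h1 := bC L (ltW L0).
have h2 : `|ri 0 L (fun x => g x - p x)| <= e / 2 * (L - 0).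
  by apply: ri_norm_le (ltW L0) _ _ => [|x _]; [exact: contB|exact: gp].
have h3 : C / (e / 2) <= L by near: L; apply: nbhs_pinfty_ge; rewrite num_real.
move: h3; rewrite ler_pdivrMr// => h3; lra.
Unshelve. all: by end_near. Qed.

Lemma osc_limit_scale g (c k : R) : k != 0 -> osc_limit g -> osc_limit (fun x => c * g (k * x)).
Proof.
move=> k0 H e e0; have ce : 0 < e / (`|c| + 1) by rewrite divr_gt0// ltr_wpDl.
have [p op gp] := H _ ce.
exists (fun x => c * p (k * x)); last first.
  move=> x; rewrite -mulrBr normrM (le_trans (ler_wpM2l _ (gp _)))//.
  by rewrite mulrCA ler_piMr ?(ltW e0)// ler_pdivrMr ?ltr_wpDl// mul1r lerDl.
elim: op {gp} => [|a b y q y0 _ IH].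
  by rewrite (_ : (fun=> _) = fun=> 0); [exact: osc0|apply/funext => x; rewrite mulr0].
rewrite (_ : (fun x => _) = fun x => c * a * cos (y * k * x) + c * b * sin (y * k * x) + c * q (k * x)).
  by apply: osc_add => //; rewrite mulf_neq0.
by apply/funext => x; rewrite !mulrDr !mulrA.
Qed.

End almost_periodic.

(** * The Riesz mean of the lattice points of a disc *)
Section lattice.
Context {R : realType}.
Implicit Types (r rho x : R) (k l n : nat).

(** Number of integers of absolute value [k]: sums over the whole line are folded
    onto the natural numbers. *)
Definition abs_mult k : R := if k is 0 then 1 else 2.

Lemma abs_mult_ge0 k : 0 <= abs_mult k. Proof. by case: k => [|k] /=. Qed.
Lemma abs_mult_le2 k : abs_mult k <= 2. Proof. by case: k => [|k] //=; rewrite ler1n. Qed.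

Lemma sum_abs_mult (f : nat -> R) n :
  \sum_(k < n.+1) abs_mult k * f k = f 0%N + 2 * \sum_(j < n) f j.+1.
Proof. by rewrite big_ord_recl mul1r mulr_sumr. Qed.

Lemma cvg_abs_mult_sum (f : nat -> R) (l : R) :
  (f 0%N + 2 * \sum_(j < K) f j.+1) @[K --> \oo] --> l ->
  (\sum_(k < K) abs_mult k * f k) @[K --> \oo] --> l.
Proof.
move=> H; rewrite -(cvg_shiftS (fun K => \sum_(k < K) abs_mult k * f k)).
by apply: cvg_ext H => K; rewrite sum_abs_mult.
Qed.

Definition frequency k l : R :=
  Num.sqrt ((2 * pi * k%:R) ^+ 2 + (2 * pi * l%:R) ^+ 2).

(** The Fourier transform of [max 0 (r^2 - x^2 - y^2)] at [2 pi (k, l)]. *)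
Definition disc_coef r k l : R :=
  if (k + l == 0)%N then pi * r ^+ 4 / 2
  else 2 * r ^+ 2 / frequency k l ^+ 2 * bessel2 (r * frequency k l).

Definition profile l rho : R := if l is 0 then h3 rho else hc (2 * pi * l%:R) rho.

(** [sum_{(m, n)} max 0 (r^2 - m^2 - n^2)] over [Z^2]. *)
Definition riesz r : R :=
  \sum_(j < (Num.truncn r).+1) abs_mult j *
    let rho := Num.sqrt (r ^+ 2 - j%:R ^+ 2) in
    \sum_(m < (Num.truncn rho).+1) abs_mult m * (rho ^+ 2 - m%:R ^+ 2).

Lemma truncn_bounds r : 0 <= r -> (Num.truncn r)%:R <= r <= (Num.truncn r)%:R + 1.
Proof.
by move=> r0; have /andP[-> /ltW] := truncn_itv r0; rewrite -natr1 => ->.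
Qed.

Lemma profile_cvg rho : 0 <= rho ->
  \sum_(l < L) abs_mult l * profile l rho @[L --> \oo] -->
  \sum_(m < (Num.truncn rho).+1) abs_mult m * (rho ^+ 2 - m%:R ^+ 2).
Proof.
move=> r0; rewrite (sum_abs_mult (fun m => rho ^+ 2 - m%:R ^+ 2)) expr0n/= subr0.
apply: (cvg_abs_mult_sum (f := profile ^~ rho)); exact/inner_poisson/truncn_bounds.
Qed.

Lemma sqr_frequency k l :
  frequency k l ^+ 2 = (2 * pi * k%:R) ^+ 2 + (2 * pi * l%:R) ^+ 2.
Proof. by rewrite sqr_sqrtr// addr_ge0// sqr_ge0. Qed.

Lemma der_hc (c y : R) : c != 0 -> is_derive y 1 (hc c) (4 * y / c * sin (c * y)).
Proof. by move=> c0; rewrite /hc; der; field. Qed.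

(** Poisson summation over one coordinate, the transform being already taken in the
    other. *)
Lemma disc_coef_cvg r l : 0 < r ->
  \sum_(k < K) abs_mult k * disc_coef r k l @[K --> \oo] -->
  \sum_(j < (Num.truncn r).+1) abs_mult j * profile l (Num.sqrt (r ^+ 2 - j%:R ^+ 2)).
Proof.
move=> r0; have nr := truncn_bounds (ltW r0).
rewrite (sum_abs_mult (fun j => profile l (Num.sqrt (r ^+ 2 - j%:R ^+ 2)))).
apply: (cvg_abs_mult_sum (f := fun k => disc_coef r k l)).
have dsq (t : R) : 0 < t < r -> is_derive t 1 (fun x => Num.sqrt (r ^+ 2 - x ^+ 2)) (- t / Num.sqrt (r ^+ 2 - t ^+ 2)).
  move=> /andP[t0 tr]; have p0 : 0 < r ^+ 2 - t ^+ 2.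
    by rewrite subr_gt0 ltr_pXn2r// nnegrE ltW.
  have d1 : is_derive t 1 (fun x => r ^+ 2 - x ^+ 2) (- (2 * t)) by der; ring.
  by apply: (der_eq (@der_sqrt _ _ (fun x => r ^+ 2 - x ^+ 2) _ _ _ p0 d1)); field; rewrite gt_eqF// sqrtr_gt0.
have sp (t : R) : 0 < t < r -> Num.sqrt (r ^+ 2 - t ^+ 2) != 0.
  by move=> /andP[t0 tr]; rewrite gt_eqF// sqrtr_gt0 subr_gt0 ltr_pXn2r// nnegrE ltW.
have pi0 := @pi_gt0 R.
case: l => [|l] /=.
  have c1 : continuous (fun x => h3 (Num.sqrt (r ^+ 2 - x ^+ 2))) by rewrite /h3; cont.
  have c2 : continuous (fun x => - 4 * x * Num.sqrt (r ^+ 2 - x ^+ 2)) by cont.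
  have d (t : R) : 0 < t < r -> is_derive t 1 (fun x => h3 (Num.sqrt (r ^+ 2 - x ^+ 2)))
      (- 4 * t * Num.sqrt (r ^+ 2 - t ^+ 2)).
    move=> tr; have s0 := sp t tr.
    have dh (y : R) : is_derive y 1 h3 (4 * y ^+ 2) by rewrite /h3; der; field.
    by apply: (der_eq (der_comp (dh _) (dsq t tr))); field.
  have f0 : h3 (Num.sqrt (r ^+ 2 - r ^+ 2)) = 0 by rewrite subrr sqrtr0 /h3; ring.
  have := poisson c1 c2 d f0 nr; apply: cvg_ext => K.
  rewrite cosint_h30// /disc_coef/=; congr (_ + _ * _); apply: eq_bigr => k _.
  rewrite cosint_h3// ?mulr_gt0// /frequency mulr0 ?addn0/=.
  by rewrite sqr_sqrtr// addr_ge0 ?sqr_ge0.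
set c : R := 2 * pi * l.+1%:R.
have c0 : c != 0 by rewrite gt_eqF// !mulr_gt0.
have c1 : continuous (fun x => hc c (Num.sqrt (r ^+ 2 - x ^+ 2))) by rewrite /hc; cont.
have c2 : continuous (fun x => - (4 * x / c) * sin (c * Num.sqrt (r ^+ 2 - x ^+ 2))) by cont.
have d (t : R) : 0 < t < r -> is_derive t 1 (fun x => hc c (Num.sqrt (r ^+ 2 - x ^+ 2)))
    (- (4 * t / c) * sin (c * Num.sqrt (r ^+ 2 - t ^+ 2))).
  move=> tr; have s0 := sp t tr.
  apply: (der_eq (@der_comp _ _ (hc c) (fun x => Num.sqrt (r ^+ 2 - x ^+ 2)) t 1 _ _ (der_hc _ c0) (dsq t tr))).
  by clearbody c; field; rewrite c0.
have f0 : hc c (Num.sqrt (r ^+ 2 - r ^+ 2)) = 0.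
  by rewrite subrr sqrtr0 /hc !mulr0 sin0; ring.
have := poisson c1 c2 d f0 nr; apply: cvg_ext => K.
rewrite cosint_hc// /disc_coef add0n/= sqr_frequency /frequency mulr0; congr (_ + _ * _).
by apply: eq_bigr => k _; rewrite cosint_hc// sqr_frequency.
Qed.

Lemma riesz_cvg r : 0 < r ->
  \sum_(l < L) (abs_mult l * \sum_(j < (Num.truncn r).+1) abs_mult j * profile l (Num.sqrt (r ^+ 2 - j%:R ^+ 2)))
    @[L --> \oo] --> riesz r.
Proof.
move=> r0; rewrite /riesz.
have H := @seq_cvg_sum R (fun j L => abs_mult j * \sum_(l < L) abs_mult l * profile l (Num.sqrt (r ^+ 2 - j%:R ^+ 2)))
  (fun j => abs_mult j * \sum_(m < (Num.truncn (Num.sqrt (r ^+ 2 - j%:R ^+ 2))).+1) abs_mult m * (Num.sqrt (r ^+ 2 - j%:R ^+ 2) ^+ 2 - m%:R ^+ 2))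
  (Num.truncn r).+1.
apply: cvg_ext (H _) => [L|j].
  under eq_bigr => j _ do rewrite mulr_sumr.
  rewrite exchange_big/=; apply: eq_bigr => l _; rewrite mulr_sumr.
  by apply: eq_bigr => j _; ring.
by apply: seq_cvgZ; apply: profile_cvg; exact: sqrtr_ge0.
Qed.

Lemma sqr_frequency_ge k l : k%:R ^+ 2 + l%:R ^+ 2 <= frequency k l ^+ 2.
Proof.
rewrite sqr_frequency.
rewrite (_ : _ + (_ * l%:R) ^+ 2 = (2 * pi) ^+ 2 * (k%:R ^+ 2 + l%:R ^+ 2)); last by ring.
rewrite ler_peMl ?addr_ge0 ?sqr_ge0//; have := pi_ge2 R; move: (pi : R) => p; nra.
Qed.

Lemma frequency_ge1 k l : (0 < k + l)%N -> 1 <= frequency k l.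
Proof.
move=> kl; rewrite -(@ler_sqr R) ?nnegrE ?sqrtr_ge0// expr1n.
apply: le_trans (sqr_frequency_ge k l); rewrite -!natrX -natrD ler1n.
by case: k l kl => [|k] [|l].
Qed.

Lemma pow54_sqr (q : R) : 0 <= q -> pow54 (q ^+ 2) = q ^+ 2 * Num.sqrt q.
Proof. by move=> q0; rewrite /pow54 /root4 sqrtr_sqr ger0_norm. Qed.

Lemma inv_pow54_weight k l : (0 < k + l)%N ->
  (pow54 (frequency k l ^+ 2))^-1 <= weight k * weight l.
Proof. by move=> kl; apply: weight_le => //; exact: sqr_frequency_ge. Qed.

Lemma inv_pow54_gt0 k l : (0 < k + l)%N -> 0 < (pow54 (frequency k l ^+ 2))^-1 :> R.
Proof.
move=> kl; rewrite invr_gt0 pow54_gt0// exprn_gt0//.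
exact: lt_le_trans (frequency_ge1 kl).
Qed.

Section oscillation.
Variables (al be C : R).
Hypothesis bfE : forall z, 1 <= z ->
  `|bessel2 z - (al * cos z + be * sin z) / Num.sqrt z| <= C / z.

Let wave k l x : R := al * cos (frequency k l * x) + be * sin (frequency k l * x).

Definition wave_mode k l x : R := if (k + l == 0)%N then 0 else
  abs_mult k * abs_mult l * (2 / pow54 (frequency k l ^+ 2) * wave k l x).

(** The Bessel asymptotics at [z = r q]: the amplitude [2 r^2 / q^2] times
    [1 / sqrt (r q)] separates into [r^(3/2)] and [q^(-5/2)], the latter summable over
    the plane lattice. *)
Lemma disc_coef_mode r k l : 1 <= r -> (0 < k + l)%N ->
  `|disc_coef r k l - r * Num.sqrt r * (2 / pow54 (frequency k l ^+ 2) * wave k l r)|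
    <= 2 * C * r / pow54 (frequency k l ^+ 2).
Proof.
move=> r1 kl; rewrite /disc_coef ifF; last by apply/negbTE; rewrite -lt0n.
have q1 := frequency_ge1 kl; set q := frequency k l in q1 *.
have r0 : 0 < r by rewrite (lt_le_trans _ r1).
have q0 : 0 < q by rewrite (lt_le_trans _ q1).
have z1 : 1 <= r * q by rewrite -[leLHS]mulr1 ler_pM.
have := bfE z1; rewrite sqrtrM ?(ltW r0)// (mulrC r q) -/(wave k l r) => H.
have C0 : 0 <= C by have := bfE (lexx 1); rewrite divr1; apply: le_trans.
rewrite pow54_sqr ?(ltW q0)//.
have sr0 : Num.sqrt r != 0 by rewrite gt_eqF// sqrtr_gt0.
have sq0 : 0 < Num.sqrt q by rewrite sqrtr_gt0.
have rE : r = Num.sqrt r ^+ 2 by rewrite sqr_sqrtr// ltW.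
rewrite (_ : _ - _ = 2 * r ^+ 2 / q ^+ 2 * (bessel2 (q * r) - wave k l r / (Num.sqrt r * Num.sqrt q))); last first.
  move: rE sr0 sq0; move: (Num.sqrt r) (Num.sqrt q) (bessel2 _) (wave k l r) => s t B w -> s0 t0.
  by field; rewrite s0 !gt_eqF.
have hq : 0 <= 2 * r ^+ 2 / q ^+ 2.
  by apply: divr_ge0; [apply: mulr_ge0 => //|]; exact: sqr_ge0.
rewrite normrM (ger0_norm hq); apply: le_trans (ler_wpM2l hq H) _.
rewrite (_ : _ * (C / _) = 2 * C * r / (q ^+ 2 * q)); last first.
  by clearbody q; field; rewrite !gt_eqF.
rewrite ler_wpM2l ?mulr_ge0 ?(ltW r0)//.
rewrite lef_pV2 ?posrE ?mulr_gt0 ?exprn_gt0// ler_wpM2l ?sqr_ge0//.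
rewrite -[leRHS](sqr_sqrtr (ltW q0)) expr2 ler_peMl ?(ltW sq0)//.
by rewrite -sqrtr1 ler_wsqrtr.
Qed.

Lemma wave_le k l x : `|wave k l x| <= `|al| + `|be|.
Proof.
rewrite (le_trans (ler_normD _ _))//.
by apply: lerD; rewrite normrM ler_piMr// ?cos_max ?sin_max.
Qed.

Lemma C_ge0 : 0 <= C.
Proof. by have := bfE (lexx 1); rewrite divr1; apply: le_trans. Qed.

Lemma abs_mult2_le k l (x : R) : 0 <= x -> abs_mult k * abs_mult l * x <= 4 * x.
Proof.
move=> x0; rewrite ler_wpM2r//; have := abs_mult_le2 k; have := abs_mult_le2 l.
by have := abs_mult_ge0 k; have := abs_mult_ge0 l; nra.
Qed.

Lemma weights_cvg (s : R) : 0 <= s -> exists2 om : R,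
  \sum_(k < n) (s * weight k) @[n --> \oo] --> om &
  forall n, \sum_(k < n) (s * weight k) <= om.
Proof.
move=> s0; apply: (@bounded_increasing_cvg _ _ (s * 6)) => n.
  by rewrite big_ord_recr lerDl mulr_ge0// weight_ge0.
by rewrite -mulr_sumr ler_wpM2l// weight_sum_le.
Qed.

Lemma sqrt_weights (c : R) k l : 0 <= c ->
  Num.sqrt c * weight k * (Num.sqrt c * weight l) = c * (weight k * weight l).
Proof. by move=> c0; rewrite mulrACA -expr2 sqr_sqrtr. Qed.

Lemma mode_le k l x : (0 < k + l)%N ->
  `|wave_mode k l x| <= 8 * (`|al| + `|be|) * (weight k * weight l).
Proof.
move=> kl; rewrite /wave_mode ifF; last by apply/negbTE; rewrite -lt0n.
rewrite normrM ger0_norm ?mulr_ge0 ?abs_mult_ge0//.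
apply: le_trans (abs_mult2_le _ _ (normr_ge0 _)) _.
have p0 := inv_pow54_gt0 kl.
rewrite normrM ger0_norm ?mulr_ge0 ?(ltW p0)//.
have := inv_pow54_weight kl; have := wave_le k l x.
move: p0; set p := _^-1; set w := weight k * _; set u := `|wave _ _ _|; set a := `|al| + _.
move=> p0 ua pw; have u0 : 0 <= u by exact: normr_ge0.
have : p * u <= w * a by rewrite ler_pM// ltW.
lra.
Qed.

Lemma osc_mode k l : osc (wave_mode k l).
Proof.
have [kl|kl] := boolP (k + l == 0)%N.
  rewrite (_ : wave_mode k l = fun=> 0); first exact: osc0.
  by apply/funext => x; rewrite /wave_mode kl.
pose c := abs_mult k * abs_mult l; pose d : R := 2 / pow54 (frequency k l ^+ 2).
rewrite (_ : wave_mode k l = fun x => (c * d * al) * cos (frequency k l * x) + (c * d * be) * sin (frequency k l * x)).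
  by apply: osc1; rewrite gt_eqF// (lt_le_trans _ (frequency_ge1 _))// lt0n.
by apply/funext => x; rewrite /wave_mode (negbTE kl) /wave -/c -/d; ring.
Qed.

(** The limit [g] of the square partial sums of the modes is a uniform limit because
    their majorant does not depend on the point. The error terms of the
    asymptotics have the summable majorant [r q^(-5/2)] as well, so that they add up
    to [O(r)]. *)
Lemma riesz_oscillation : exists2 g : R -> R, osc_limit g &
  exists D : R, forall r, 1 <= r ->
    `|riesz r - pi * r ^+ 4 / 2 - r * Num.sqrt r * g r| <= D * r.
Proof.
pose c := 8 * (`|al| + `|be|).
have c0 : 0 <= c by rewrite mulr_ge0// addr_ge0.
have [om Uom Ule] := weights_cvg (sqrtr_ge0 c).
have v0 k : 0 <= Num.sqrt c * weight k by rewrite mulr_ge0 ?sqrtr_ge0 ?weight_ge0.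
have Fv x k l : (0 < k + l)%N -> `|wave_mode k l x| <= Num.sqrt c * weight k * (Num.sqrt c * weight l).
  by move=> kl; rewrite sqrt_weights// mode_le.
pose G n x := rectsum (fun k l => wave_mode k l x) n n.
have /choice[g gP] : forall x, exists y : R, G n.+1 x @[n --> \oo] --> y /\
    forall n, `|y - G n.+1 x| <= om * om - (\sum_(k < n.+1) (Num.sqrt c * weight k)) * \sum_(k < n.+1) (Num.sqrt c * weight k).
  by move=> x; have [l l1 l2] := square_sum_cvg v0 (Fv x) Uom Ule; exists l.
exists g.
  move=> e e0; have gap := @majorant_gap_cvg0 _ (fun k => Num.sqrt c * weight k) om Uom.
  have /cvgrPdist_le /(_ _ e0) [N _ HN] := gap.
  exists (G N.+1).
    apply: (@osc_sum _ _ (fun l x => \sum_(k < N.+1) wave_mode k l x)) => l.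
    by apply: (@osc_sum _ _ (fun k x => wave_mode k l x)) => k; exact: osc_mode.
  move=> x; apply: le_trans ((gP x).2 N) _.
  have := HN N (leqnn N); rewrite /= sub0r normrN; apply: le_trans; exact: ler_norm.
exists (4 * (2 * C) * 36) => r r1.
have r0 : 0 < r by rewrite (lt_le_trans _ r1).
have C0 := C_ge0.
pose F k l := abs_mult k * abs_mult l * disc_coef r k l.
pose b := 4 * (2 * r * Num.sqrt r * (`|al| + `|be|) + 2 * C * r).
have b0 : 0 <= b.
  by rewrite mulr_ge0// addr_ge0 ?mulr_ge0 ?sqrtr_ge0 ?addr_ge0 ?(ltW r0).
have FE k l : (0 < k + l)%N -> `|F k l - r * Num.sqrt r * wave_mode k l r| <= 4 * (2 * C) * r * (weight k * weight l).
  move=> kl; rewrite /F /wave_mode ifF; last by apply/negbTE; rewrite -lt0n.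
  rewrite (_ : _ - _ = abs_mult k * abs_mult l * (disc_coef r k l - r * Num.sqrt r * (2 / pow54 (frequency k l ^+ 2) * wave k l r))); last by ring.
  rewrite normrM ger0_norm ?mulr_ge0 ?abs_mult_ge0//.
  apply: le_trans (abs_mult2_le _ _ (normr_ge0 _)) _.
  rewrite (_ : 4 * (2 * C) * r * _ = 4 * (2 * C * r * (weight k * weight l))); last by ring.
  rewrite ler_wpM2l//; apply: le_trans (disc_coef_mode r1 kl) _.
  by rewrite ler_wpM2l ?inv_pow54_weight// !mulr_ge0// ltW.
have Fb k l : (0 < k + l)%N -> `|F k l| <= Num.sqrt b * weight k * (Num.sqrt b * weight l).
  move=> kl; rewrite sqrt_weights//.
  have -> : F k l = (F k l - r * Num.sqrt r * wave_mode k l r) + r * Num.sqrt r * wave_mode k l r by ring.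
  apply: le_trans (ler_normD _ _) _.
  have s0 : 0 <= r * Num.sqrt r by rewrite mulr_ge0 ?sqrtr_ge0 ?ltW.
  have h1 := FE _ _ kl; have h2 := mode_le r kl.
  have h3 : `|r * Num.sqrt r * wave_mode k l r| <= r * Num.sqrt r * (8 * (`|al| + `|be|) * (weight k * weight l)).
    by rewrite normrM (ger0_norm s0) ler_wpM2l.
  apply: le_trans (lerD h1 h3) _; rewrite le_eqVlt; apply/orP; left; apply/eqP.
  by rewrite /b; ring.
have [om' Uom' Ule'] := weights_cvg (sqrtr_ge0 b).
have v0' k : 0 <= Num.sqrt b * weight k by rewrite mulr_ge0 ?sqrtr_ge0 ?weight_ge0.
have FG l : \sum_(k < K) F k l @[K --> \oo] --> abs_mult l * \sum_(j < (Num.truncn r).+1) abs_mult j * profile l (Num.sqrt (r ^+ 2 - j%:R ^+ 2)).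
  have H := @seq_cvgZ _ _ (abs_mult l) _ (@disc_coef_cvg r l r0).
  by apply: cvg_ext H => K; rewrite mulr_sumr; apply: eq_bigr => k _; rewrite /F; ring.
have sq := iterated_sum_square v0' Fb Ule' FG (riesz_cvg r0).
have main n : `|rectsum F n.+1 n.+1 - pi * r ^+ 4 / 2 - r * Num.sqrt r * G n.+1 r| <= 4 * (2 * C) * 36 * r.
  pose d k l : R := if (k + l == 0)%N then pi * r ^+ 4 / 2 else 0.
  have sd : rectsum d n.+1 n.+1 = pi * r ^+ 4 / 2.
    rewrite /rectsum big_ord_recl big_ord_recl /d/= big1// addr0 big1 ?addr0//.
    by move=> l _; rewrite big1// => k _; rewrite addnS.
  have -> : rectsum F n.+1 n.+1 - pi * r ^+ 4 / 2 - r * Num.sqrt r * G n.+1 r =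
      rectsum (fun k l => F k l - d k l - r * Num.sqrt r * wave_mode k l r) n.+1 n.+1.
    rewrite -sd /G /rectsum mulr_sumr -!sumrB; apply: eq_bigr => l _.
    by rewrite mulr_sumr -!sumrB.
  have Eb k l : `|F k l - d k l - r * Num.sqrt r * wave_mode k l r| <=
      4 * (2 * C) * r * (weight k * weight l).
    have [/eqP|kl] := posnP (k + l)%N; last first.
      by rewrite /d ifF ?subr0; [exact: FE|apply/negbTE; rewrite -lt0n].
    rewrite addn_eq0 => /andP[/eqP -> /eqP ->].
    rewrite /F /d /wave_mode /disc_coef/= !mul1r subrr mulr0 subr0 normr0.
    by rewrite !mulr_ge0 ?weight_ge0 ?(ltW r0).
  apply: le_trans (ler_norm_sum _ _ _) _.
  apply: (@le_trans _ _ (\sum_(l < n.+1) \sum_(k < n.+1) 4 * (2 * C) * r * (weight k * weight l))).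
    by apply: ler_sum => l _; apply: le_trans (ler_norm_sum _ _ _) _; apply: ler_sum.
  under eq_bigr => l _ do rewrite -mulr_sumr -mulr_suml.
  rewrite -mulr_sumr -mulr_sumr [leRHS]mulrAC.
  rewrite ler_wpM2l ?mulr_ge0 ?(ltW r0)//.
  have w6 := @weight_sum_le R n.+1.
  have w0 : 0 <= \sum_(k < n.+1) weight k :> R by apply: sumr_ge0 => k _; exact: weight_ge0.
  by rewrite (_ : 36 = 6 * 6) ?ler_pM//; ring.
have lim : (rectsum F n.+1 n.+1 - pi * r ^+ 4 / 2 - r * Num.sqrt r * G n.+1 r) @[n --> \oo] -->
    riesz r - pi * r ^+ 4 / 2 - r * Num.sqrt r * g r.
  apply: seq_cvgB; last by apply: seq_cvgZ; have [] := gP r.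
  apply: seq_cvgB; last exact: cvg_cst.
  have gap := @majorant_gap_cvg0 _ (fun k => Num.sqrt b * weight k) om' Uom'.
  apply/cvgrPdist_le => e e0; have /cvgrPdist_le /(_ _ e0) := gap.
  apply: filterS => n /=; rewrite sub0r normrN => h.
  by apply: le_trans (sq n.+1 isT) _; apply: le_trans h; exact: ler_norm.
rewrite -[X in `|X|]subr0; apply: (seq_norm_lim lim (N := 0)) => n _.
by rewrite subr0; exact: main.
Qed.
End oscillation.

Lemma riesz_asymptotics : exists2 g : R -> R, osc_limit g &
  exists D : R, forall r, 1 <= r ->
    `|riesz r - pi * r ^+ 4 / 2 - r * Num.sqrt r * g r| <= D * r.
Proof.
by have [al [be [C bfE]]] := @bessel2_asymptotics R; exact: riesz_oscillation bfE.
Qed.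
End lattice.

(** * Integration over a plane domain *)
Section plane.
Context {R : realType}.
Local Notation T2 := (measurableTypeR R * measurableTypeR R)%type.
Local Notation mu := (@lebesgue_measure R).
Local Notation mu2 := (@lebesgue_measure R \x @lebesgue_measure R)%E.

(** An open set is a countable union of rational squares, which are Borel
    rectangles. *)
Lemma open_measurable2 (U : set (R * R)) : open U -> measurable (U : set T2).
Proof.
move=> oU.
pose B (p q : rat) (n : nat) : set T2 :=
  `](ratr p : R) - n.+1%:R^-1, ratr p + n.+1%:R^-1[%classic `*`
  `](ratr q : R) - n.+1%:R^-1, ratr q + n.+1%:R^-1[%classic.
pose C p q n : set T2 := if `[< B p q n `<=` U >] then B p q n else set0.
have -> : (U : set T2) = \bigcup_p \bigcup_q \bigcup_n C p q n.
  apply/seteqP; split => [z Uz|z [p _ [q _ [n _]]]]; last first.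
    by rewrite /C; case: asboolP => // BU /BU.
  have /nbhs_ballP[e /= e0 zU] : nbhs z U by exact: open_nbhs_nbhs.
  have [n ne] : exists n : nat, 2 / n.+1%:R < e.
    exists (Num.truncn (2 / e)).
    rewrite ltr_pdivrMr// mulrC -ltr_pdivrMr//.
    by have /andP[_] := truncn_itv (ltW (divr_gt0 (ltr0n R 2) e0)).
  have [d dE] : exists d : R, d = n.+1%:R^-1 by eexists.
  have d0 : 0 < d by rewrite dE invr_gt0.
  have app (x : R) : exists p : rat, x - d < ratr p < x + d.
    have lt : x - d < x + d by lra.
    by have [p] := rat_in_itvoo lt; rewrite in_itv/= => ?; exists p.
  have [p pz] := app z.1; have [q qz] := app z.2.
  rewrite -dE in ne.
  exists p => //; exists q => //; exists n => //; rewrite /C /B -dE asboolT.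
    by split => /=; rewrite in_itv/=; lra.
  move=> w [/=]; rewrite !in_itv/= => w1 w2; apply: zU; split; rewrite /ball/=
    ltr_distlC; lra.
apply: bigcupT_measurable_rat => p; apply: bigcupT_measurable_rat => q.
apply: bigcup_measurable => n _; rewrite /C; case: asboolP => // _.
by apply: measurableX; exact: measurable_itv.
Qed.

Lemma continuous_measurable2 (f : R * R -> R) (A : set (R * R)) : continuous f ->
  measurable_fun (A : set T2) f.
Proof.
move=> cf; apply: (measurable_funS measurableT) => //.
apply: (measurability _ (RGenOpens.measurableE R)) => _ [_ [a [b ->] <-]].
by rewrite setTI; apply: open_measurable2; move/continuousP : cf; apply; exact: interval_open.
Qed.

Definition I2 (S : set (R * R)) (f : R * R -> R) : R := \int[mu2]_(z in S) f z.
Definition int2 (S : set (R * R)) (f : R * R -> R) : Prop :=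
  mu2.-integrable (S : set T2) (EFin \o f).

Section on_a_set.
Variable S : set (R * R).
Hypothesis mS : measurable (S : set T2).
Hypothesis fS : (mu2 (S : set T2) < +oo)%E.
Implicit Types f g u v : R * R -> R.

Local Notation meas f := (measurable_fun (S : set T2) f).

Lemma int2_meas f : int2 S f -> meas f.
Proof. by move=> /measurable_int /measurable_EFinP. Qed.

Lemma int2_le f g : meas f -> (forall z, S z -> `|f z| <= g z) -> int2 S g -> int2 S f.
Proof.
move=> mf fg ig; apply: le_integrable ig => //; first exact/measurable_EFinP.
by move=> z Sz /=; rewrite lee_fin (le_trans (fg z Sz))// ler_norm.
Qed.

Lemma int2_bounded f (C : R) : meas f -> (forall z, S z -> `|f z| <= C) -> int2 S f.
Proof.
move=> mf fC; apply: measurable_bounded_integrable => //.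
exists C; split; first exact: num_real.
by move=> x Cx z Sz; apply: le_trans (fC z Sz) (ltW Cx).
Qed.

Lemma int2D f g : int2 S f -> int2 S g -> int2 S (fun z => f z + g z).
Proof. by move=> hf hg; have := integrableD mS hf hg. Qed.
Lemma int2B f g : int2 S f -> int2 S g -> int2 S (fun z => f z - g z).
Proof. by move=> hf hg; have := integrableB mS hf hg. Qed.
Lemma int2Z (c : R) f : int2 S f -> int2 S (fun z => c * f z).
Proof. by move=> hf; have := integrableZl mS c hf. Qed.
Lemma int2_cst (c : R) : int2 S (fun=> c).
Proof. by apply: (int2_bounded (C := `|c|)) => //; exact: measurable_cst. Qed.
Lemma int2_norm f : int2 S f -> int2 S (fun z => `|f z|).
Proof. by move=> hf; have := integrable_norm hf. Qed.
Lemma int2_ext f g : (forall z, S z -> f z = g z) -> int2 S f -> int2 S g.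
Proof.
move=> fg; apply: eq_integrable => // z; rewrite inE => /fg /= ->; by [].
Qed.
Lemma int2_sum n (F : 'I_n -> R * R -> R) : (forall i, int2 S (F i)) ->
  int2 S (fun z => \sum_(i < n) F i z).
Proof.
move=> iF; suff : forall r : seq 'I_n, int2 S (fun z => \sum_(i <- r) F i z).
  by move=> /(_ (index_enum _)).
elim=> [|i r IH].
  by apply: int2_ext (int2_cst 0) => z _; rewrite big_nil.
by apply: int2_ext (int2D (iF i) IH) => z _; rewrite big_cons.
Qed.

Lemma I2_ext f g : (forall z, S z -> f z = g z) -> I2 S f = I2 S g.
Proof. by move=> fg; apply: eq_Rintegral => z; rewrite inE => /fg. Qed.
Lemma I2D f g : int2 S f -> int2 S g -> I2 S (fun z => f z + g z) = I2 S f + I2 S g.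
Proof. by move=> hf hg; exact: RintegralD. Qed.
Lemma I2B f g : int2 S f -> int2 S g -> I2 S (fun z => f z - g z) = I2 S f - I2 S g.
Proof. by move=> hf hg; exact: RintegralB. Qed.
Lemma I2Z (c : R) f : int2 S f -> I2 S (fun z => c * f z) = c * I2 S f.
Proof. by move=> hf; exact: RintegralZl. Qed.
Lemma I20 : I2 S (fun=> 0) = 0.
Proof.
transitivity (0 * I2 S (fun=> 0)); last by rewrite mul0r.
by rewrite -(I2Z 0 (int2_cst 0)); apply: I2_ext => z _; rewrite mul0r.
Qed.
Lemma I2_le f g : int2 S f -> int2 S g -> (forall z, S z -> f z <= g z) -> I2 S f <= I2 S g.
Proof. by move=> hf hg fg; exact: le_Rintegral. Qed.
Lemma I2_norm f : int2 S f -> `|I2 S f| <= I2 S (fun z => `|f z|).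
Proof. by move=> hf; exact: le_normr_Rintegral. Qed.
Lemma I2_sum n (F : 'I_n -> R * R -> R) : (forall i, int2 S (F i)) ->
  I2 S (fun z => \sum_(i < n) F i z) = \sum_(i < n) I2 S (F i).
Proof.
move=> iF; suff : forall r : seq 'I_n,
   I2 S (fun z => \sum_(i <- r) F i z) = \sum_(i <- r) I2 S (F i) /\
   int2 S (fun z => \sum_(i <- r) F i z).
  by move=> /(_ (index_enum _)) [].
elim=> [|i r [IH iIH]].
  rewrite big_nil -[X in _ = X /\ _]I20; split; first by apply: I2_ext => z _; rewrite big_nil.
  by apply: int2_ext (int2_cst 0) => z _; rewrite big_nil.
rewrite big_cons -IH -I2D//; split; first by apply: I2_ext => z _; rewrite big_cons.
by apply: int2_ext (int2D (iF i) iIH) => z _; rewrite big_cons.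
Qed.

Lemma L2_meas u : L2 S u -> meas u. Proof. by case. Qed.
Lemma L2_sqr u : L2 S u -> int2 S (fun z => u z ^+ 2). Proof. by case. Qed.

Lemma L2_mul u v : L2 S u -> L2 S v -> int2 S (fun z => u z * v z).
Proof.
move=> [mu1 iu] [mv iv]; apply: int2_le (int2D iu iv).
  exact: measurable_funM.
move=> z Sz; have := sqr_ge0 (u z - v z); have := sqr_ge0 (u z + v z).
by rewrite ler_norml; nra.
Qed.

Lemma L2_bounded u (C : R) : meas u -> (forall z, S z -> `|u z| <= C) -> L2 S u.
Proof.
move=> mu1 uC; split=> //; apply: (@int2_bounded _ (C ^+ 2)).
  exact: measurable_funX.
move=> z Sz; rewrite normrX lerXn2r ?nnegrE ?uC//.
exact: le_trans (uC z Sz).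
Qed.

Lemma L2_int u : L2 S u -> int2 S u.
Proof.
move=> Lu; have L1 : L2 S (fun=> 1).
  by apply: (@L2_bounded _ 1) => [|z _]; [exact: measurable_cst|rewrite normr1].
by apply: int2_ext (L2_mul Lu L1) => z _; rewrite mulr1.
Qed.

Lemma L2D u v : L2 S u -> L2 S v -> L2 S (fun z => u z + v z).
Proof.
move=> Lu Lv; split; first by apply: measurable_funD; [case: Lu|case: Lv].
have := int2D (int2D (L2_sqr Lu) (int2Z 2 (L2_mul Lu Lv))) (L2_sqr Lv).
by apply: int2_ext => z _; ring.
Qed.

Lemma L2Z (c : R) u : L2 S u -> L2 S (fun z => c * u z).
Proof.
move=> Lu; split; first by apply: measurable_funM; [exact: measurable_cst|case: Lu].
by apply: int2_ext (int2Z (c ^+ 2) (L2_sqr Lu)) => z _; ring.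
Qed.

Lemma L2_sum n (F : 'I_n -> R * R -> R) : (forall i, L2 S (F i)) ->
  L2 S (fun z => \sum_(i < n) F i z).
Proof.
move=> iF; suff : forall r : seq 'I_n, L2 S (fun z => \sum_(i <- r) F i z).
  by move=> /(_ (index_enum _)).
elim=> [|i r IH].
  rewrite (_ : (fun z => _) = fun=> 0); last by apply/funext => z; rewrite big_nil.
  by apply: (@L2_bounded _ 0) => [|z _]; [exact: measurable_cst|rewrite normr0].
rewrite (_ : (fun z => _) = fun z => F i z + \sum_(i <- r) F i z); first exact: L2D.
by apply/funext => z; rewrite big_cons.
Qed.

(** Every limit below passes under the integral sign through this statement. *)
Lemma I2_dominated (f_ : nat -> R * R -> R) f g :
  (forall n, meas (f_ n)) -> meas f ->
  (forall z, S z -> f_ n z @[n --> \oo] --> f z) ->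
  int2 S g -> (forall n z, S z -> `|f_ n z| <= g z) ->
  I2 S (f_ n) @[n --> \oo] --> I2 S f.
Proof.
move=> mf_ mf f_f ig fg.
by apply: (@Rdominated_cvg _ T2 R mu2 S f_ f g) => //; exact: aeW.
Qed.

Lemma I2_slice_x f (J : R -> R) : int2 S f ->
  (forall x, (\int[mu]_y ((f \_ S) (x, y))%:E)%E = (J x)%:E) ->
  I2 S f = \int[mu]_x J x.
Proof.
move=> iS H; rewrite /I2 /Rintegral integral_mkcond.
rewrite (_ : (fun z => (f z)%:E) \_ S = (fun z => ((f \_ S) z)%:E)); last first.
  by rewrite restrict_EFin.
rewrite -integral12_prod_meas1; last first.
  move: iS; rewrite /int2 integrable_mkcond//; by rewrite restrict_EFin.
by congr fine; apply: eq_integral => x _; rewrite /fubini_F H.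
Qed.

Lemma I2_slice_y f (J : R -> R) : int2 S f ->
  (forall y, (\int[mu]_x ((f \_ S) (x, y))%:E)%E = (J y)%:E) ->
  I2 S f = \int[mu]_y J y.
Proof.
move=> iS H; rewrite /I2 /Rintegral integral_mkcond.
rewrite (_ : (fun z => (f z)%:E) \_ S = (fun z => ((f \_ S) z)%:E)); last first.
  by rewrite restrict_EFin.
rewrite -integral21_prod_meas1; last first.
  move: iS; rewrite /int2 integrable_mkcond//; by rewrite restrict_EFin.
by congr fine; apply: eq_integral => x _; rewrite /fubini_G H.
Qed.

Lemma I2_ae0 w : int2 S w -> (forall E : set (R * R), E `<=` S ->
    measurable (E : set T2) -> I2 E w = 0) -> {ae mu2, forall z, S z -> w z = 0}.
Proof.
move=> iw H; have : ae_eq mu2 (S : set T2) (EFin \o w) (EFin \o (fun=> 0)).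
  apply: (integral_ae_eq mS iw) => [|E ES mE]; first exact/measurable_EFinP/measurable_cst.
  have iE : mu2.-integrable (E : set T2) (EFin \o w) by exact: integrableS iw.
  have fin : (\int[mu2]_(z in E) (w z)%:E)%E \is a fin_num by exact: integrable_fin_num.
  have e : (\int[mu2]_(z in E) (w z)%:E)%E = 0%E by rewrite -(fineK fin); congr EFin; exact: H.
  by rewrite [LHS]e integral0_eq.
by apply: filterS => z h Sz; have [] := h Sz.
Qed.

End on_a_set.

Section triangle_integral.
Variable a : R.
Hypothesis a0 : 0 < a.
Let S := triangle a.

Lemma triangle_open : open S.
Proof.
rewrite /S /triangle.
have -> : [set z : R * R | [/\ 0 < z.2, z.2 < z.1 & z.1 < a]] =
  [set z | 0 < z.2] `&` [set z | 0 < z.1 - z.2] `&` [set z | 0 < a - z.1].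
  apply/seteqP; split=> z /=; first by case=> *; rewrite !subr_gt0.
  by rewrite !subr_gt0 => -[[]].
have pos (f : R * R -> R) : continuous f -> open [set z | 0 < f z].
  move=> /continuousP cf; have -> : [set z | 0 < f z] = f @^-1` `]0, +oo[%classic.
    by apply/seteqP; split=> z /=; rewrite in_itv/= andbT.
  by apply: cf; exact: interval_open.
by apply: openI; [apply: openI|]; apply: pos; cont.
Qed.

Lemma triangle_measurable : measurable (S : set T2).
Proof. by apply: open_measurable2; exact: triangle_open. Qed.

Lemma triangle_finite : (mu2 (S : set T2) < +oo)%E.
Proof.
apply: (@le_lt_trans _ _ (mu2 (`[0, a]%classic `*` `[0, a]%classic))).
  apply: le_measure; rewrite ?inE.
  - exact: triangle_measurable.
  - by apply: measurableX; exact: measurable_itv.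
  - by move=> z [z1 z2 z3]; split => /=; rewrite in_itv/=; lra.
rewrite product_measure1E; try exact: measurable_itv.
have E : mu `[0, a]%classic = a%:E.
  by have := @lebesgue_measure_itv R `[0, a]; rewrite /= lte_fin a0 sube0.
by rewrite [X in (X * _)%E]E [X in (_ * X)%E]E -EFinM ltry.
Qed.

End triangle_integral.
End plane.

(** * Integration by parts on the triangle *)
Section triangle_calculus.
Context {R : realType}.
Local Notation T2 := (measurableTypeR R * measurableTypeR R)%type.
Local Notation mu := (@lebesgue_measure R).
Local Notation mu2 := (@lebesgue_measure R \x @lebesgue_measure R)%E.
Implicit Types (f g : R -> R) (h u v phi : R * R -> R) (z : R * R).

Lemma der_slice_x h (d x y : R) : is_derive ((x, y) : R * R) ((1, 0) : R * R) h d ->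
  is_derive x 1 (fun t => h (t, y)) d.
Proof.
move=> /der_line hd.
have d1 : is_derive x 1 (fun t : R => t - x) 1 by der; ring.
have hd0 : is_derive (x - x) 1 (fun t : R => h (t *: (1, 0) + (x, y))) d by rewrite subrr.
apply: (der_eq _ (mulr1 d)).
have := @der_comp _ _ (fun t : R => h (t *: (1, 0) + (x, y))) (fun t : R => t - x) x 1 _ _ hd0 d1.
rewrite (_ : (fun t : R => h ((t - x) *: (1, 0) + (x, y))) = (fun t => h (t, y)))//.
apply/funext => t; congr h; congr pair; rewrite /= /GRing.scale/=; ring.
Qed.

Lemma der_slice_y h (d x y : R) : is_derive ((x, y) : R * R) ((0, 1) : R * R) h d ->
  is_derive y 1 (fun t => h (x, t)) d.
Proof.
move=> /der_line hd.
have d1 : is_derive y 1 (fun t : R => t - y) 1 by der; ring.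
have hd0 : is_derive (y - y) 1 (fun t : R => h (t *: (0, 1) + (x, y))) d by rewrite subrr.
apply: (der_eq _ (mulr1 d)).
have := @der_comp _ _ (fun t : R => h (t *: (0, 1) + (x, y))) (fun t : R => t - y) y 1 _ _ hd0 d1.
rewrite (_ : (fun t : R => h ((t - y) *: (0, 1) + (x, y))) = (fun t => h (x, t)))//.
apply/funext => t; congr h; congr pair; rewrite /= /GRing.scale/=; ring.
Qed.

Lemma cont_slice_x h (y : R) : continuous h -> continuous (fun x : R => h (x, y)).
Proof.
move=> ch x; apply: (@continuous_comp _ _ _ (fun x : R => (x, y)) h); last exact: ch.
by apply: (@cvg_pair _ _ _ _ (nbhs x) (nbhs y)); [exact: cvg_id|exact: cvg_cst].
Qed.

Lemma cont_slice_y h (x : R) : continuous h -> continuous (fun y : R => h (x, y)).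
Proof.
move=> ch y; apply: (@continuous_comp _ _ _ (fun y : R => (x, y)) h); last exact: ch.
by apply: (@cvg_pair _ _ _ _ (nbhs x) (nbhs y)); [exact: cvg_cst|exact: cvg_id].
Qed.

Lemma integral_cut (f : R -> R) (p q : R) : continuous f ->
  (\int[mu]_x ((f \_ `]p, q[) x)%:E)%E = (ri p q f)%:E.
Proof.
move=> cf; have mf : measurable_fun `]p, q[ (EFin \o f).
  by apply/measurable_EFinP; exact: cont_measurable.
rewrite /ri /Rintegral fineK; last first.
  by apply: integrable_fin_num => //; exact: cont_integrable.
rewrite [RHS]integral_itv_bndoo// [RHS]integral_mkcond.
by apply: eq_integral => x _; rewrite restrict_EFin.
Qed.

Lemma compact_support_bounded h (K : set (R * R)) : continuous h -> compact K ->
  (forall z, ~ K z -> h z = 0) -> exists2 C, 0 <= C & forall z, `|h z| <= C.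
Proof.
move=> ch cK hK.
have cpt : compact (h @` K) by apply: continuous_compact => //; exact: continuous_subspaceT.
have /compact_bounded [M [_ HM]] := cpt.
exists (`|M| + 1); first by rewrite addr_ge0.
have M1 : M < `|M| + 1 by rewrite (le_lt_trans (ler_norm _))// ltrDl.
move=> z; have [Kz|nKz] := pselect (K z).
  by apply: (HM _ M1); exists z.
by rewrite hK// normr0 addr_ge0.
Qed.

Lemma locally_zero_derive h (K : set (R * R)) (z v : R * R) : compact K ->
  (forall z, ~ K z -> h z = 0) -> ~ K z -> 'D_v h z = 0.
Proof.
move=> cK hK nKz.
have oK : open (~` K) by apply: closed_openC; apply: compact_closed => //; exact: norm_hausdorff.
have : is_derive z v h 0.
  have d0 : is_derive z v (fun _ : R * R => 0 : R) 0 := der_cst _ _ _.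
  apply: near_eq_is_derive d0.
  have : nbhs z (~` K) by exact: open_nbhs_nbhs.
  by apply: filterS => w nKw; rewrite hK.
by move=> d; exact: derive_val.
Qed.

Lemma C1_der_x phi z : C1 phi -> is_derive z ((1, 0) : R * R) phi (dx phi z).
Proof. by case=> d _ _ _; exact/derivableP. Qed.

Lemma C1_der_y phi z : C1 phi -> is_derive z ((0, 1) : R * R) phi (dy phi z).
Proof. by case=> _ d _ _; exact/derivableP. Qed.

(** Continuity of the partial derivatives is used along segments parallel to the
    axes: vary [x] by the mean value theorem, then [y]. *)
Lemma C1_continuous phi : C1 phi -> continuous phi.
Proof.
move=> C [x0 y0]; apply/cvgrPdist_le => e e0.
have [_ _ cx _] := C.
have e2 : 0 < e / 2 by lra.
have /cvgrPdist_le /(_ _ (@ltr01 R)) /nbhs_ballP [d1 /= d10 H1] := cx (x0, y0).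
pose M := `|dx phi (x0, y0)| + 1.
have M0 : 0 < M by rewrite ltr_wpDl.
have cy : {for y0, continuous (fun y => phi (x0, y))}.
  apply: differentiable_continuous; apply/derivable1_diffP.
  by have [] := der_slice_y (C1_der_y (x0, y0) C).
have /cvgrPdist_le /(_ _ e2) /nbhs_ballP [d2 /= d20 H2] := cy.
(* [M] bounds the derivative in [x] near the point, so that this radius makes the
   horizontal variation at most [e / 2]. *)
pose d := Num.min d1 (Num.min d2 (e / 2 / M)).
have d0 : 0 < d by rewrite !lt_min d10 d20 divr_gt0.
have nb : nbhs ((x0, y0) : R * R) (ball ((x0, y0) : R * R) d) by exact: nbhsx_ballx.
apply: filterS nb => -[x y] [/=]; rewrite /ball/= !lt_min => /and3P[x1 x2 x3] /and3P[y1 y2 y3].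
have hy := H2 y y2.
have hx : `|phi (x0, y) - phi (x, y)| <= M * `|x0 - x|.
  have bnd t : `|x0 - t| <= `|x0 - x| -> `|dx phi (t, y)| <= M.
    move=> tx; have := H1 (t, y); rewrite /ball/= => /(_ (conj (le_lt_trans tx x1) y1)).
    move=> h; rewrite -(subrK (dx phi (x0, y0)) (dx phi (t, y))).
    by rewrite (le_trans (ler_normD _ _))// /M addrC lerD2l distrC.
  have D t := der_slice_x (C1_der_x (t, y) C).
  have [xx|/ltW xx] := leP x x0.
    have [t /andP[t1 t2] ->] := mean_value_bound xx (fun t _ => D t).
    rewrite normrM ler_wpM2r// bnd// !ger0_norm; lra.
  rewrite distrC (distrC x0).
  have [t /andP[t1 t2] ->] := mean_value_bound xx (fun t _ => D t).
  rewrite normrM ler_wpM2r// bnd// !ler0_norm; lra.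
have hx' : M * `|x0 - x| <= e / 2.
  by move: x3; rewrite ltr_pdivlMr// => /ltW; rewrite mulrC.
rewrite (_ : _ - _ = (phi (x0, y0) - phi (x0, y)) + (phi (x0, y) - phi (x, y))); last by ring.
apply: le_trans (ler_normD _ _) _; lra.
Qed.

Variable a : R.
Hypothesis a0 : 0 < a.
Let S := triangle a.
Let mS : measurable (S : set T2) := triangle_measurable a.
Let fS : (mu2 (S : set T2) < +oo)%E := triangle_finite a0.

(** Fubini and the fundamental theorem on each horizontal slice; the support keeps
    away from the boundary, so that the slice may be extended to [[0, a]]. *)
Lemma exact_x h hx (K : set (R * R)) : continuous hx -> compact K -> K `<=` S ->
  (forall z, is_derive z ((1, 0) : R * R) h (hx z)) ->
  (forall z, ~ K z -> h z = 0) -> (forall z, ~ K z -> hx z = 0) -> I2 S hx = 0.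
Proof.
move=> ch cK KS dh h0 hx0.
have [C C0 hC] := compact_support_bounded ch cK hx0.
have ih : int2 S hx by apply: (int2_bounded mS fS (C := C)) => //; exact: continuous_measurable2.
rewrite (I2_slice_y mS (J := fun=> 0) ih) ?/Rintegral ?integral0//.
move=> y.
have hxS (x : R) : ~ S (x, y) -> h (x, y) = 0 /\ hx (x, y) = 0.
  by move=> nS; split; [apply: h0|apply: hx0] => /KS.
transitivity (\int[mu]_x ((((fun x => hx (x, y)) \_ `]0, a[) x)%:E))%E.
  apply: eq_integral => x _; congr EFin; rewrite /patch.
  case: ifPn => Sx; case: ifPn => Ix //.
    move: Ix; rewrite notin_setE/= in_itv/= => nI; move: Sx; rewrite inE => -[s1 s2 s3].
    by exfalso; apply: nI; move: s1 s2 s3 => /=; lra.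
  by move: Sx; rewrite notin_setE => /hxS[_ ->].
rewrite integral_cut; last exact: cont_slice_x.
have ds (x : R) : is_derive x 1 (fun x => h (x, y)) (hx (x, y)) by exact: der_slice_x.
rewrite (ri_FTC (ltW a0) _ ds); last exact: cont_slice_x.
have [-> _] : h (a, y) = 0 /\ hx (a, y) = 0 by apply: hxS => -[_ _ /=]; rewrite ltxx.
have [-> _] : h (0, y) = 0 /\ hx (0, y) = 0 by apply: hxS => -[/=]; lra.
by rewrite subrr.
Qed.

Lemma exact_y h hy (K : set (R * R)) : continuous hy -> compact K -> K `<=` S ->
  (forall z, is_derive z ((0, 1) : R * R) h (hy z)) ->
  (forall z, ~ K z -> h z = 0) -> (forall z, ~ K z -> hy z = 0) -> I2 S hy = 0.
Proof.
move=> ch cK KS dh h0 hy0.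
have [C C0 hC] := compact_support_bounded ch cK hy0.
have ih : int2 S hy by apply: (int2_bounded mS fS (C := C)) => //; exact: continuous_measurable2.
rewrite (I2_slice_x mS (J := fun=> 0) ih) ?/Rintegral ?integral0//.
move=> x.
have hyS (y : R) : ~ S (x, y) -> h (x, y) = 0 /\ hy (x, y) = 0.
  by move=> nS; split; [apply: h0|apply: hy0] => /KS.
transitivity (\int[mu]_y ((((fun y => hy (x, y)) \_ `]0, a[) y)%:E))%E.
  apply: eq_integral => y _; congr EFin; rewrite /patch.
  case: ifPn => Sx; case: ifPn => Ix //.
    move: Ix; rewrite notin_setE/= in_itv/= => nI; move: Sx; rewrite inE => -[s1 s2 s3].
    by exfalso; apply: nI; move: s1 s2 s3 => /=; lra.
  by move: Sx; rewrite notin_setE => /hyS[_ ->].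
rewrite integral_cut; last exact: cont_slice_y.
have ds (y : R) : is_derive y 1 (fun y => h (x, y)) (hy (x, y)) by exact: der_slice_y.
rewrite (ri_FTC (ltW a0) _ ds); last exact: cont_slice_y.
have [-> _] : h (x, a) = 0 /\ hy (x, a) = 0 by apply: hyS => -[/=]; lra.
have [-> _] : h (x, 0) = 0 /\ hy (x, 0) = 0 by apply: hyS => -[/=]; lra.
by rewrite subrr.
Qed.

Definition bC1 u ux uy := [/\ forall z, is_derive z ((1, 0) : R * R) u (ux z),
  forall z, is_derive z ((0, 1) : R * R) u (uy z),
  [/\ continuous u, continuous ux & continuous uy] &
  exists C, forall z, [/\ `|u z| <= C, `|ux z| <= C & `|uy z| <= C]].

Lemma C1c_facts phi : C1c S phi -> [/\ continuous phi, continuous (dx phi),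
  continuous (dy phi) & exists K : set (R * R), [/\ compact K, K `<=` S &
  forall z, ~ K z -> [/\ phi z = 0, dx phi z = 0 & dy phi z = 0]]].
Proof.
move=> [C [K [cK KS hK]]]; have [_ _ cx cy] := C.
split=> //; first exact: C1_continuous.
exists K; split=> // z nK; split; first exact: hK.
  exact: locally_zero_derive cK hK nK.
exact: locally_zero_derive cK hK nK.
Qed.

Lemma cont_mul_int2 u phi : C1c S phi -> continuous u ->
  [/\ int2 S (fun z => u z * phi z), int2 S (fun z => u z * dx phi z) &
      int2 S (fun z => u z * dy phi z)].
Proof.
move=> /C1c_facts [c1 c2 c3 [K [cK KS hK]]] cu.
have H h : continuous h -> (forall z, ~ K z -> h z = 0) -> int2 S (fun z => u z * h z).
  move=> ch h0; have cuh : continuous (fun z => u z * h z) by exact: contM.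
  have [|C _ hC] := compact_support_bounded cuh cK; first by move=> z /h0 ->; rewrite mulr0.
  by apply: (int2_bounded mS fS (C := C)) => //; exact: continuous_measurable2.
by split; apply: H => // z /hK[].
Qed.

Lemma ibp_x u ux phi : continuous u -> continuous ux ->
  (forall z, is_derive z ((1, 0) : R * R) u (ux z)) -> C1c S phi ->
  I2 S (fun z => u z * dx phi z) = - I2 S (fun z => ux z * phi z).
Proof.
move=> cu cux du Cphi; have [c1 c2 _ [K [cK KS hK]]] := C1c_facts Cphi.
have [_ i1 _] := cont_mul_int2 Cphi cu; have [i2 _ _] := cont_mul_int2 Cphi cux.
apply/eqP; rewrite -addr_eq0 -(I2D mS i1 i2); apply/eqP.
apply: (@exact_x (fun z => u z * phi z) _ K) => //.
- by apply: contD; exact: contM.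
- move=> z; apply: (der_eq (derM (du z) (C1_der_x z Cphi.1))); ring.
- by move=> z /hK[-> _ _]; rewrite mulr0.
- by move=> z /hK[-> -> _]; rewrite !mulr0 addr0.
Qed.

Lemma ibp_y u uy phi : continuous u -> continuous uy ->
  (forall z, is_derive z ((0, 1) : R * R) u (uy z)) -> C1c S phi ->
  I2 S (fun z => u z * dy phi z) = - I2 S (fun z => uy z * phi z).
Proof.
move=> cu cuy du Cphi; have [c1 _ c2 [K [cK KS hK]]] := C1c_facts Cphi.
have [_ _ i1] := cont_mul_int2 Cphi cu; have [i2 _ _] := cont_mul_int2 Cphi cuy.
apply/eqP; rewrite -addr_eq0 -(I2D mS i1 i2); apply/eqP.
apply: (@exact_y (fun z => u z * phi z) _ K) => //.
- by apply: contD; exact: contM.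
- move=> z; apply: (der_eq (derM (du z) (C1_der_y z Cphi.1))); ring.
- by move=> z /hK[-> _ _]; rewrite mulr0.
- by move=> z /hK[-> _ ->]; rewrite !mulr0 addr0.
Qed.

Lemma bC1_sobolev u ux uy : bC1 u ux uy -> sobolev S u ux uy.
Proof.
move=> [d1 d2 [c1 c2 c3] [C HC]].
have L h : continuous h -> (forall z, `|h z| <= C) -> L2 S h.
  by move=> ch hC; apply: (L2_bounded mS fS (C := C)) => //; exact: continuous_measurable2.
split; try by apply: L => // z; case: (HC z).
by move=> phi Cphi; split; [exact: ibp_x|exact: ibp_y].
Qed.

(** On the triangle, [f(x) g(y) + g(x) f(y)] is the derivative in [x] of the
    product of the two primitives, once integrated over [0 < y < x]. *)
Lemma triangle_product f g : continuous f -> continuous g ->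
  I2 S (fun z => f z.1 * g z.2 + g z.1 * f z.2) = ri 0 a f * ri 0 a g.
Proof.
move=> cf cg; have [F0 dF0] := primitive cf; have [G0 dG0] := primitive cg.
pose F x := F0 x - F0 0; pose G x := G0 x - G0 0.
have dF (x : R) : is_derive x 1 F (f x).
  by apply: (der_eq (derB (dF0 x) (der_cst _ _ _))); rewrite subr0.
have dG (x : R) : is_derive x 1 G (g x).
  by apply: (der_eq (derB (dG0 x) (der_cst _ _ _))); rewrite subr0.
have [cF cG] := (der_continuous dF, der_continuous dG).
have F00 : F 0 = 0 by rewrite /F subrr.
have G00 : G 0 = 0 by rewrite /G subrr.
pose h z := f z.1 * g z.2 + g z.1 * f z.2.
have cc1 (k : R -> R) : continuous k -> continuous (fun z : R * R => k z.1).
  by move=> ck; apply: cont_comp => //; exact: cont_fst.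
have cc2 (k : R -> R) : continuous k -> continuous (fun z : R * R => k z.2).
  by move=> ck; apply: cont_comp => //; exact: cont_snd.
have ch : continuous h by apply: contD; apply: contM; by [exact: cc1|exact: cc2].
have bnd (k : R -> R) : continuous k -> exists2 C, 0 <= C & forall x, 0 <= x <= a -> `|k x| <= C.
  move=> ck; have cpt : compact (k @` `[0, a]%classic).
    by apply: continuous_compact; [exact: continuous_subspaceT|exact: segment_compact].
  have /compact_bounded [M [_ HM]] := cpt; exists (`|M| + 1); first by rewrite addr_ge0.
  have M1 : M < `|M| + 1 by rewrite (le_lt_trans (ler_norm _))// ltrDl.
  by move=> x xa; apply: (HM _ M1); exists x => //=; rewrite in_itv.
have [C1 C10 fC] := bnd f cf; have [C2 C20 gC] := bnd g cg.
have ih : int2 S h.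
  apply: (int2_bounded mS fS (C := C1 * C2 + C2 * C1)); first exact: continuous_measurable2.
  move=> [x y] [/= s1 s2 s3]; rewrite /h/= (le_trans (ler_normD _ _))//.
  by rewrite lerD// normrM ler_pM// ?fC ?gC//; lra.
pose J x := f x * G x + g x * F x.
have cJ : continuous J by apply: contD; exact: contM.
have slice x : (\int[mu]_y ((h \_ S) (x, y))%:E)%E = ((J \_ `]0, a[) x)%:E.
  have [xa|xa] := boolP (0 < x < a); last first.
    rewrite [in RHS]patchE memNset ?/=; last by rewrite /= in_itv/=; exact/negP.
    rewrite integral0_eq// => y _; rewrite patchE memNset// => -[/= s1 s2 s3].
    by move: xa; rewrite s3 (lt_trans s1 s2).
  rewrite [in RHS]patchE mem_set; last by rewrite /= in_itv/=.
  transitivity (\int[mu]_y ((((fun y => h (x, y)) \_ `]0, x[) y)%:E))%E.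
    apply: eq_integral => y _; congr EFin; rewrite !patchE.
    congr (if _ then _ else _); apply/idP/idP; rewrite !inE/= in_itv/=.
      by case=> /= -> ->.
    by move=> /andP[s1 s2]; split=> //=; case/andP: xa.
  have cs : continuous (fun y => h (x, y)) by exact: cont_slice_y.
  have dh (y : R) : is_derive y 1 (fun y => f x * G y + g x * F y) (h (x, y)).
    by apply: (der_eq (derD (derM (der_cst _ _ _) (dG y)) (derM (der_cst _ _ _) (dF y)))); rewrite /h/=; ring.
  have x0 : 0 <= x by case/andP: xa => /ltW.
  rewrite integral_cut// (ri_FTC x0 cs dh) F00 G00 !mulr0 addr0 subr0.
  by [].
rewrite (I2_slice_x mS ih slice) -Rintegral_mkcond.
have -> : \int[mu]_(x in `]0, a[) J x = ri 0 a J.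
  rewrite /ri /Rintegral [in RHS]integral_itv_bndoo//.
  by apply/measurable_EFinP; exact: cont_measurable.
have dJ (x : R) : is_derive x 1 (fun x => F x * G x) (J x).
  by apply: (der_eq (derM (dF x) (dG x))); rewrite /J; ring.
rewrite (ri_FTC (ltW a0) cJ dJ) F00 mul0r subr0.
by rewrite (ri_FTC (ltW a0) cf dF) (ri_FTC (ltW a0) cg dG) F00 G00 !subr0.
Qed.

End triangle_calculus.

(** * Cutoff functions and Green's formula on the triangle *)
Section cutoff.
Context {R : realType}.
Implicit Types (s d : R).

(** [6 (s - 1) (2 - s)], cut to its positive part: continuous, of integral one, and
    enough for a cutoff of class [C^1]. *)
Definition bump s : R := let w := 6 * (s - 1) * (2 - s) in (w + `|w|) / 2.

Lemma bump_continuous : continuous bump.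
Proof.
have cw : continuous (fun s : R => 6 * (s - 1) * (2 - s)) by cont.
rewrite /bump; apply: contM; last exact: cont_cst.
apply: contD => //; apply: (cont_comp (h := fun x : R => `|x|)) cw.
exact: norm_continuous.
Qed.

Lemma bump_ge0 s : 0 <= bump s.
Proof.
rewrite /bump; set w := 6 * _ * _; have := ler_norm (- w); rewrite normrN; lra.
Qed.

Lemma bump_out s : s <= 1 \/ 2 <= s -> bump s = 0.
Proof. by move=> sO; rewrite /bump ler0_norm ?subrr ?mul0r//; case: sO; nra. Qed.

Lemma bump_in s : 1 <= s <= 2 -> bump s = 6 * (s - 1) * (2 - s).
Proof. by move=> sI; rewrite /bump ger0_norm; [lra|nra]. Qed.

Lemma bump_mul_le s : 0 <= s -> s * bump s <= 3.
Proof.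
move=> s0; have [s1|s1] := leP s 1; first by rewrite bump_out; [lra|left].
have [s2|s2] := leP 2 s; first by rewrite bump_out; [lra|right].
rewrite bump_in; last by rewrite !ltW.
have : (s - 1) * (2 - s) <= 4^-1 by have := sqr_ge0 (s - 3 / 2); nra.
nra.
Qed.

(** A step of class [C^1] between [1] and [2], needed because the test functions have
    to be [C^1] with compact support in the open triangle. *)
Lemma smooth_step : exists eta : R -> R, [/\ forall s : R, is_derive s 1 eta (bump s),
  forall s, s <= 1 -> eta s = 0, forall s, 2 <= s -> eta s = 1 &
  forall s, 0 <= eta s <= 1].
Proof.
have [F dF] := primitive bump_continuous.
pose eta s := F s - F 1.
have deta (s : R) : is_derive s 1 eta (bump s).
  by apply: (der_eq (derB (dF s) (der_cst _ _ _))); rewrite subr0.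
have e1 s : s <= 1 -> eta s = 0.
  move=> s1; rewrite /eta -opprB -(ri_FTC s1 bump_continuous dF).
  rewrite (@ri_ext _ s 1 _ (fun=> 0)) ?ri_cst ?mul0r ?oppr0// => x /andP[_ x1].
  by rewrite bump_out//; left.
have e2 s : 2 <= s -> eta s = 1.
  move=> s2; rewrite /eta -(ri_FTC _ bump_continuous dF); last by lra.
  rewrite (@ri_split _ 1 2 s)//; [|lra|exact: bump_continuous].
  rewrite (@ri_ext _ 2 s _ (fun=> 0)); last first.
    by move=> x /andP[x2 _]; rewrite bump_out//; right.
  rewrite ri_cst// mul0r addr0 (@ri_ext _ 1 2 _ (fun s => 6 * (s - 1) * (2 - s))); last first.
    by move=> x x12; rewrite bump_in.
  have d (x : R) : is_derive x 1 (fun s : R => 9 * s ^+ 2 - 2 * s ^+ 3 - 12 * s) (6 * (x - 1) * (2 - x)).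
    by der; ring.
  rewrite (ri_FTC _ _ d); [lra|lra|by cont].
have mono x y : x <= y -> eta x <= eta y.
  move=> xy; apply: (ge0_derive_le xy (fun z _ => deta z)) => z _; exact: bump_ge0.
exists eta; split=> // s; apply/andP; split.
  by have [s1|s1] := leP s 1; [rewrite e1|rewrite -(e1 1)// mono// ltW].
by have [s2|s2] := leP 2 s; [rewrite e2|rewrite -(e2 2)// mono// ltW].
Qed.

End cutoff.

Section green.
Context {R : realType}.
Local Notation T2 := (measurableTypeR R * measurableTypeR R)%type.
Local Notation mu2 := (@lebesgue_measure R \x @lebesgue_measure R)%E.
Variable a : R.
Hypothesis a0 : 0 < a.
Let S := triangle a.
Let mS : measurable (S : set T2) := triangle_measurable a.
Let fS : (mu2 (S : set T2) < +oo)%E := triangle_finite a0.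
Variable eta : R -> R.
Hypothesis deta : forall s : R, is_derive s 1 eta (bump s).
Hypothesis eta1 : forall s, s <= 1 -> eta s = 0.
Hypothesis eta2 : forall s, 2 <= s -> eta s = 1.
Hypothesis eta01 : forall s, 0 <= eta s <= 1.
Implicit Types (z : R * R) (u P Q : R * R -> R) (n : nat).

Let N n : R := n.+1%:R.
Let e n (d : R) := eta (N n * d).
Let b n (d : R) := N n * bump (N n * d).

(** Cutoff at distance of order [1 / n] from the three sides: each factor is a step
    in the distance to one side, up to a constant. *)
Definition chi n z := e n z.2 * e n (z.1 - z.2) * e n (a - z.1).
Definition chix n z := e n z.2 * b n (z.1 - z.2) * e n (a - z.1)
   - e n z.2 * e n (z.1 - z.2) * b n (a - z.1).
Definition chiy n z := b n z.2 * e n (z.1 - z.2) * e n (a - z.1)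
   - e n z.2 * b n (z.1 - z.2) * e n (a - z.1).

Let der_e n f z v d : is_derive z v f d ->
  is_derive z v (fun z : R * R => e n (f z)) (b n (f z) * d).
Proof.
move=> fd; have d1 : is_derive z v (fun z => N n * f z) (N n * d).
  by apply: (der_eq (derM (der_cst (N n) z v) fd)); ring.
by apply: (der_eq (der_comp (deta _) d1)); rewrite /b; ring.
Qed.

Let ceta : continuous eta := der_continuous deta.
Let cont_e n f : continuous f -> continuous (fun z : R * R => e n (f z)).
Proof.
move=> cf; have ck : continuous (fun z => N n * f z) := contM (@cont_cst _ _ (N n)) cf.
exact: (cont_comp (h := eta) ceta ck).
Qed.
Let cont_b n f : continuous f -> continuous (fun z : R * R => b n (f z)).
Proof.
move=> cf; have ck : continuous (fun z => N n * f z) := contM (@cont_cst _ _ (N n)) cf.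
exact: (contM (@cont_cst _ _ (N n)) (cont_comp (h := bump) (@bump_continuous R) ck)).
Qed.

Let cd1 : continuous (fun z : R * R => z.2). Proof. exact: cont_snd. Qed.
Let cd2 : continuous (fun z : R * R => z.1 - z.2). Proof. cont. Qed.
Let cd3 : continuous (fun z : R * R => a - z.1). Proof. cont. Qed.

Lemma chi_continuous n : continuous (chi n).
Proof. by apply: contM; [apply: contM|]; apply: cont_e. Qed.
Lemma chix_continuous n : continuous (chix n).
Proof.
exact: (contB (contM (contM (cont_e (n := n) cd1) (cont_b (n := n) cd2)) (cont_e (n := n) cd3))
  (contM (contM (cont_e (n := n) cd1) (cont_e (n := n) cd2)) (cont_b (n := n) cd3))).
Qed.
Lemma chiy_continuous n : continuous (chiy n).
Proof.
exact: (contB (contM (contM (cont_b (n := n) cd1) (cont_e (n := n) cd2)) (cont_e (n := n) cd3))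
  (contM (contM (cont_e (n := n) cd1) (cont_b (n := n) cd2)) (cont_e (n := n) cd3))).
Qed.

Lemma der_chi_x n z : is_derive z ((1, 0) : R * R) (chi n) (chix n z).
Proof.
have d1 : is_derive z ((1, 0) : R * R) (fun z : R * R => z.2) 0 by exact: der_snd.
have d2 : is_derive z ((1, 0) : R * R) (fun z : R * R => z.1 - z.2) 1.
  by apply: (der_eq (derB (der_fst z (1, 0)) (der_snd z (1, 0)))); rewrite /=; ring.
have d3 : is_derive z ((1, 0) : R * R) (fun z : R * R => a - z.1) (-1).
  by apply: (der_eq (derB (der_cst a z (1, 0)) (der_fst z (1, 0)))); rewrite /=; ring.
by apply: (der_eq (derM (derM (der_e n d1) (der_e n d2)) (der_e n d3))); rewrite /chix; ring.
Qed.

Lemma der_chi_y n z : is_derive z ((0, 1) : R * R) (chi n) (chiy n z).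
Proof.
have d1 : is_derive z ((0, 1) : R * R) (fun z : R * R => z.2) 1 by exact: der_snd.
have d2 : is_derive z ((0, 1) : R * R) (fun z : R * R => z.1 - z.2) (-1).
  by apply: (der_eq (derB (der_fst z (0, 1)) (der_snd z (0, 1)))); rewrite /=; ring.
have d3 : is_derive z ((0, 1) : R * R) (fun z : R * R => a - z.1) 0.
  by apply: (der_eq (derB (der_cst a z (0, 1)) (der_fst z (0, 1)))); rewrite /=; ring.
by apply: (der_eq (derM (derM (der_e n d1) (der_e n d2)) (der_e n d3))); rewrite /chiy; ring.
Qed.

Let Nge1 n : 1 <= N n. Proof. by rewrite /N ler1n. Qed.

Let K n : set (R * R) := [set z | [/\ 1 <= N n * z.2, 1 <= N n * (z.1 - z.2) & 1 <= N n * (a - z.1)]].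

Let KS n : K n `<=` S.
Proof.
have pos (d : R) : 1 <= N n * d -> 0 < d.
  by have := Nge1 n; set m := N n; case: (ltP 0 d) => // d0; nra.
by move=> [x y] [/= /pos k1 /pos k2 /pos k3]; split=> /=; lra.
Qed.

Let K_compact n : compact (K n).
Proof.
have cpt : compact (`[0, a]%classic `*` `[0, a]%classic : set (R * R)).
  by apply: compact_setX; exact: segment_compact.
apply: (subclosed_compact _ cpt); last first.
  by move=> z /KS[z1 z2 z3]; split => /=; rewrite in_itv/=; lra.
have cl (f : R * R -> R) : continuous f -> closed [set z | 1 <= f z].
  move=> cf; have -> : [set z | 1 <= f z] = f @^-1` [set x | 1 <= x] by [].
  by apply: preimage_closed => [z _|]; [exact: cf|exact: closed_ge].
have -> : K n = [set z | 1 <= N n * z.2] `&` [set z | 1 <= N n * (z.1 - z.2)] `&` [set z | 1 <= N n * (a - z.1)].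
  by apply/seteqP; split=> z /=; [case|case=> -[]].
by apply: closedI; [apply: closedI|]; apply: cl; apply: contM => //; exact: cont_cst.
Qed.

Let chi_out n z : ~ K n z -> chi n z = 0.
Proof.
move=> nK; rewrite /chi /e.
have [k1|/ltW k1] := leP 1 (N n * z.2); last by rewrite (eta1 k1) !mul0r.
have [k2|/ltW k2] := leP 1 (N n * (z.1 - z.2)); last by rewrite (eta1 k2) mulr0 mul0r.
have [k3|/ltW k3] := leP 1 (N n * (a - z.1)); last by rewrite (eta1 k3) mulr0.
by case: nK.
Qed.

Lemma C1_of u ux uy : (forall z, is_derive z ((1, 0) : R * R) u (ux z)) ->
  (forall z, is_derive z ((0, 1) : R * R) u (uy z)) ->
  continuous ux -> continuous uy -> [/\ C1 u, dx u = ux & dy u = uy].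
Proof.
move=> d1 d2 c1 c2.
have e1 : dx u = ux by apply/funext => z; rewrite /dx; have [_ ->] := d1 z.
have e2 : dy u = uy by apply/funext => z; rewrite /dy; have [_ ->] := d2 z.
by split=> //; split; rewrite ?e1 ?e2.
Qed.

Lemma chi_mul_C1c n u ux uy : (forall z, is_derive z ((1, 0) : R * R) u (ux z)) ->
  (forall z, is_derive z ((0, 1) : R * R) u (uy z)) ->
  continuous u -> continuous ux -> continuous uy ->
  [/\ C1c S (fun z => chi n z * u z),
      dx (fun z => chi n z * u z) = (fun z => chix n z * u z + chi n z * ux z) &
      dy (fun z => chi n z * u z) = (fun z => chiy n z * u z + chi n z * uy z)].
Proof.
move=> d1 d2 c0 c1 c2.
have [||||C e1 e2] := @C1_of (fun z => chi n z * u z)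
    (fun z => chix n z * u z + chi n z * ux z) (fun z => chiy n z * u z + chi n z * uy z).
- by move=> z; apply: (der_eq (derM (der_chi_x n z) (d1 z))); ring.
- by move=> z; apply: (der_eq (derM (der_chi_y n z) (d2 z))); ring.
- by apply: contD; apply: contM => //; [exact: chix_continuous|exact: chi_continuous].
- by apply: contD; apply: contM => //; [exact: chiy_continuous|exact: chi_continuous].
split=> //; split=> //; exists (K n).
by split; [exact: K_compact|exact: KS|move=> z /chi_out ->; rewrite mul0r].
Qed.

Let e01 n d : 0 <= e n d <= 1. Proof. exact: eta01. Qed.

Let b_le n d (w C : R) : 0 < d -> `|w| <= C * d -> `|b n d * w| <= 3 * C.
Proof.
move=> d1 wC; have d0 := ltW d1; have b0 : 0 <= b n d by rewrite /b mulr_ge0 ?bump_ge0// (le_trans _ (Nge1 n)).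
have C0 : 0 <= C * d by exact: le_trans wC.
rewrite normrM (ger0_norm b0); apply: le_trans (ler_wpM2l b0 wC) _.
have nd0 : 0 <= N n * d by rewrite mulr_ge0// (le_trans _ (Nge1 n)).
have h := bump_mul_le nd0.
have C00 : 0 <= C by rewrite -(pmulr_lge0 _ d1).
rewrite (_ : b n d * (C * d) = N n * d * bump (N n * d) * C); last by rewrite /b; ring.
by rewrite ler_wpM2r.
Qed.

Let dist_gt0 z : S z -> [/\ 0 < z.2, 0 < z.1 - z.2 & 0 < a - z.1].
Proof. by case=> *; rewrite !subr_gt0. Qed.

Let far (d : R) : 0 < d -> exists n0, forall n, (n0 <= n)%N -> 2 <= N n * d.
Proof.
move=> d0; exists (Num.truncn (2 / d)) => n nn.
rewrite -ler_pdivrMr//; have /andP[_ /ltW h] := truncn_itv (ltW (divr_gt0 (ltr0n R 2) d0)).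
by apply: le_trans h _; rewrite /N ler_nat ltnS.
Qed.

Let chi_eventually z : S z -> exists n0, forall n, (n0 <= n)%N ->
  [/\ chi n z = 1, chix n z = 0 & chiy n z = 0].
Proof.
move=> /dist_gt0 [/far [n1 h1] /far [n2 h2] /far [n3 h3]].
exists (maxn n1 (maxn n2 n3)) => n; rewrite !geq_max => /and3P[/h1 k1 /h2 k2 /h3 k3].
have B d : 2 <= N n * d -> e n d = 1 /\ b n d = 0.
  by move=> k; rewrite /e /b eta2// bump_out ?mulr0//; right.
have [e1 b1] := B _ k1; have [e2 b2] := B _ k2; have [e3 b3] := B _ k3.
by rewrite /chi /chix /chiy e1 e2 e3 b1 b2 b3 !(mulr1, mulr0, mul0r, subrr).
Qed.

Let chi01 n z : 0 <= chi n z <= 1.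
Proof.
rewrite /chi; have /andP[p1 q1] := e01 n z.2; have /andP[p2 q2] := e01 n (z.1 - z.2).
have /andP[p3 q3] := e01 n (a - z.1).
by rewrite !mulr_ge0//= !mulr_ile1// mulr_ge0.
Qed.

Let three (x C p q : R) : 0 <= p <= 1 -> 0 <= q <= 1 -> `|x| <= C -> `|p * q * x| <= C.
Proof.
move=> /andP[p0 p1] /andP[q0 q1] xC; rewrite normrM ger0_norm ?mulr_ge0//.
apply: le_trans xC; rewrite ler_piMl// mulr_ile1//.
Qed.

(** Near a side at distance [d] the gradient of the cutoff is of size [1 / d] and normal
    to that side, while the normal component of [(P, Q)] is [O(d)]; the bound is
    therefore uniform in [n]. *)
Lemma chi_tangent n z P Q (C : R) : S z -> `|Q z| <= C * z.2 ->
  `|P z - Q z| <= C * (z.1 - z.2) -> `|P z| <= C * (a - z.1) ->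
  `|chix n z * P z + chiy n z * Q z| <= 9 * C.
Proof.
move=> /dist_gt0 [d1 d2 d3] h1 h2 h3.
have k1 := three (e01 n (z.1 - z.2)) (e01 n (a - z.1)) (b_le n d1 h1).
have k2 := three (e01 n z.2) (e01 n (a - z.1)) (b_le n d2 h2).
have k3 := three (e01 n z.2) (e01 n (z.1 - z.2)) (b_le n d3 h3).
rewrite (_ : _ + _ = e n (z.1 - z.2) * e n (a - z.1) * (b n z.2 * Q z)
  + e n z.2 * e n (a - z.1) * (b n (z.1 - z.2) * (P z - Q z))
  - e n z.2 * e n (z.1 - z.2) * (b n (a - z.1) * P z)); last by rewrite /chix /chiy; ring.
apply: le_trans (ler_normB _ _) _; apply: le_trans (lerD (ler_normD _ _) (lexx _)) _.
lra.
Qed.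

Let bounded_by h (C : R) : continuous h -> (forall z, `|h z| <= C) -> L2 S h.
Proof.
by move=> ch hC; apply: (L2_bounded mS fS (C := C)) => //; exact: continuous_measurable2.
Qed.

(** Insert the field [(P, Q)], cut off near the boundary, in the definition of the weak
    derivatives of [v]. As [n] grows the term carrying the gradient of the cutoff
    vanishes by domination: the field is tangent to the sides to first order. *)
Lemma green P Q Px Py Qx Qy (C C' : R) v vx vy :
  (forall z, is_derive z ((1, 0) : R * R) P (Px z)) ->
  (forall z, is_derive z ((0, 1) : R * R) P (Py z)) ->
  (forall z, is_derive z ((1, 0) : R * R) Q (Qx z)) ->
  (forall z, is_derive z ((0, 1) : R * R) Q (Qy z)) ->
  continuous P -> continuous Q -> continuous Px -> continuous Py ->
  continuous Qx -> continuous Qy ->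
  (forall z, `|P z| <= C') -> (forall z, `|Q z| <= C') ->
  (forall z, `|Px z + Qy z| <= C') ->
  (forall z, S z -> [/\ `|Q z| <= C * z.2, `|P z - Q z| <= C * (z.1 - z.2) &
     `|P z| <= C * (a - z.1)]) ->
  sobolev S v vx vy ->
  I2 S (fun z => P z * vx z + Q z * vy z) = - I2 S (fun z => (Px z + Qy z) * v z).
Proof.
move=> dPx dPy dQx dQy cP cQ cPx cPy cQx cQy bP bQ bD tang [Lv Lvx Lvy wk].
have C'0 : 0 <= C' by exact: le_trans (bP (0, 0)).
have LP := bounded_by cP bP; have LQ := bounded_by cQ bQ.
have cD : continuous (fun z => Px z + Qy z) by exact: contD.
have LD := bounded_by cD bD.
have iG : int2 S (fun z => P z * vx z + Q z * vy z) by apply: (int2D mS); exact: L2_mul.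
have iH : int2 S (fun z => (Px z + Qy z) * v z) by exact: L2_mul.
have iv := int2_norm (L2_int mS fS Lv).
have mv := L2_meas Lv.
have mG := int2_meas iG; have mH := int2_meas iH.
pose A n z := chi n z * (P z * vx z + Q z * vy z).
pose B n z := chi n z * ((Px z + Qy z) * v z).
pose D n z := (chix n z * P z + chiy n z * Q z) * v z.
have mchi n : measurable_fun (S : set T2) (chi n).
  by apply: continuous_measurable2; exact: chi_continuous.
have mA n : measurable_fun (S : set T2) (A n) by exact: measurable_funM.
have mB n : measurable_fun (S : set T2) (B n) by exact: measurable_funM.
have cT n : continuous (fun z => chix n z * P z + chiy n z * Q z).
  by apply: contD; apply: contM => //; [exact: chix_continuous|exact: chiy_continuous].
have mD n : measurable_fun (S : set T2) (D n).
  by apply: measurable_funM => //; exact: continuous_measurable2.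
have chi_le n z (x : R) : `|chi n z * x| <= `|x|.
  by have /andP[c0 c1] := chi01 n z; rewrite normrM ger0_norm// ler_piMl.
have bDn n z : S z -> `|D n z| <= 9 * C * `|v z|.
  move=> Sz; rewrite /D normrM ler_wpM2r//; have [t1 t2 t3] := tang z Sz.
  exact: chi_tangent.
have iA n : int2 S (A n) by apply: (int2_le mS (mA n) _ (int2_norm iG)) => z _; exact: chi_le.
have iB n : int2 S (B n) by apply: (int2_le mS (mB n) _ (int2_norm iH)) => z _; exact: chi_le.
have iDn n : int2 S (D n) by apply: (int2_le mS (mD n) (bDn n) (int2Z mS (9 * C) iv)).
have eqn n : I2 S (A n) = - I2 S (B n) - I2 S (D n).
  have [T1 e1 _] := chi_mul_C1c n dPx dPy cP cPx cPy.
  have [T2' _ e2] := chi_mul_C1c n dQx dQy cQ cQx cQy.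
  have [w1 _] := wk _ T1; have [_ w2] := wk _ T2'.
  rewrite e1 in w1; rewrite e2 in w2.
  have L2c h : continuous h -> (exists C, forall z, S z -> `|h z| <= C) -> L2 S h.
    by move=> ch [c hc]; apply: (L2_bounded mS fS (C := c)) => //; exact: continuous_measurable2.
  have [[c1 _ _ _] [c2 _ _ _]] := (C1c_facts T1, C1c_facts T2').
  have Lc1 : L2 S (fun z => chi n z * P z).
    by apply: L2c => //; exists C' => z _; apply: le_trans (chi_le _ _ _) _.
  have Lc2 : L2 S (fun z => chi n z * Q z).
    by apply: L2c => //; exists C' => z _; apply: le_trans (chi_le _ _ _) _.
  have bndc h : C1c S h -> L2 S (dx h) /\ L2 S (dy h).
    move=> /C1c_facts [_ cx cy [K' [cK' _ hK']]]; split; apply: L2c => //.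
      by have [|M _ HM] := compact_support_bounded cx cK'; [by move=> z /hK'[]|exists M].
    by have [|M _ HM] := compact_support_bounded cy cK'; [by move=> z /hK'[]|exists M].
  have [Ld1 _] := bndc _ T1; have [_ Ld2] := bndc _ T2'.
  rewrite e1 in Ld1; rewrite e2 in Ld2.
  have i1 := L2_mul mS Lvx Lc1; have i2 := L2_mul mS Lvy Lc2.
  have i3 := L2_mul mS Lv Ld1; have i4 := L2_mul mS Lv Ld2.
  have -> : I2 S (A n) = I2 S (fun z => vx z * (chi n z * P z)) + I2 S (fun z => vy z * (chi n z * Q z)).
    by rewrite -(I2D mS i1 i2); apply: I2_ext => z _; rewrite /A; ring.
  rewrite -opprD -(I2D mS (iB n) (iDn n)).
  rewrite -[I2 S (fun z => vx z * _)]opprK -[I2 S (fun z => vy z * _)]opprK.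
  rewrite -opprD; congr (- _); rewrite /I2 -w1 -w2 -/(I2 S _) -/(I2 S _) -(I2D mS i3 i4).
  by apply: I2_ext => z _; rewrite /B /D; ring.
have cvgc (f : R * R -> R) z : S z -> (chi n z * f z) @[n --> \oo] --> f z.
  move=> /chi_eventually [n0 H]; apply: cvg_near_cst.
  by exists n0 => // n /= /H[-> _ _]; rewrite mul1r.
have lA : I2 S (A n) @[n --> \oo] --> I2 S (fun z => P z * vx z + Q z * vy z).
  apply: (I2_dominated mS mA mG _ (int2_norm iG)) => [z Sz|n z _]; last exact: chi_le.
  exact: (cvgc (fun z => P z * vx z + Q z * vy z)).
have lB : I2 S (B n) @[n --> \oo] --> I2 S (fun z => (Px z + Qy z) * v z).
  apply: (I2_dominated mS mB mH _ (int2_norm iH)) => [z Sz|n z _]; last exact: chi_le.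
  exact: (cvgc (fun z => (Px z + Qy z) * v z)).
have lD : I2 S (D n) @[n --> \oo] --> I2 S (fun=> 0).
  apply: (I2_dominated mS mD _ _ (int2Z mS (9 * C) iv) bDn); first exact: measurable_cst.
  move=> z /chi_eventually [n0 H]; apply: cvg_near_cst.
  by exists n0 => // n /= /H[_ h1 h2]; rewrite /D h1 h2 !mul0r addr0 mul0r.
rewrite (I20 mS fS) in lD.
have lR := seq_cvgB (@seq_cvgZ _ _ (-1) _ lB) lD; rewrite subr0 mulN1r in lR.
have lA' : I2 S (A n) @[n --> \oo] --> - I2 S (fun z => (Px z + Qy z) * v z).
  by apply: cvg_ext lR => n; rewrite eqn mulN1r.
by apply: (cvg_unique _ lA lA').
Qed.

(** The functions [chi n * u] approximate [u] in [H^1]: their gradients stay bounded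
    because [u] compensates the growth of the gradient of the cutoff. *)
Lemma bC1_sobolev0 u ux uy (C : R) : bC1 u ux uy ->
  (forall z, S z -> [/\ `|u z| <= C * z.2, `|u z| <= C * (z.1 - z.2) &
     `|u z| <= C * (a - z.1)]) -> sobolev0 S u ux uy.
Proof.
move=> bu vanish; split; first exact: bC1_sobolev.
move=> eps eps0; have [d1 d2 [c0 cx cy] [C' bC']] := bu.
have C'0 : 0 <= C' by have [h _ _] := bC' (0, 0); exact: le_trans h.
pose X n z := (u z - chi n z * u z) ^+ 2 + (ux z - (chix n z * u z + chi n z * ux z)) ^+ 2
   + (uy z - (chiy n z * u z + chi n z * uy z)) ^+ 2.
have cX n : continuous (X n).
  have cc := @chi_continuous n; have ccx := @chix_continuous n; have ccy := @chiy_continuous n.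
  by apply: contD; [apply: contD|]; apply: contX; apply: contB => //; [|apply: contD|apply: contD]; exact: contM.
(* A constant majorant: the triangle has finite area. *)
pose M := 3 * (2 * C' + 9 * C) ^+ 2.
have tx n z : S z -> `|chix n z * u z| <= 9 * C /\ `|chiy n z * u z| <= 9 * C.
  move=> Sz; have [v1 v2 v3] := vanish z Sz; have [p1 p2 p3] := dist_gt0 Sz.
  have C0 : 0 <= C by rewrite -(pmulr_lge0 _ p1); exact: le_trans v1.
  split.
    have := @chi_tangent n z u (fun=> 0) C Sz; rewrite subr0 normr0 mulr0 addr0; apply=> //.
    by rewrite mulr_ge0// ltW.
  have := @chi_tangent n z (fun=> 0) u C Sz; rewrite sub0r normrN normr0 mulr0 add0r; apply=> //.
  by rewrite mulr_ge0// ltW.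
have bX n z : S z -> `|X n z| <= M.
  move=> Sz; have [t1 t2] := tx n z Sz; have [b1 b2 b3] := bC' z.
  have /andP[k0 k1] := chi01 n z.
  have one (x w : R) : `|x| <= C' -> `|w| <= 9 * C -> (x - (w + chi n z * x)) ^+ 2 <= (2 * C' + 9 * C) ^+ 2.
    move=> xC wC; rewrite -[leLHS]real_normK ?num_real// lerXn2r ?nnegrE//.
      by have := le_trans (normr_ge0 _) wC; lra.
    apply: le_trans (ler_normB _ _) _; apply: le_trans (lerD (lexx _) (ler_normD _ _)) _.
    have : `|chi n z * x| <= `|x| by rewrite normrM ger0_norm// ler_piMl.
    lra.
  have o1 := one _ 0 b1 _; rewrite add0r normr0 in o1.
  have o1' := o1 (le_trans (normr_ge0 _) t1).
  have o2 := one _ _ b2 t1; have o3 := one _ _ b3 t2.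
  rewrite ger0_norm; last by rewrite !addr_ge0// sqr_ge0.
  by rewrite /X /M; lra.
have lX : I2 S (X n) @[n --> \oo] --> I2 S (fun=> 0).
  apply: (I2_dominated mS _ _ _ (int2_cst mS fS M) bX) => [n||z Sz].
  - exact: continuous_measurable2.
  - exact: measurable_cst.
  have [n0 H] := chi_eventually Sz; apply: cvg_near_cst.
  by exists n0 => // n /= /H[h0 h1 h2]; rewrite /X h0 h1 h2; ring.
rewrite (I20 mS fS) in lX.
have /cvgrPdist_lt /(_ _ eps0) [n _ Hn] := lX.
have [Cc e1 e2] := chi_mul_C1c n d1 d2 c0 cx cy.
exists (fun z => chi n z * u z) => //; rewrite e1 e2.
have := Hn n (leqnn n); rewrite /= sub0r normrN; apply: le_lt_trans; exact: ler_norm.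
Qed.

End green.

(** * The explicit eigenfunctions *)
Section modes.
Context {R : realType}.
Local Notation T2 := (measurableTypeR R * measurableTypeR R)%type.
Local Notation mu2 := (@lebesgue_measure R \x @lebesgue_measure R)%E.
Variable a : R.
Hypothesis a0 : 0 < a.
Let S := triangle a.
Let mS : measurable (S : set T2) := triangle_measurable a.
Let fS : (mu2 (S : set T2) < +oo)%E := triangle_finite a0.
Implicit Types (bc : boundary_condition) (m n : nat) (z : R * R) (x y : R).

Definition freq m : R := m%:R * (pi / a).
Definition trig bc m x := match bc with Neumann => cos (freq m * x) | Dirichlet => sin (freq m * x) end.
Definition dtrig bc m x := match bc with
  Neumann => - (freq m * sin (freq m * x)) | Dirichlet => freq m * cos (freq m * x) end.
(** Parity with respect to the diagonal, which is a side of the triangle: even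
    functions have vanishing normal derivative there, odd ones vanish. *)
Definition swap_sign bc : R := match bc with Neumann => 1 | Dirichlet => -1 end.

(** Product eigenfunctions of the square, made even or odd across its diagonal. *)
Definition eigmode bc m n z := trig bc m z.1 * trig bc n z.2 + swap_sign bc * (trig bc n z.1 * trig bc m z.2).
Definition eigmode_dx bc m n z := dtrig bc m z.1 * trig bc n z.2 + swap_sign bc * (dtrig bc n z.1 * trig bc m z.2).
Definition eigmode_dy bc m n z := trig bc m z.1 * dtrig bc n z.2 + swap_sign bc * (trig bc n z.1 * dtrig bc m z.2).
Definition eigmode_dxy bc m n z := dtrig bc m z.1 * dtrig bc n z.2 + swap_sign bc * (dtrig bc n z.1 * dtrig bc m z.2).
Definition eigmode_dxx bc m n z := - (freq m ^+ 2) * (trig bc m z.1 * trig bc n z.2)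
  - freq n ^+ 2 * (swap_sign bc * (trig bc n z.1 * trig bc m z.2)).
Definition eigmode_dyy bc m n z := - (freq n ^+ 2) * (trig bc m z.1 * trig bc n z.2)
  - freq m ^+ 2 * (swap_sign bc * (trig bc n z.1 * trig bc m z.2)).
Definition eigval m n : R := freq m ^+ 2 + freq n ^+ 2.

Lemma freq_ge0 m : 0 <= freq m.
Proof. by rewrite /freq mulr_ge0// divr_ge0 ?pi_ge0// ltW. Qed.

Lemma der_trig bc m x : is_derive x 1 (trig bc m) (dtrig bc m x).
Proof. by case: bc; rewrite /trig /dtrig; der; ring. Qed.

Lemma der_dtrig bc m x : is_derive x 1 (dtrig bc m) (- (freq m ^+ 2) * trig bc m x).
Proof. by case: bc; rewrite /trig /dtrig; der; ring. Qed.

Lemma trig_continuous bc m : continuous (trig bc m).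
Proof. exact: der_continuous (der_trig bc m). Qed.
Lemma dtrig_continuous bc m : continuous (dtrig bc m).
Proof. exact: der_continuous (der_dtrig bc m). Qed.

Section tensor.
Variables (f g df dg : R -> R).
Hypotheses (dff : forall x : R, is_derive x 1 f (df x)) (dgg : forall x : R, is_derive x 1 g (dg x)).
Lemma der_tensor_x z : is_derive z ((1, 0) : R * R) (fun z => f z.1 * g z.2) (df z.1 * g z.2).
Proof.
have d1 := @der_comp _ _ f (fun z : R * R => z.1) z (1, 0) _ _ (dff _) (der_fst z (1, 0)).
have d2 := @der_comp _ _ g (fun z : R * R => z.2) z (1, 0) _ _ (dgg _) (der_snd z (1, 0)).
by apply: (der_eq (derM d1 d2)); rewrite /=; ring.
Qed.
Lemma der_tensor_y z : is_derive z ((0, 1) : R * R) (fun z => f z.1 * g z.2) (f z.1 * dg z.2).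
Proof.
have d1 := @der_comp _ _ f (fun z : R * R => z.1) z (0, 1) _ _ (dff _) (der_fst z (0, 1)).
have d2 := @der_comp _ _ g (fun z : R * R => z.2) z (0, 1) _ _ (dgg _) (der_snd z (0, 1)).
by apply: (der_eq (derM d1 d2)); rewrite /=; ring.
Qed.
End tensor.

Lemma cont_tensor (f g : R -> R) : continuous f -> continuous g ->
  continuous (fun z : R * R => f z.1 * g z.2).
Proof.
move=> cf cg; exact: (contM (cont_comp cf (@cont_fst R)) (cont_comp cg (@cont_snd R))).
Qed.

Lemma der_eigmode_x bc m n z : is_derive z ((1, 0) : R * R) (eigmode bc m n) (eigmode_dx bc m n z).
Proof.
have T k l := der_tensor_x (der_trig bc k) (der_trig bc l) z.
by apply: (der_eq (derD (T m n) (derM (der_cst (swap_sign bc) z (1, 0)) (T n m)))); rewrite /eigmode_dx; ring.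
Qed.
Lemma der_eigmode_y bc m n z : is_derive z ((0, 1) : R * R) (eigmode bc m n) (eigmode_dy bc m n z).
Proof.
have T k l := der_tensor_y (der_trig bc k) (der_trig bc l) z.
by apply: (der_eq (derD (T m n) (derM (der_cst (swap_sign bc) z (0, 1)) (T n m)))); rewrite /eigmode_dy; ring.
Qed.
Lemma der_eigmode_dx_x bc m n z : is_derive z ((1, 0) : R * R) (eigmode_dx bc m n) (eigmode_dxx bc m n z).
Proof.
have T k l := der_tensor_x (der_dtrig bc k) (der_trig bc l) z.
by apply: (der_eq (derD (T m n) (derM (der_cst (swap_sign bc) z (1, 0)) (T n m)))); rewrite /eigmode_dxx; ring.
Qed.
Lemma der_eigmode_dx_y bc m n z : is_derive z ((0, 1) : R * R) (eigmode_dx bc m n) (eigmode_dxy bc m n z).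
Proof.
have T k l := der_tensor_y (der_dtrig bc k) (der_trig bc l) z.
by apply: (der_eq (derD (T m n) (derM (der_cst (swap_sign bc) z (0, 1)) (T n m)))); rewrite /eigmode_dxy; ring.
Qed.
Lemma der_eigmode_dy_x bc m n z : is_derive z ((1, 0) : R * R) (eigmode_dy bc m n) (eigmode_dxy bc m n z).
Proof.
have T k l := der_tensor_x (der_trig bc k) (der_dtrig bc l) z.
by apply: (der_eq (derD (T m n) (derM (der_cst (swap_sign bc) z (1, 0)) (T n m)))); rewrite /eigmode_dxy; ring.
Qed.
Lemma der_eigmode_dy_y bc m n z : is_derive z ((0, 1) : R * R) (eigmode_dy bc m n) (eigmode_dyy bc m n z).
Proof.
have T k l := der_tensor_y (der_trig bc k) (der_dtrig bc l) z.
by apply: (der_eq (derD (T m n) (derM (der_cst (swap_sign bc) z (0, 1)) (T n m)))); rewrite /eigmode_dyy; ring.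
Qed.

Let cdual (f1 g1 f2 g2 : R -> R) (c d : R) : continuous f1 -> continuous g1 -> continuous f2 -> continuous g2 ->
  continuous (fun z : R * R => c * (f1 z.1 * g1 z.2) + d * (f2 z.1 * g2 z.2)).
Proof.
move=> c1 c2 c3 c4.
exact: (contD (contM (@cont_cst _ _ c) (cont_tensor c1 c2)) (contM (@cont_cst _ _ d) (cont_tensor c3 c4))).
Qed.

Let cont_ext (f g : R * R -> R) : f =1 g -> continuous f -> continuous g.
Proof. by move=> /funext ->. Qed.

Lemma eigmode_continuous bc m n : [/\ continuous (eigmode bc m n), continuous (eigmode_dx bc m n),
  continuous (eigmode_dy bc m n) & [/\ continuous (eigmode_dxx bc m n), continuous (eigmode_dyy bc m n) & continuous (eigmode_dxy bc m n)]].
Proof.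
have c0 k := @trig_continuous bc k; have c1 k := @dtrig_continuous bc k.
split; [| | |split].
- by apply: (@cont_ext _ _ _ (@cdual _ _ _ _ 1 (swap_sign bc) (c0 m) (c0 n) (c0 n) (c0 m)) ) => z; rewrite /eigmode; ring.
- by apply: (@cont_ext _ _ _ (@cdual _ _ _ _ 1 (swap_sign bc) (c1 m) (c0 n) (c1 n) (c0 m)) ) => z; rewrite /eigmode_dx; ring.
- by apply: (@cont_ext _ _ _ (@cdual _ _ _ _ 1 (swap_sign bc) (c0 m) (c1 n) (c0 n) (c1 m)) ) => z; rewrite /eigmode_dy; ring.
- by apply: (@cont_ext _ _ _ (@cdual _ _ _ _ (- (freq m ^+ 2)) (- (freq n ^+ 2 * swap_sign bc)) (c0 m) (c0 n) (c0 n) (c0 m)) ) => z; rewrite /eigmode_dxx; ring.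
- by apply: (@cont_ext _ _ _ (@cdual _ _ _ _ (- (freq n ^+ 2)) (- (freq m ^+ 2 * swap_sign bc)) (c0 m) (c0 n) (c0 n) (c0 m)) ) => z; rewrite /eigmode_dyy; ring.
- by apply: (@cont_ext _ _ _ (@cdual _ _ _ _ 1 (swap_sign bc) (c1 m) (c1 n) (c1 n) (c1 m)) ) => z; rewrite /eigmode_dxy; ring.
Qed.

Lemma trig_le1 bc m x : `|trig bc m x| <= 1.
Proof. by case: bc; [exact: cos_max|exact: sin_max]. Qed.

Lemma dtrig_le bc m x : `|dtrig bc m x| <= freq m.
Proof.
have f0 := freq_ge0 m.
by case: bc; rewrite /dtrig ?normrN normrM (ger0_norm f0) ler_piMr// ?sin_max ?cos_max.
Qed.

Lemma swap_sign_norm bc : `|swap_sign bc| = 1.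
Proof. by case: bc; rewrite /swap_sign ?normrN normr1. Qed.

Let dual_le bc (p q r s A B : R) : `|p * q| <= A -> `|r * s| <= B -> `|p * q + swap_sign bc * (r * s)| <= A + B.
Proof.
move=> h1 h2; apply: le_trans (ler_normD _ _) _; apply: lerD => //.
by rewrite normrM swap_sign_norm mul1r.
Qed.

Let mul_le (p q A B : R) : `|p| <= A -> `|q| <= B -> `|p * q| <= A * B.
Proof. by move=> h1 h2; rewrite normrM ler_pM. Qed.

Definition bnd m n : R := 2 + freq m + freq n.

Lemma eigmode_bounds bc m n z : [/\ `|eigmode bc m n z| <= bnd m n, `|eigmode_dx bc m n z| <= bnd m n
   & `|eigmode_dy bc m n z| <= bnd m n].
Proof.
have [f1 f2] := (freq_ge0 m, freq_ge0 n).
have h k x := trig_le1 bc k x; have h1 k x := dtrig_le bc k x.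
split.
- by apply: le_trans (dual_le bc (mul_le (h _ _) (h _ _)) (mul_le (h _ _) (h _ _))) _; rewrite /bnd; lra.
- by apply: le_trans (dual_le bc (mul_le (h1 _ _) (h _ _)) (mul_le (h1 _ _) (h _ _))) _; rewrite /bnd; lra.
- by apply: le_trans (dual_le bc (mul_le (h _ _) (h1 _ _)) (mul_le (h _ _) (h1 _ _))) _; rewrite /bnd; lra.
Qed.

Lemma eigmode_bC1 bc m n : bC1 (eigmode bc m n) (eigmode_dx bc m n) (eigmode_dy bc m n).
Proof.
have [c0 c1 c2 _] := eigmode_continuous bc m n.
split=> //; [exact: der_eigmode_x|exact: der_eigmode_y|].
by exists (bnd m n) => z; exact: eigmode_bounds.
Qed.

Lemma eigmode_eigen bc m n z : eigmode_dxx bc m n z + eigmode_dyy bc m n z = - (eigval m n * eigmode bc m n z).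
Proof. by rewrite /eigmode_dxx /eigmode_dyy /eigval /eigmode; ring. Qed.

Lemma freq_a m : freq m * a = m%:R * pi.
Proof. by rewrite /freq; field; rewrite gt_eqF. Qed.

Lemma sin_freq_end m x : `|sin (freq m * x)| <= freq m * `|a - x|.
Proof.
have := sin_lipschitz (freq m * x) (freq m * a).
rewrite freq_a sin_natpi subr0 -freq_a -mulrBr normrM (ger0_norm (freq_ge0 m)).
by rewrite (distrC x).
Qed.

Lemma sin_freq_start m x : `|sin (freq m * x)| <= freq m * `|x|.
Proof.
by apply: le_trans (sin_le_abs _) _; rewrite normrM (ger0_norm (freq_ge0 m)).
Qed.

Lemma trig_lipschitz bc m x y : `|trig bc m x - trig bc m y| <= freq m * `|x - y|.
Proof. exact: (derive_lipschitz (der_trig bc m) (dtrig_le bc m)). Qed.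

Lemma dtrig_lipschitz bc m x y : `|dtrig bc m x - dtrig bc m y| <= freq m ^+ 2 * `|x - y|.
Proof.
apply: (derive_lipschitz (der_dtrig bc m)) => z.
by rewrite normrM normrN (ger0_norm (sqr_ge0 _)) ler_piMr ?sqr_ge0// trig_le1.
Qed.

Let L2md bc m n : L2 S (eigmode bc m n).
Proof. by have [] := bC1_sobolev a0 (eigmode_bC1 bc m n). Qed.

Let L2c (h : R * R -> R) (C : R) : continuous h -> (forall z, `|h z| <= C) -> L2 S h.
Proof.
by move=> ch hC; apply: (L2_bounded mS fS (C := C)) => //; exact: continuous_measurable2.
Qed.

Lemma neumann_tangent m n z : S z ->
  [/\ `|eigmode_dy Neumann m n z| <= 2 * (freq m + freq n) ^+ 2 * z.2,
   `|eigmode_dx Neumann m n z - eigmode_dy Neumann m n z| <= 2 * (freq m + freq n) ^+ 2 * (z.1 - z.2) &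
   `|eigmode_dx Neumann m n z| <= 2 * (freq m + freq n) ^+ 2 * (a - z.1)].
Proof.
case=> z1 z2 z3; have [f1 f2] := (freq_ge0 m, freq_ge0 n).
have h k x := trig_le1 Neumann k x.
have [y0 xy ax] : [/\ 0 <= z.2, 0 <= z.1 - z.2 & 0 <= a - z.1] by split; lra.
have sq : freq m ^+ 2 + freq n ^+ 2 <= 2 * (freq m + freq n) ^+ 2 by nra.
have hy k : `|dtrig Neumann k z.2| <= freq k ^+ 2 * z.2.
  rewrite /dtrig normrN normrM (ger0_norm (freq_ge0 k)) expr2 -mulrA ler_wpM2l ?freq_ge0//.
  by have := sin_freq_start k z.2; rewrite (ger0_norm y0).
have hx k : `|dtrig Neumann k z.1| <= freq k ^+ 2 * (a - z.1).
  rewrite /dtrig normrN normrM (ger0_norm (freq_ge0 k)) expr2 -mulrA ler_wpM2l ?freq_ge0//.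
  by have := sin_freq_end k z.1; rewrite (ger0_norm ax).
split.
- apply: le_trans (dual_le Neumann (mul_le (h m z.1) (hy n)) (mul_le (h n z.1) (hy m))) _.
  by rewrite !mul1r -mulrDl ler_wpM2r// addrC.
- pose D k l := dtrig Neumann k z.1 * (trig Neumann l z.2 - trig Neumann l z.1)
     + trig Neumann l z.1 * (dtrig Neumann k z.1 - dtrig Neumann k z.2).
  have -> : eigmode_dx Neumann m n z - eigmode_dy Neumann m n z = D m n + D n m.
    by rewrite /eigmode_dx /eigmode_dy /D /swap_sign; ring.
  have hD k l : `|D k l| <= (freq k * freq l + freq k ^+ 2) * (z.1 - z.2).
    rewrite mulrDl; apply: le_trans (ler_normD _ _) _; apply: lerD.
      apply: le_trans (mul_le (dtrig_le Neumann k z.1) (trig_lipschitz Neumann l z.2 z.1)) _.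
      by rewrite distrC (ger0_norm xy) mulrA.
    apply: le_trans (mul_le (h l z.1) (dtrig_lipschitz Neumann k z.1 z.2)) _.
    by rewrite mul1r (ger0_norm xy).
  apply: le_trans (ler_normD _ _) _; apply: le_trans (lerD (hD m n) (hD n m)) _.
  by rewrite -mulrDl ler_wpM2r//; nra.
- apply: le_trans (dual_le Neumann (mul_le (hx m) (h n z.2)) (mul_le (hx n) (h m z.2))) _.
  by rewrite !mulr1 -mulrDl ler_wpM2r.
Qed.

Lemma dirichlet_vanish m n z : S z ->
  [/\ `|eigmode Dirichlet m n z| <= (freq m + freq n) * z.2,
   `|eigmode Dirichlet m n z| <= (freq m + freq n) * (z.1 - z.2) &
   `|eigmode Dirichlet m n z| <= (freq m + freq n) * (a - z.1)].
Proof.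
case=> z1 z2 z3.
have h k x := trig_le1 Dirichlet k x.
have [y0 xy ax] : [/\ 0 <= z.2, 0 <= z.1 - z.2 & 0 <= a - z.1] by split; lra.
have hy k : `|trig Dirichlet k z.2| <= freq k * z.2.
  by have := sin_freq_start k z.2; rewrite (ger0_norm y0).
have hx k : `|trig Dirichlet k z.1| <= freq k * (a - z.1).
  by have := sin_freq_end k z.1; rewrite (ger0_norm ax).
split.
- apply: le_trans (dual_le Dirichlet (mul_le (h m z.1) (hy n)) (mul_le (h n z.1) (hy m))) _.
  by rewrite !mul1r -mulrDl addrC.
- have -> : eigmode Dirichlet m n z = trig Dirichlet m z.1 * (trig Dirichlet n z.2 - trig Dirichlet n z.1)
     + trig Dirichlet n z.1 * (trig Dirichlet m z.1 - trig Dirichlet m z.2).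
    by rewrite /eigmode /swap_sign; ring.
  apply: le_trans (ler_normD _ _) _; rewrite mulrDl addrC; apply: lerD.
    apply: le_trans (mul_le (h n z.1) (trig_lipschitz Dirichlet m z.1 z.2)) _.
    by rewrite mul1r (ger0_norm xy).
  apply: le_trans (mul_le (h m z.1) (trig_lipschitz Dirichlet n z.2 z.1)) _.
  by rewrite mul1r distrC (ger0_norm xy).
- apply: le_trans (dual_le Dirichlet (mul_le (hx m) (h n z.2)) (mul_le (hx n) (h m z.2))) _.
  by rewrite !mulr1 -mulrDl.
Qed.

Lemma eigmode_form_domain bc m n : form_domain bc S (eigmode bc m n) (eigmode_dx bc m n) (eigmode_dy bc m n).
Proof.
case: bc => /=; first exact/bC1_sobolev/eigmode_bC1.
have [eta [e1 e2 e3 e4]] := @smooth_step R.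
apply: (bC1_sobolev0 a0 e1 e2 e3 e4 (eigmode_bC1 Dirichlet m n)) => z.
exact: dirichlet_vanish.
Qed.

(** Green's formula for the gradient of a mode, whose normal component vanishes on
    the three sides. *)
Lemma neumann_form m n v vx vy : sobolev S v vx vy ->
  I2 S (fun z => eigmode_dx Neumann m n z * vx z + eigmode_dy Neumann m n z * vy z) =
  I2 S (fun z => eigval m n * eigmode Neumann m n z * v z).
Proof.
move=> sv; have [eta [e1 e2 e3 e4]] := @smooth_step R.
have [c0 c1 c2 [c3 c4 c5]] := eigmode_continuous Neumann m n.
have ev0 : 0 <= eigval m n by rewrite addr_ge0 ?sqr_ge0.
have bn0 : 0 <= bnd m n by rewrite /bnd !addr_ge0 ?freq_ge0.
pose C' := bnd m n + eigval m n * bnd m n.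
have leC : bnd m n <= C' by rewrite lerDl mulr_ge0.
rewrite (green a0 e1 e2 e3 e4 (C := 2 * (freq m + freq n) ^+ 2) (C' := C')
  (@der_eigmode_dx_x Neumann m n) (@der_eigmode_dx_y Neumann m n) (@der_eigmode_dy_x Neumann m n)
  (@der_eigmode_dy_y Neumann m n) c1 c2 c3 c5 c5 c4 _ _ _ _ sv).
- have i1 : int2 S (fun z => (eigmode_dxx Neumann m n z + eigmode_dyy Neumann m n z) * v z).
    have [Lv _ _ _] := sv; apply: (L2_mul mS _ Lv).
    rewrite (_ : (fun z => _) = (fun z => - eigval m n * eigmode Neumann m n z)); first exact: L2Z.
    by apply/funext => z; rewrite eigmode_eigen mulNr.
  rewrite -mulN1r -(I2Z mS _ i1); apply: I2_ext => z _; rewrite eigmode_eigen; ring.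
- by move=> z; have [_ h _] := eigmode_bounds Neumann m n z; exact: le_trans leC.
- by move=> z; have [_ _ h] := eigmode_bounds Neumann m n z; exact: le_trans leC.
- move=> z; rewrite eigmode_eigen normrN normrM (ger0_norm ev0).
  have [h _ _] := eigmode_bounds Neumann m n z.
  by apply: (@le_trans _ _ (eigval m n * bnd m n)); [rewrite ler_wpM2l|rewrite lerDr].
- by move=> z; exact: neumann_tangent.
Qed.

(** Integration by parts against a test function, from which the Dirichlet case
    follows by density. *)
Lemma test_form bc m n psi : C1c S psi ->
  I2 S (fun z => eigmode_dx bc m n z * dx psi z + eigmode_dy bc m n z * dy psi z) =
  I2 S (fun z => eigval m n * eigmode bc m n z * psi z).
Proof.
move=> Cp; have [c0 c1 c2 [c3 c4 c5]] := eigmode_continuous bc m n.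
have [_ i1 _] := cont_mul_int2 a0 Cp c1; have [_ _ i2] := cont_mul_int2 a0 Cp c2.
have [i3 _ _] := cont_mul_int2 a0 Cp c3; have [i4 _ _] := cont_mul_int2 a0 Cp c4.
rewrite (I2D mS i1 i2) (ibp_x a0 c1 c3 (@der_eigmode_dx_x bc m n) Cp) (ibp_y a0 c2 c4 (@der_eigmode_dy_y bc m n) Cp).
rewrite -opprD -(I2D mS i3 i4) -mulN1r -(I2Z mS _ (int2D mS i3 i4)).
apply: I2_ext => z _; have := eigmode_eigen bc m n z.
by move/(congr1 (fun t => - t * psi z)); rewrite opprK => <-; ring.
Qed.

(** Both sides are continuous in [v] for the [H^1] norm, and they agree on test
    functions by [test_form]. *)
Lemma dirichlet_form m n v vx vy : sobolev0 S v vx vy ->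
  I2 S (fun z => eigmode_dx Dirichlet m n z * vx z + eigmode_dy Dirichlet m n z * vy z) =
  I2 S (fun z => eigval m n * eigmode Dirichlet m n z * v z).
Proof.
move=> [[Lv Lvx Lvy _] app].
have [c0 c1 c2 _] := eigmode_continuous Dirichlet m n.
have [_ _ _ _] := eigmode_continuous Dirichlet m n.
have ev0 : 0 <= eigval m n by rewrite addr_ge0 ?sqr_ge0.
have bn0 : 0 <= bnd m n by rewrite /bnd !addr_ge0 ?freq_ge0.
pose C := bnd m n + eigval m n * bnd m n.
have C0 : 0 <= C by rewrite addr_ge0 ?mulr_ge0.
have leC : bnd m n <= C by rewrite lerDl mulr_ge0.
have B1 z : `|eigmode_dx Dirichlet m n z| <= C by have [_ h _] := eigmode_bounds Dirichlet m n z; exact: le_trans leC.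
have B2 z : `|eigmode_dy Dirichlet m n z| <= C by have [_ _ h] := eigmode_bounds Dirichlet m n z; exact: le_trans leC.
have B0 z : `|eigval m n * eigmode Dirichlet m n z| <= C.
  rewrite normrM (ger0_norm ev0); have [h _ _] := eigmode_bounds Dirichlet m n z.
  by apply: (@le_trans _ _ (eigval m n * bnd m n)); [rewrite ler_wpM2l|rewrite lerDr].
have Lx := L2c c1 B1; have Ly := L2c c2 B2.
have Lm : L2 S (fun z => eigval m n * eigmode Dirichlet m n z) by exact: L2Z.
have iL := int2D mS (L2_mul mS Lx Lvx) (L2_mul mS Ly Lvy); have iR := L2_mul mS Lm Lv.
apply/eqP; rewrite -subr_eq0 -normr_le0.
set D := _ - _.
pose A := I2 S (fun=> 1).
suff H (d : R) : 0 < d -> `|D| <= d * (3 * A + C ^+ 2).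
  have A0 : 0 <= A.
    by rewrite -(I20 mS fS); apply: (I2_le mS); [exact: int2_cst|exact: int2_cst|move=> z _; exact: ler01].
  have K0 : 0 < 3 * A + C ^+ 2 + 1 by rewrite ltr_wpDl// addr_ge0 ?mulr_ge0 ?sqr_ge0.
  rewrite leNgt; apply/negP => D0.
  have := H (`|D| / (2 * (3 * A + C ^+ 2 + 1))); rewrite divr_gt0 ?mulr_gt0// => /(_ isT).
  rewrite mulrAC ler_pdivlMr ?mulr_gt0//; move: D0 K0; set t := `|D|; set K := 3 * A + _; nra.
move=> d0; have [psi Cp small] := app (d ^+ 2) (exprn_gt0 2 d0).
have [cp cpx cpy [K' [cK' KS' hK']]] := C1c_facts Cp.
have Lt h : continuous h -> (forall z, ~ K' z -> h z = 0) -> L2 S h.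
  by move=> ch hz; have [c _ hc] := compact_support_bounded ch cK' hz; exact: L2c hc.
have Lp : L2 S psi by apply: Lt => // z /hK'[].
have Lpx : L2 S (dx psi) by apply: Lt => // z /hK'[].
have Lpy : L2 S (dy psi) by apply: Lt => // z /hK'[].
have L2B u w : L2 S u -> L2 S w -> L2 S (fun z => u z - w z).
  by move=> Lu Lw; have := L2D mS Lu (L2Z mS (-1) Lw);
   rewrite (_ : (fun z => u z + -1 * w z) = (fun z => u z - w z))//; apply/funext => z; ring.
have [E0 E1 E2] := And3 (L2B _ _ Lv Lp) (L2B _ _ Lvx Lpx) (L2B _ _ Lvy Lpy).
have ieq := test_form Dirichlet m n Cp.
have iL' := int2D mS (L2_mul mS Lx Lpx) (L2_mul mS Ly Lpy); have iR' := L2_mul mS Lm Lp.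
have iDD := int2B mS (int2D mS (L2_mul mS Lx E1) (L2_mul mS Ly E2)) (L2_mul mS Lm E0).
have DE : D = I2 S (fun z => eigmode_dx Dirichlet m n z * (vx z - dx psi z) + eigmode_dy Dirichlet m n z * (vy z - dy psi z)
    - eigval m n * eigmode Dirichlet m n z * (v z - psi z)).
  rewrite /D -[LHS]subr0 -(subrr (I2 S (fun z => eigval m n * eigmode Dirichlet m n z * psi z))) -{1}ieq.
  rewrite -(I2B mS iL iR) -(I2B mS iL' iR') -(I2B mS (int2B mS iL iR) (int2B mS iL' iR')).
  by apply: I2_ext => z _; ring.
rewrite DE; apply: le_trans (I2_norm mS iDD) _.
have isq := int2D mS (int2D mS (L2_sqr E0) (L2_sqr E1)) (L2_sqr E2).
have ib := int2D mS (int2_cst mS fS (3 * d)) (int2Z mS (C ^+ 2 / d) isq).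
apply: (@le_trans _ _ (I2 S (fun z => 3 * d + C ^+ 2 / d * ((v z - psi z) ^+ 2 + (vx z - dx psi z) ^+ 2 + (vy z - dy psi z) ^+ 2)))).
  apply: (I2_le mS (int2_norm iDD) ib) => z _.
  have amgm (p x : R) : `|p| <= C -> `|p * x| <= d + C ^+ 2 / d * x ^+ 2.
    move=> pC; apply: (@le_trans _ _ (C * `|x|)); first by rewrite normrM ler_wpM2r.
    rewrite -(real_normK (num_real x)) -(ler_pM2l d0) mulrDr.
    rewrite (_ : d * (C ^+ 2 / d * `|x| ^+ 2) = (C * `|x|) ^+ 2); last by field; rewrite gt_eqF.
    by have := sqr_ge0 (d - C * `|x|); have := mulr_ge0 C0 (normr_ge0 x); set t := C * `|x|; nra.
  have h1 := amgm _ (vx z - dx psi z) (B1 z); have h2 := amgm _ (vy z - dy psi z) (B2 z).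
  have h3 := amgm _ (v z - psi z) (B0 z).
  apply: le_trans (ler_normB _ _) _; apply: le_trans (lerD (ler_normD _ _) (lexx _)) _.
  apply: le_trans (lerD (lerD h1 h2) h3) _.
  by rewrite le_eqVlt; apply/orP; left; apply/eqP; ring.
rewrite (I2D mS (int2_cst mS fS (3 * d)) (int2Z mS _ isq)) (I2Z mS _ isq).
have -> : I2 S (fun=> 3 * d) = 3 * d * A.
  by rewrite /A -(I2Z mS _ (int2_cst mS fS 1)); apply: I2_ext => z _; rewrite mulr1.
rewrite mulrDr; apply: lerD; first by rewrite le_eqVlt; apply/orP; left; apply/eqP; ring.
have Cd : 0 <= C ^+ 2 / d by rewrite divr_ge0 ?sqr_ge0 ?ltW.
apply: le_trans (ler_wpM2l Cd (ltW small)) _.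
by rewrite le_eqVlt; apply/orP; left; apply/eqP; field; rewrite gt_eqF.
Qed.

Lemma eigmode_form bc m n v vx vy : form_domain bc S v vx vy ->
  I2 S (fun z => eigmode_dx bc m n z * vx z + eigmode_dy bc m n z * vy z) =
  I2 S (fun z => eigval m n * eigmode bc m n z * v z).
Proof. by case: bc => /= h; [exact: neumann_form h|exact: dirichlet_form h]. Qed.

Lemma eigmode_eigenfunction bc m n : eigenfunctions bc S (eigval m n) (eigmode bc m n).
Proof.
split; first exact: L2Z.
exists (eigmode_dx bc m n), (eigmode_dy bc m n); split; first exact: eigmode_form_domain.
by move=> v vx vy; exact: eigmode_form.
Qed.

(** Symmetry of the quadratic form, a mode being one of the two arguments. *)
Lemma eigen_orthogonal bc m n (lambda : R) u : eigenfunctions bc S lambda u ->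
  lambda != eigval m n -> I2 S (fun z => u z * eigmode bc m n z) = 0.
Proof.
move=> [_ [ux [uy [du Hu]]]] lne.
have Lu : L2 S u by case: bc du {Hu} => /= [[]|[[]]].
have iu : int2 S (fun z => u z * eigmode bc m n z) by exact: L2_mul.
have := Hu _ _ _ (eigmode_form_domain bc m n); have := eigmode_form m n du.
rewrite -/(I2 S _) -/(I2 S _) => E1 E2.
have : (lambda - eigval m n) * I2 S (fun z => u z * eigmode bc m n z) = 0.
  rewrite mulrBl -!(I2Z mS _ iu).
  rewrite (_ : I2 S (fun z => lambda * _) = I2 S (fun z => lambda * u z * eigmode bc m n z)); last first.
    by apply: I2_ext => z _; ring.
  rewrite -E2.
  rewrite (_ : I2 S (fun z => eigval m n * _) = I2 S (fun z => eigval m n * eigmode bc m n z * u z)); last first.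
    by apply: I2_ext => z _; ring.
  by rewrite -E1; apply/eqP; rewrite subr_eq0; apply/eqP; apply: I2_ext => z _; ring.
by move=> /eqP; rewrite mulf_eq0 subr_eq0 (negbTE lne) => /eqP.
Qed.

(** One mode for each orbit of the swap [(m, n) -> (n, m)], discarding the odd modes
    that vanish identically. *)
Definition admissible bc m n : bool := match bc with
  Neumann => (n <= m)%N | Dirichlet => (0 < n < m)%N end.

Let cc bc i j := ri 0 a (fun x => trig bc i x * trig bc j x).

Lemma trig_orthogonal bc i j : i != j -> cc bc i j = 0.
Proof.
move=> ij; rewrite /cc.
pose p := freq i - freq j; pose q := freq i + freq j.
have pa : 0 < pi / a by rewrite divr_gt0// pi_gt0.
have p0 : p != 0.
  by rewrite subr_eq0; apply: contra ij => /eqP/(mulIf (lt0r_neq0 pa))/eqP; rewrite eqr_nat.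
have q0 : q != 0.
  rewrite /q /freq -mulrDl -natrD mulf_eq0 negb_or (gt_eqF pa) andbT pnatr_eq0 addn_eq0.
  by apply: contra ij => /andP[/eqP -> /eqP ->].
have E x : trig bc i x * trig bc j x = (cos (p * x) + swap_sign bc * cos (q * x)) / 2.
  rewrite /p /q mulrBl (mulrDl (freq i)) cosB cosD.
  by case: bc; rewrite /trig /swap_sign; field.
have d (x : R) : is_derive x 1 (fun x => (sin (p * x) / p + swap_sign bc * (sin (q * x) / q)) / 2)
   (trig bc i x * trig bc j x).
  rewrite E; clear E; clearbody p q; der; move: (cos (p * x)) (cos (q * x)) => c1 c2.
  by field; rewrite p0 q0.
have ct : continuous (fun x => trig bc i x * trig bc j x) by apply: contM; exact: trig_continuous.
rewrite (ri_FTC (ltW a0) ct d) !mulr0 sin0 /p /q (mulrBl _ (freq i)) (mulrDl (freq i)) !freq_a sinB sinD !sin_natpi.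
by rewrite !(mul0r, mulr0, subr0, addr0).
Qed.

Lemma trig_norm_gt0 bc i : (bc = Dirichlet -> (0 < i)%N) -> 0 < cc bc i i.
Proof.
move=> hi; rewrite /cc.
have [i0|ip] := posnP i.
  case: bc hi => [_|/(_ erefl)]; last by rewrite i0.
  rewrite (@ri_ext _ 0 a _ (fun=> 1)).
    by rewrite ri_cst ?ltW// mul1r subr0.
  by move=> x _; rewrite i0 /trig /freq !mul0r cos0 mulr1.
have pa : 0 < pi / a by rewrite divr_gt0// pi_gt0.
pose q := 2 * freq i.
have q0 : q != 0 by rewrite mulf_neq0 ?pnatr_eq0// mulf_neq0 ?gt_eqF// ltr0n.
have E x : trig bc i x * trig bc i x = (1 + swap_sign bc * cos (q * x)) / 2.
  rewrite /q (_ : 2 * freq i * x = freq i * x + freq i * x); last by ring.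
  rewrite cosD; have e := cos2Dsin2 (freq i * x).
  by case: bc {hi}; rewrite /trig /swap_sign -/(freq i) /= => *; nra.
have d (x : R) : is_derive x 1 (fun x => (x + swap_sign bc * (sin (q * x) / q)) / 2)
   (trig bc i x * trig bc i x).
  by rewrite E; clear E; clearbody q; der; move: (cos (q * x)) => c1; field.
have ct : continuous (fun x => trig bc i x * trig bc i x) by apply: contM; exact: trig_continuous.
rewrite (ri_FTC (ltW a0) ct d) !mulr0 sin0 /q -mulrA freq_a.
rewrite (_ : 2 * (i%:R * pi) = (2 * i)%:R * pi); last by rewrite natrM; ring.
by rewrite sin_natpi !(mul0r, mulr0, subr0, addr0) divr_gt0.
Qed.

(** Symmetrizing reduces the double integral over the triangle to integrals over the
    two sides of the square, by [triangle_product]. *)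
Lemma eigmode_gram bc m n m' n' : I2 S (fun z => eigmode bc m n z * eigmode bc m' n' z) =
  cc bc m m' * cc bc n n' + swap_sign bc * (cc bc m n' * cc bc n m').
Proof.
have cf i j : continuous (fun x => trig bc i x * trig bc j x) by apply: contM; exact: trig_continuous.
have T1 := triangle_product a0 (cf m m') (cf n n').
have T2' := triangle_product a0 (cf m n') (cf n m').
have ip i j k l : int2 S (fun z => trig bc i z.1 * trig bc j z.1 * (trig bc k z.2 * trig bc l z.2)
    + trig bc k z.1 * trig bc l z.1 * (trig bc i z.2 * trig bc j z.2)).
  apply: (int2_bounded mS fS (C := 1 * 1 * (1 * 1) + 1 * 1 * (1 * 1))).
    apply: continuous_measurable2; apply: contD; exact: (cont_tensor (cf _ _) (cf _ _)).
  move=> z _; apply: le_trans (ler_normD _ _) _; apply: lerD; do 3 ? apply: mul_le; exact: trig_le1.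
rewrite /cc -T1 -T2' -(I2Z mS _ (ip m n' n m')) -(I2D mS (ip m m' n n') (int2Z mS _ (ip m n' n m'))).
apply: I2_ext => z _; have s2 : swap_sign bc * swap_sign bc = 1 by clear; case: bc; rewrite /swap_sign; ring.
transitivity (trig bc m z.1 * trig bc n z.2 * (trig bc m' z.1 * trig bc n' z.2)
  + swap_sign bc * (trig bc m z.1 * trig bc n z.2 * (trig bc n' z.1 * trig bc m' z.2)
     + trig bc n z.1 * trig bc m z.2 * (trig bc m' z.1 * trig bc n' z.2))
  + swap_sign bc * swap_sign bc * (trig bc n z.1 * trig bc m z.2 * (trig bc n' z.1 * trig bc m' z.2))).
  by rewrite /eigmode; ring.
by rewrite s2; ring.
Qed.

Lemma eigmode_orthogonal bc m n m' n' : admissible bc m n -> admissible bc m' n' ->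
  (m, n) != (m', n') -> I2 S (fun z => eigmode bc m n z * eigmode bc m' n' z) = 0.
Proof.
move=> h h' ne; rewrite eigmode_gram.
have -> : cc bc m m' * cc bc n n' = 0.
  have [mm|mm] := eqVneq m m'; last by rewrite trig_orthogonal// mul0r.
  have [nn|nn] := eqVneq n n'; last by rewrite [X in _ * X]trig_orthogonal// mulr0.
  by move: ne; rewrite mm nn eqxx.
have [mn|mn] := eqVneq m n'; last by rewrite trig_orthogonal// mul0r mulr0 addr0.
have [nm|nm] := eqVneq n m'; last by rewrite [X in _ * (_ * X)]trig_orthogonal// !mulr0 addr0.
exfalso; move: ne; rewrite xpair_eqE -mn -nm (eq_sym n) andbb.
by case: bc h h' => /=; rewrite -mn -nm => h h'; [rewrite eqn_leq h' h|case/andP: h h' => + + /andP[]; lia].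
Qed.

Lemma eigmode_norm_gt0 bc m n : admissible bc m n -> 0 < I2 S (fun z => eigmode bc m n z * eigmode bc m n z).
Proof.
move=> h; rewrite eigmode_gram.
have pm : 0 < cc bc m m by apply: trig_norm_gt0 => bE; move: h; rewrite bE /=; lia.
have pn : 0 < cc bc n n by apply: trig_norm_gt0 => bE; move: h; rewrite bE /=; lia.
have [mn|mn] := eqVneq m n; last first.
  by rewrite [cc bc m n]trig_orthogonal// mul0r mulr0 addr0 mulr_gt0.
case: bc h pm pn => /= [_ pm pn|]; last by rewrite mn ltnn andbF.
by rewrite mn mul1r addr_gt0// mulr_gt0.
Qed.

End modes.

(** * Completeness of the Neumann modes *)
Section completeness.
Context {R : realType}.
Local Notation T2 := (measurableTypeR R * measurableTypeR R)%type.
Local Notation mu2 := (@lebesgue_measure R \x @lebesgue_measure R)%E.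
Variable a : R.
Hypothesis a0 : 0 < a.
Let S := triangle a.
Let mS : measurable (S : set T2) := triangle_measurable a.
Let fS : (mu2 (S : set T2) < +oo)%E := triangle_finite a0.

Let meas1 (q : R * R -> R) : measurable_fun [set: T2] q -> measurable_fun (S : set T2) q.
Proof. by move=> mq; apply: measurable_funS mq. Qed.

Lemma int2_mul_bounded (h q : R * R -> R) (C : R) : int2 S h -> measurable_fun (S : set T2) q ->
  (forall z, S z -> `|q z| <= C) -> int2 S (fun z => h z * q z).
Proof.
move=> ih mq qC; apply: (int2_le mS _ _ (int2Z mS C (int2_norm ih))).
  by apply: measurable_funM => //; exact: int2_meas ih.
by move=> z Sz; rewrite normrM mulrC ler_wpM2r// qC.
Qed.

Section pi_lambda.
Variables (d : measure_display) (X : measurableType d) (h h' : R * R -> R) (p p' : R * R -> X).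
Hypotheses (ih : int2 S h) (ih' : int2 S h').
Hypotheses (mp : measurable_fun (S : set T2) p) (mp' : measurable_fun (S : set T2) p').

(** The signed set function of which [h] and [h'] are the densities, transported by
    [p] and [p']. Its zero sets form a Dynkin class. *)
Definition pairing (A : set X) := I2 S (fun z => h z * \1_A (p z) + h' z * \1_A (p' z)).

Let mi (q : R * R -> X) A : measurable_fun (S : set T2) q -> measurable A ->
  measurable_fun (S : set T2) (fun z => \1_A (q z) : R).
Proof. by move=> mq mA; apply: (measurableT_comp (measurable_indic mA) mq). Qed.

Let i1 (A : set X) x : `|\1_A x : R| <= 1.
Proof. by rewrite indicE; case: (x \in A); rewrite /= ?normr1 ?normr0. Qed.

Let ii A : measurable A -> int2 S (fun z => h z * \1_A (p z) + h' z * \1_A (p' z)).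
Proof.
move=> mA; apply: (int2D mS); apply: int2_mul_bounded => //; try exact: mi; move=> z _; exact: i1.
Qed.

Lemma pairing_lambda_system : pairing setT = 0 ->
  lambda_system setT [set A | measurable A /\ pairing A = 0].
Proof.
move=> T0; split => //.
- move=> A B BA [mA A0] [mB B0]; split; first exact: measurableD.
  rewrite -(subrr (0 : R)) -{1}A0 -B0 -(I2B mS (ii mA) (ii mB)); apply: I2_ext => z _.
  have E x : \1_(A `\` B) x = \1_A x - \1_B x :> R.
    rewrite !indicE in_setD; have [xB|xB] := boolP (x \in B); last by rewrite andbT subr0.
    have xA : x \in A by move: xB; rewrite !inE => /BA.
    by rewrite xA /= subrr.
  by rewrite !E; ring.
- move=> F ndF HF; have mF n : measurable (F n) by case: (HF n).
  have mU : measurable (\bigcup_n F n) by exact: bigcupT_measurable.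
  split => //.
  have cv x : \1_(F n) x @[n --> \oo] --> (\1_(\bigcup_n F n) x : R).
    have [[N _ FN]|nU] := pselect ((\bigcup_n F n) x).
      apply: cvg_near_cst; near=> n.
      rewrite !indicE !mem_set//; first by exists N.
      by have Nn : (N <= n)%N; [near: n; exact: nbhs_infty_ge|have /subsetPset := ndF N n Nn; apply].
    rewrite (_ : (fun n => _) = (fun=> \1_(\bigcup_n F n) x)); first exact: cvg_cst.
    apply/funext => n; rewrite !indicE !memNset// => Fx; apply: nU; by exists n.
  have H : pairing (F n) @[n --> \oo] --> pairing (\bigcup_n F n).
    have ig := int2D mS (int2_norm ih) (int2_norm ih').
    apply: (@I2_dominated _ S mS (fun n z => h z * \1_(F n) (p z) + h' z * \1_(F n) (p' z))
      (fun z => h z * \1_(\bigcup_n F n) (p z) + h' z * \1_(\bigcup_n F n) (p' z)) _ _ _ _ ig).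
    + by move=> n; exact: int2_meas (ii (mF n)).
    + exact: int2_meas (ii mU).
    + by move=> z _; exact: (seq_cvgD (seq_cvgZ (cv (p z))) (seq_cvgZ (cv (p' z)))).
    + move=> n z _; apply: le_trans (ler_normD _ _) _; apply: lerD; rewrite normrM ler_piMr//.
  rewrite -(cvg_lim _ H)//; apply: lim_near_cst => //; near=> n; by case: (HF n).
Unshelve. all: by end_near. Qed.

Lemma pairing_eq0 (G : set (set X)) : setI_closed G -> @measurable _ X = <<s G >> ->
  pairing setT = 0 -> (forall A, G A -> pairing A = 0) ->
  forall A, measurable A -> pairing A = 0.
Proof.
move=> GI mE T0 G0 A mA.
have sub : <<s G >> `<=` [set A | measurable A /\ pairing A = 0].
  apply: (lambda_system_subset GI (pairing_lambda_system T0)) => //.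
  move=> B GB; split; last exact: G0.
  by rewrite mE; exact: sub_sigma_algebra.
by have [] : [set A | measurable A /\ pairing A = 0] A by apply: sub; rewrite -mE.
Qed.

End pi_lambda.

(** A difference of two staircases of period [2 a] is the Fourier cosine series of the
    indicator of [[0, c]] on [[0, a]]. Its partial sums are combinations of the
    functions [cos (k pi x / a)], are bounded, and converge pointwise. *)
Definition square_wave K (c x : R) := stair K ((x + c) / (2 * a)) - stair K ((x - c) / (2 * a)).

Lemma square_wave_cosines K c x : square_wave K c x =
  c / a * trig a Neumann 0 x +
  \sum_(k < K) 2 * sin (freq a k.+1 * c) / (pi * k.+1%:R) * trig a Neumann k.+1 x.
Proof.
have an : a != 0 by rewrite gt_eqF.
rewrite /square_wave /stair /trig {1}/freq mul0r mul0r cos0 mulr1 opprD addrACA -sumrB; congr (_ + _).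
  by field.
apply: eq_bigr => k _.
have E y : 2 * pi * k.+1%:R * (y / (2 * a)) = freq a k.+1 * y.
  by rewrite /freq; move: (pi : R) => q; field.
rewrite !E mulrDr mulrBr sinD sinB -mulrBl [RHS]mulrAC; congr (_ / _); ring.
Qed.

Lemma square_wave_bounded K c x : 0 < x < a -> 0 < c < a -> `|square_wave K c x| <= 20.
Proof.
move=> /andP[x0 xa] /andP[c0 ca].
have a2 : 0 < 2 * a by lra.
have h1 : `|stair K ((x + c) / (2 * a)) - 2^-1| <= 9.
  by apply: stair_bounded01; rewrite divr_ge0 ?ler_pdivrMr//=; lra.
have h2 : `|stair K ((x - c) / (2 * a))| <= 10.
  have B y : 0 <= y <= 1 -> `|stair K y| <= 10.
    by move=> /stair_bounded01 => /(_ K); rewrite !ler_norml; lra.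
  have [xc|xc] := leP c x; first by apply: B; rewrite divr_ge0 ?ler_pdivrMr//=; lra.
  rewrite -normrN -stairN; apply: B; rewrite -mulNr divr_ge0 ?ler_pdivrMr//=; lra.
by move: h1 h2; rewrite /square_wave !ler_norml; lra.
Qed.

(** The value [1/2] at the jump is that of the Fourier series; a second limit in
    [c], by [half_step_cvg], restores an indicator. *)
Definition half_step (c x : R) : R := ((x < c)%R%:R + (x <= c)%R%:R) / 2.

Lemma square_wave_cvg c x : 0 < x < a -> 0 < c < a ->
  (fun K : nat => square_wave K c x) @ \oo --> half_step c x.
Proof.
move=> /andP[x0 xa] /andP[c0 ca].
have a2 : 0 < 2 * a by lra.
have h1 : stair K ((x + c) / (2 * a)) @[K --> \oo] --> (2^-1 : R).
  by apply: stair_cvg01; rewrite divr_gt0 ?ltr_pdivrMr//=; lra.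
have hp y : 0 < y < a -> stair K (y / (2 * a)) @[K --> \oo] --> (2^-1 : R).
  by move=> ?; apply: stair_cvg01; rewrite divr_gt0 ?ltr_pdivrMr//=; lra.
rewrite /half_step; case: (ltgtP x c) => [xc|xc|xc] /=.
- rewrite (_ : (1 + 1) / 2 = 2^-1 - - 2^-1 :> R); last lra.
  apply: cvgB => //.
  rewrite (_ : (fun K => _) = (fun K => - stair K ((c - x) / (2 * a)))).
    by apply: cvgN; apply: hp; lra.
  by apply/funext => K; rewrite -stairN -mulNr opprB.
- rewrite (_ : (0 + 0) / 2 = 2^-1 - 2^-1 :> R); last lra.
  by apply: cvgB => //; apply: hp; lra.
- rewrite (_ : (0 + 1) / 2 = 2^-1 - 0 :> R); last lra.
  apply: cvgB => //.
  rewrite (_ : (fun K => _) = fun=> 0); first exact: cvg_cst.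
  by apply/funext => K; rewrite xc subrr mul0r stair0.
Qed.

Lemma half_step_cvg (c : R) x : 0 <= c < a ->
  half_step (c + (a - c) / 2 / n.+1%:R) x @[n --> \oo] --> ((x <= c)%R%:R : R).
Proof.
move=> /andP[c0 ca]; have d0 : 0 < (a - c) / 2 by lra.
case: (leP x c) => [xc|xc] /=.
  rewrite (_ : (fun n => _) = fun=> 1); first exact: cvg_cst.
  apply/funext => n; rewrite /half_step.
  have p : 0 < (a - c) / 2 / n.+1%:R by rewrite divr_gt0.
  have h : x < c + (a - c) / 2 / n.+1%:R by rewrite (le_lt_trans xc)// ltrDl.
  by rewrite h (ltW h) /=; lra.
have dp : 0 < (x - c) / ((a - c) / 2) by rewrite divr_gt0// subr_gt0.
apply: cvg_near_cst; near=> n.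
suff h : c + (a - c) / 2 / n.+1%:R < x.
  by rewrite /half_step (ltNge x) (leNgt x) (ltW h) h /= addr0 mul0r.
have : n.+1%:R^-1 < (x - c) / ((a - c) / 2).
  near: n; exact: near_infty_natSinv_lt (PosNum dp).
by rewrite ltr_pdivlMr// mulrC => h; rewrite addrC -ltrBrDr.
Unshelve. all: by end_near. Qed.

Section one_variable.
Variables (h h' : R * R -> R).
Hypotheses (ih : int2 S h) (ih' : int2 S h').

Let bm (F : R -> R) := measurable_fun [set: measurableTypeR R] F /\
  exists C, forall x, 0 < x < a -> `|F x| <= C.
Let Phi (F : R -> R) := I2 S (fun z => h z * F z.1 + h' z * F z.2).
Let S1 z : S z -> 0 < z.1 < a. Proof. case=> *; lra. Qed.
Let S2 z : S z -> 0 < z.2 < a. Proof. case=> *; lra. Qed.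

Let mfst : measurable_fun (S : set T2) (fst : T2 -> measurableTypeR R).
Proof. by apply: meas1; exact: measurable_fst. Qed.
Let msnd : measurable_fun (S : set T2) (snd : T2 -> measurableTypeR R).
Proof. by apply: meas1; exact: measurable_snd. Qed.

Let iPhi F : bm F -> int2 S (fun z => h z * F z.1 + h' z * F z.2).
Proof.
move=> [mF [C FC]]; apply: (int2D mS); apply: (int2_mul_bounded (C := C)) => //.
- exact: (measurableT_comp mF mfst).
- by move=> z /S1; exact: FC.
- exact: (measurableT_comp mF msnd).
- by move=> z /S2; exact: FC.
Qed.

Let PhiL (c : R) F G : bm F -> bm G -> Phi (fun x => c * F x + G x) = c * Phi F + Phi G.
Proof.
move=> bF bG; rewrite /Phi -(I2Z mS c (iPhi bF)) -(I2D mS (int2Z mS c (iPhi bF)) (iPhi bG)).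
by apply: I2_ext => z _; ring.
Qed.

Let Phi_dom (F_ : nat -> R -> R) F (C : R) : (forall n, bm (F_ n)) -> bm F ->
  (forall n x, 0 < x < a -> `|F_ n x| <= C) ->
  (forall x, 0 < x < a -> F_ n x @[n --> \oo] --> F x) ->
  (forall n, Phi (F_ n) = 0) -> Phi F = 0.
Proof.
move=> bF_ bF FC cv z0.
have H : Phi (F_ n) @[n --> \oo] --> Phi F.
  have ig := int2D mS (int2Z mS C (int2_norm ih)) (int2Z mS C (int2_norm ih')).
  apply: (@I2_dominated _ S mS (fun n z => h z * F_ n z.1 + h' z * F_ n z.2)
    (fun z => h z * F z.1 + h' z * F z.2) _ _ _ _ ig).
  - by move=> n; exact: int2_meas (iPhi (bF_ n)).
  - exact: int2_meas (iPhi bF).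
  - by move=> z Sz; exact: (seq_cvgD (seq_cvgZ (cv _ (S1 Sz))) (seq_cvgZ (cv _ (S2 Sz)))).
  - move=> n z Sz; apply: le_trans (ler_normD _ _) _.
    by apply: lerD; rewrite normrM mulrC ler_wpM2r//; apply: FC; [exact: S1|exact: S2].
rewrite -(cvg_lim _ H)//; apply: lim_near_cst => //; exact: nearW.
Qed.

Hypothesis cos0 : forall k, Phi (trig a Neumann k) = 0.

Let bm_cos k : bm (trig a Neumann k).
Proof.
split; last by exists 1 => x _; exact: trig_le1.
by apply: cont_measurable; exact: trig_continuous.
Qed.

Let bm_lin (c : R) F G : bm F -> bm G -> bm (fun x => c * F x + G x).
Proof.
move=> [mF [C FC]] [mG [D GD]]; split.
  by apply: measurable_funD => //; apply: measurable_funM => //; exact: measurable_cst.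
exists (`|c| * C + D) => x xa; apply: le_trans (ler_normD _ _) _; apply: lerD; last exact: GD.
by rewrite normrM ler_wpM2l// FC.
Qed.

Let bm0 : bm (fun=> 0).
Proof. by split; [exact: measurable_cst|exists 0 => x _; rewrite normr0]. Qed.

Let Phi0 : Phi (fun=> 0) = 0.
Proof. by rewrite /Phi -[RHS](I20 mS fS); apply: I2_ext => z _; rewrite !mulr0 addr0. Qed.

Let Phi_sum n (c : nat -> R) : let F x := \sum_(k < n) c k * trig a Neumann k.+1 x in
  bm F /\ Phi F = 0.
Proof.
elim: n => [|n [IH1 IH2]] /=.
  by rewrite (_ : (fun x => _) = fun=> 0)//; apply/funext => x; rewrite big_ord0.
rewrite (_ : (fun x => _) = (fun x => c n * trig a Neumann n.+1 x + \sum_(k < n) c k * trig a Neumann k.+1 x)).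
  split; first exact: bm_lin.
  by rewrite PhiL// cos0 IH2 mulr0 addr0.
by apply/funext => x; rewrite big_ord_recr /= addrC.
Qed.

Let Phi_wave K c : bm (square_wave K c) /\ Phi (square_wave K c) = 0.
Proof.
have [h1 h2] := Phi_sum K (fun k => 2 * sin (freq a k.+1 * c) / (pi * k.+1%:R)).
rewrite (_ : square_wave K c = fun x => c / a * trig a Neumann 0 x +
  \sum_(k < K) 2 * sin (freq a k.+1 * c) / (pi * k.+1%:R) * trig a Neumann k.+1 x); last first.
  by apply/funext => x; exact: square_wave_cosines.
split; first exact: bm_lin.
by rewrite PhiL// cos0 h2 mulr0 addr0.
Qed.

Let bm_le c : bm (fun x => (x <= c)%R%:R).
Proof.
split; last by exists 1 => x _; case: (x <= c); rewrite /= ?normr1 ?normr0.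
rewrite (_ : (fun x => _) = \1_(`]-oo, c]%classic)); first exact: measurable_indic.
by apply/funext => x; rewrite indicE mem_setE in_itv.
Qed.

Let bm_half c : bm (half_step c).
Proof.
have bl : bm (fun x => (x < c)%R%:R).
  split; last by exists 1 => x _; case: (x < c); rewrite /= ?normr1 ?normr0.
  rewrite (_ : (fun x => _) = \1_(`]-oo, c[%classic)); first exact: measurable_indic.
  by apply/funext => x; rewrite indicE mem_setE in_itv.
rewrite (_ : half_step c = fun x => 2^-1 * (x < c)%R%:R + (2^-1 * (x <= c)%R%:R + 0)).
  by apply: bm_lin => //; exact: bm_lin.
by apply/funext => x; rewrite /half_step; field.
Qed.

Let Phi_half c : 0 < c < a -> Phi (half_step c) = 0.
Proof.
move=> ca; apply: (@Phi_dom (fun K => square_wave K c) _ 20) => //.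
- by move=> n; case: (Phi_wave n c).
- by move=> n x xa; exact: square_wave_bounded.
- by move=> x xa; exact: square_wave_cvg.
- by move=> n; case: (Phi_wave n c).
Qed.

Let Phi_le c : 0 <= c < a -> Phi (fun x => (x <= c)%R%:R) = 0.
Proof.
move=> /andP[c0 ca]; apply: (@Phi_dom (fun n => half_step (c + (a - c) / 2 / n.+1%:R)) _ 1) => //.
- move=> n x _; rewrite /half_step ger0_norm; last by rewrite divr_ge0// addr_ge0.
  by case: (x < _); case: (x <= _) => /=; lra.
- by move=> x _; apply: half_step_cvg; rewrite c0 ca.
- move=> n; apply: Phi_half.
  have p : 0 < (a - c) / 2 / n.+1%:R by rewrite !divr_gt0//; lra.
  have q : (a - c) / 2 / n.+1%:R <= (a - c) / 2 by rewrite ler_pdivrMr// ler_peMr ?ler1n//; lra.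
  by move: p q; move: ((a - c) / 2 / n.+1%:R) => e p q; apply/andP; split; lra.
Qed.

(** Dominated convergence carries the orthogonality from the cosines to the
    indicators of half-lines, and the pi-lambda theorem from these to all Borel
    sets. The two terms are handled together because the modes are symmetric
    in the two variables. *)
Lemma cosines_determine_one_variable (A : set (measurableTypeR R)) : measurable A ->
  I2 S (fun z => h z * \1_A z.1 + h' z * \1_A z.2) = 0.
Proof.
have T0 : Phi (fun=> 1) = 0.
  by rewrite -[RHS](cos0 0); congr Phi; apply/funext => x; rewrite /trig /freq !mul0r trigo.cos0.
apply: (@pairing_eq0 _ (measurableTypeR R) h h' fst snd ih ih' mfst msnd (@RGenOInfty.G R)).
- move=> _ _ [x ->] [y ->]; exists (Num.max x y); apply/seteqP; split => z /=;
    by rewrite !in_itv /= !andbT gt_max => /andP.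
- exact: RGenOInfty.measurableE.
- by rewrite -T0; apply: I2_ext => z _; rewrite !indicE !in_setT.
- move=> _ [c ->].
  have E x : \1_(`]c, +oo[%classic) x = (c < x)%R%:R :> R.
    by rewrite indicE mem_setE in_itv /= andbT.
  have [c0|c0] := ltP c 0.
    rewrite -T0; apply: I2_ext => z Sz; rewrite !E.
    have /andP[z1 _] := S1 Sz; have /andP[z2 _] := S2 Sz.
    by rewrite (lt_trans c0 z1) (lt_trans c0 z2).
  have [ca|ca] := leP a c.
    rewrite -Phi0; apply: I2_ext => z Sz; rewrite !E.
    have /andP[_ z1] := S1 Sz; have /andP[_ z2] := S2 Sz.
    by rewrite !ltNge (ltW (lt_le_trans z1 ca)) (ltW (lt_le_trans z2 ca)).
  have := PhiL (-1) (bm_le c) (bm_cos 0); rewrite cos0 Phi_le ?c0// mulr0 addr0 => H.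
  rewrite -[RHS]H; apply: I2_ext => z _; rewrite !E /trig /freq !mul0r trigo.cos0 !ltNge.
  by case: (_ <= _); case: (_ <= _) => /=; ring.
Qed.

End one_variable.

(** The previous lemma, used once in each variable, shows that the symmetrization of
    [w] across the diagonal integrates to zero over every rectangle, hence over every
    Borel set. A set inside the triangle is disjoint from its mirror image, so that [w] itself
    integrates to zero over it. *)
Theorem neumann_complete (w : R * R -> R) : int2 S w ->
  (forall j k, I2 S (fun z => w z * eigmode a Neumann j k z) = 0) ->
  {ae mu2, forall z, S z -> w z = 0}.
Proof.
move=> iw H.
have mc k : continuous (trig a Neumann k) by exact: trig_continuous.
have bc k (q : R * R -> R) : continuous q -> int2 S (fun z => w z * trig a Neumann k (q z)).
  move=> cq; apply: (int2_mul_bounded (C := 1)) => // [|z _]; last exact: trig_le1.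
  by apply: continuous_measurable2; exact: cont_comp.
have fstc : continuous (fun z : R * R => z.1) := @cont_fst R.
have sndc : continuous (fun z : R * R => z.2) := @cont_snd R.
have s1 k A : measurable (A : set (measurableTypeR R)) ->
    I2 S (fun z => w z * trig a Neumann k z.2 * \1_A z.1 + w z * trig a Neumann k z.1 * \1_A z.2) = 0.
  apply: cosines_determine_one_variable; [exact: (bc k _ sndc)|exact: (bc k _ fstc)|].
  move=> j; rewrite -(H j k); apply: I2_ext => z _; rewrite /eigmode /swap_sign; ring.
have ib A (q : T2 -> measurableTypeR R) : measurable A -> measurable_fun setT q ->
    int2 S (fun z => w z * \1_A (q z)).
  move=> mA mq; apply: (int2_mul_bounded (C := 1)) => // [|z _].
    by apply: meas1; exact: (measurableT_comp (measurable_indic mA) mq).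
  by rewrite indicE; case: (_ \in _); rewrite /= ?normr1 ?normr0.
have mf := @measurable_fst _ _ (measurableTypeR R) (measurableTypeR R).
have ms := @measurable_snd _ _ (measurableTypeR R) (measurableTypeR R).
have s2 A B : measurable (A : set (measurableTypeR R)) -> measurable (B : set (measurableTypeR R)) ->
    I2 S (fun z => w z * \1_A z.2 * \1_B z.1 + w z * \1_A z.1 * \1_B z.2) = 0.
  move=> mA; apply: cosines_determine_one_variable; [exact: (ib A _ mA ms)|exact: (ib A _ mA mf)|].
  move=> k; rewrite -(s1 k A mA); apply: I2_ext => z _; ring.
have sw : measurable_fun (S : set T2) (fun z : T2 => (z.2, z.1) : T2).
  by apply: (measurable_funS measurableT) => //; apply: measurable_fun_pair.
have idm : measurable_fun (S : set T2) (fun z : T2 => z) by exact: measurable_id.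
pose C := [set (A : set (measurableTypeR R)) `*` (B : set (measurableTypeR R)) | A in measurable & B in measurable].
have rect A B : measurable A -> measurable B ->
    pairing w w (fun z : T2 => z) (fun z : T2 => (z.2, z.1) : T2) (A `*` B) = 0.
  move=> mA mB; rewrite -(s2 A B mA mB); apply: I2_ext => z _.
  have E (x y : R) : \1_(A `*` B) (x, y) = \1_A x * \1_B y :> R.
    by rewrite !indicE in_setX /=; case: (x \in A); case: (y \in B); rewrite /= ?mulr1 ?mulr0.
  by case: z => x y; rewrite !E /=; ring.
have all_sets E : measurable (E : set T2) ->
    pairing w w (fun z : T2 => z) (fun z : T2 => (z.2, z.1) : T2) E = 0.
  apply: (pairing_eq0 iw iw idm sw (G := C)).
  - move=> _ _ [X1 mX1 [X2 mX2 <-]] [Y1 mY1 [Y2 mY2 <-]].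
    exists (X1 `&` Y1); first exact: measurableI.
    by exists (X2 `&` Y2); [exact: measurableI|rewrite setXI].
  - exact: measurable_prod_measurableType.
  - by rewrite -setXTT; apply: rect.
  - by move=> _ [A mA [B mB <-]]; exact: rect.
apply: (I2_ae0 mS iw) => E ES mE; rewrite -[RHS](all_sets E mE) /I2 /Rintegral.
rewrite [LHS](_ : _ = fine (\int[mu2]_(z in S) (w z * \1_E z)%:E)%E); last first.
  rewrite integral_mkcond [in RHS]integral_mkcond; congr fine; apply: eq_integral => z _.
  rewrite !patchE indicE; have [zE|zE] := boolP (z \in E).
    by rewrite mulr1 mem_set//; apply: ES; move: zE; rewrite inE.
  by rewrite mulr0; case: ifP.
congr fine; apply: eq_integral => z; rewrite inE => Sz.
rewrite [X in _ + w z * X](_ : _ = 0) ?mulr0 ?addr0//.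
rewrite indicE memNset// => /ES; case: Sz => z1 z2 z3 [] /= *; lra.
Qed.

End completeness.

(** * Dirichlet modes, multiplicities and the counting function *)
Section dirichlet_completeness.
Context {R : realType}.
Local Notation T2 := (measurableTypeR R * measurableTypeR R)%type.
Local Notation mu2 := (@lebesgue_measure R \x @lebesgue_measure R)%E.
Variable a : R.
Hypothesis a0 : 0 < a.
Let S := triangle a.
Let mS : measurable (S : set T2) := triangle_measurable a.
Let fS : (mu2 (S : set T2) < +oo)%E := triangle_finite a0.

Lemma ae_imply (P Q : R * R -> Prop) : (forall z, P z -> Q z) ->
  {ae mu2, forall z, P z} -> {ae mu2, forall z, Q z}.
Proof. by move=> PQ; apply: filterS PQ; exact: (ae_filter_ringOfSetsType mu2). Qed.

Definition sin_freq (i : int) (x : R) : R := sin (i%:~R * (pi / a) * x).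
(** The Dirichlet modes with integer frequencies of any sign, a range closed under
    the product formulas for sines and cosines. *)
Definition antisym (i j : int) (z : R * R) : R :=
  sin_freq i z.1 * sin_freq j z.2 - sin_freq j z.1 * sin_freq i z.2.

Lemma sin_freqN i x : sin_freq (- i) x = - sin_freq i x.
Proof. by rewrite /sin_freq mulrNz !mulNr sinN. Qed.

Lemma antisym_eigmode (m n : nat) z : antisym m n z = eigmode a Dirichlet m n z.
Proof. by rewrite /antisym /eigmode /swap_sign /trig /sin_freq /freq; ring. Qed.

Lemma sin_freqM (i : int) (k : nat) x :
  sin_freq i x * trig a Neumann k x = (sin_freq (i + k%:Z) x + sin_freq (i - k%:Z) x) / 2.
Proof.
rewrite /sin_freq /trig /freq rmorphD rmorphB /= !mulrDl !mulNr sinD sinB.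
by rewrite -[k%:~R]/(k%:R : R); field.
Qed.

(** [sin 2x sin y - sin x sin 2y = 2 sin x sin y (cos x - cos y)], up to scaling, and
    [cos] decreases on [[0, pi]]. *)
Lemma dirichlet_weight_lt0 z : S z -> eigmode a Dirichlet 2 1 z < 0.
Proof.
case=> z2 z12 z1; rewrite -antisym_eigmode /antisym /sin_freq.
have pa : 0 < pi / a by rewrite divr_gt0// pi_gt0.
have E x : sin (2%:~R * (pi / a) * x) = 2 * sin (pi / a * x) * cos (pi / a * x).
  rewrite (_ : 2%:~R * (pi / a) * x = pi / a * x + pi / a * x); last by rewrite -[2%:~R]/(2 : R); ring.
  by rewrite sinD; ring.
rewrite !E !mul1r.
have inp x : 0 < x < a -> 0 < pi / a * x < pi.
  move=> /andP[x0 xa]; rewrite mulr_gt0//= -{2}[pi](@divfK _ a) ?gt_eqF//.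
  by rewrite ltr_pM2l.
have h1 := inp z.1 ltac:(lra); have h2 := inp z.2 ltac:(lra).
have s1 := sin_gt0_pi h1; have s2 := sin_gt0_pi h2.
have c : cos (pi / a * z.1) < cos (pi / a * z.2).
  move: (h1) (h2) => /andP[/ltW p1 /ltW p2] /andP[/ltW p3 /ltW p4].
  by rewrite ltr_cos ?in_itv/= ?p1 ?p2 ?p3 ?p4// ltr_pM2l.
have := mulr_gt0 s1 s2; move: c; move: (cos _) (cos _) (sin _) (sin _) => c1 c2 t1 t2; nra.
Qed.

Section orthogonal.
Variable u : R * R -> R.
Hypothesis iu : int2 S u.
Hypothesis u0 : forall m n : nat, (0 < n < m)%N -> I2 S (fun z => u z * eigmode a Dirichlet m n z) = 0.

Let Z (f : R * R -> R) := int2 S (fun z => u z * f z) /\ I2 S (fun z => u z * f z) = 0.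

Let ZD f g : Z f -> Z g -> Z (fun z => f z + g z).
Proof.
move=> [i1 e1] [i2 e2]; have E z : u z * (f z + g z) = u z * f z + u z * g z by ring.
split; first by apply: (int2_ext mS (f := fun z => u z * f z + u z * g z)) => [z _|]; [rewrite E|exact: int2D].
by rewrite (I2_ext (g := fun z => u z * f z + u z * g z)) ?(I2D mS)// e1 e2 addr0.
Qed.

Let ZZ c f : Z f -> Z (fun z => c * f z).
Proof.
move=> [i1 e1]; have E z : u z * (c * f z) = c * (u z * f z) by ring.
split; first by apply: (int2_ext mS (f := fun z => c * (u z * f z))) => [z _|]; [rewrite E|exact: int2Z].
by rewrite (I2_ext (g := fun z => c * (u z * f z))) ?(I2Z mS)// e1 mulr0.
Qed.

Let Z_ext f g : f =1 g -> Z f -> Z g.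
Proof. by move=> /funext ->. Qed.

Let Z0 : Z (fun=> 0).
Proof.
split; first by apply: (int2_ext mS (f := fun=> 0)) => [z _|]; [rewrite mulr0|exact: int2_cst].
by rewrite -[RHS](I20 mS fS); apply: I2_ext => z _; rewrite mulr0.
Qed.

Let Z_nat (m n : nat) : Z (antisym m n).
Proof.
have lt p q : (0 < q < p)%N -> Z (antisym p q).
  move=> pq; apply: (@Z_ext (eigmode a Dirichlet p q)) => [z|]; first by rewrite antisym_eigmode.
  split; last exact: u0.
  apply: (int2_mul_bounded (C := bnd a p q)) => // [|z _]; last by case: (eigmode_bounds a0 Dirichlet p q z).
  by apply: continuous_measurable2; case: (eigmode_continuous a Dirichlet p q).
have sf0 x : sin_freq 0 x = 0 by rewrite /sin_freq !mul0r sin0.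
have [->|n0] := posnP n; first by apply: Z_ext Z0 => z; rewrite /antisym !sf0; ring.
have [->|m0] := posnP m; first by apply: Z_ext Z0 => z; rewrite /antisym !sf0; ring.
have [mn|nm|->] := ltngtP m n.
- by apply: Z_ext (ZZ (-1) (lt n m _)) => [z|]; [rewrite /antisym; ring|rewrite m0].
- by apply: lt; rewrite n0.
- by apply: Z_ext Z0 => z; rewrite /antisym; ring.
Qed.

Let Z_int (i j : int) : Z (antisym i j).
Proof.
have step (k l : int) : Z (antisym k l) -> Z (antisym (- k) l).
  move=> h; apply: Z_ext (ZZ (-1) h) => z; rewrite /antisym !sin_freqN; ring.
have swap (k l : int) : Z (antisym k l) -> Z (antisym l k).
  by move=> h; apply: Z_ext (ZZ (-1) h) => z; rewrite /antisym; ring.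
have H (k : int) (n : nat) : Z (antisym k n).
  by case: k => k; [exact: Z_nat|rewrite NegzE; apply/step/Z_nat].
by case: j => n; [exact: H|rewrite NegzE; apply/swap/step/swap/H].
Qed.

(** The product of the first Dirichlet mode with a Neumann mode is a combination of
    Dirichlet modes. So [u] times the first Dirichlet mode is orthogonal to all Neumann
    modes, hence zero, and that mode vanishes nowhere inside the triangle. *)
Lemma dirichlet_complete : {ae mu2, forall z, S z -> u z = 0}.
Proof.
pose w z := u z * eigmode a Dirichlet 2 1 z.
have iw : int2 S w.
  apply: (int2_mul_bounded (C := bnd a 2 1)) => // [|z _]; last by case: (eigmode_bounds a0 Dirichlet 2 1 z).
  by apply: continuous_measurable2; case: (eigmode_continuous a Dirichlet 2 1).
(* Sum over the four sign choices in the product of the modes [(2, 1)] and [(j, k)]. *)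
have half (j k : nat) : Z (fun z => antisym (2 + j%:Z) (1 + k%:Z) z + antisym (2 + j%:Z) (1 - k%:Z) z
    + antisym (2 - j%:Z) (1 + k%:Z) z + antisym (2 - j%:Z) (1 - k%:Z) z).
  exact: (ZD (ZD (ZD (Z_int _ _) (Z_int _ _)) (Z_int _ _)) (Z_int _ _)).
have : {ae mu2, forall z, S z -> w z = 0}.
  apply: (neumann_complete a0 iw) => j k.
  have [_ <-] := ZZ (4^-1) (ZD (half j k) (half k j)).
  apply: I2_ext => z _; rewrite /w -mulrA; congr (_ * _).
  rewrite -antisym_eigmode.
  pose A (f g : R -> R) := f z.1 * g z.2 - g z.1 * f z.2.
  have P (p q : int) (j' k' : nat) : A (fun x => sin_freq p x * trig a Neumann j' x) (fun x => sin_freq q x * trig a Neumann k' x)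
     = 4^-1 * (antisym (p + j'%:Z) (q + k'%:Z) z + antisym (p + j'%:Z) (q - k'%:Z) z
    + antisym (p - j'%:Z) (q + k'%:Z) z + antisym (p - j'%:Z) (q - k'%:Z) z).
    by rewrite /A !sin_freqM /antisym; field.
  cbv beta; rewrite [RHS]mulrDr -!P /A /antisym /eigmode /swap_sign; ring.
move=> w0; apply: ae_imply w0 => z h Sz; have /eqP := h Sz.
by rewrite /w mulf_eq0 (lt_eqF (dirichlet_weight_lt0 Sz)) orbF => /eqP.
Qed.

End orthogonal.
End dirichlet_completeness.

Section multiplicities.
Context {R : realType}.
Local Notation T2 := (measurableTypeR R * measurableTypeR R)%type.
Local Notation mu2 := (@lebesgue_measure R \x @lebesgue_measure R)%E.
Variable a : R.
Hypothesis a0 : 0 < a.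
Let S := triangle a.
Let mS : measurable (S : set T2) := triangle_measurable a.
Let fS : (mu2 (S : set T2) < +oo)%E := triangle_finite a0.

Lemma modes_complete bc (u : R * R -> R) : int2 S u ->
  (forall m n, admissible bc m n -> I2 S (fun z => u z * eigmode a bc m n z) = 0) ->
  {ae mu2, forall z, S z -> u z = 0}.
Proof.
case: bc => iu H; last exact: dirichlet_complete.
apply: neumann_complete => // j k.
have [jk|kj] := leqP k j; first exact: H.
rewrite -(H k j (ltnW kj)); apply: I2_ext => z _; rewrite /eigmode /swap_sign; ring.
Qed.

Lemma I2_ae_eq0 (f : R * R -> R) : int2 S f -> {ae mu2, forall z, S z -> f z = 0} -> I2 S f = 0.
Proof.
move=> If f0; rewrite -[RHS](I20 mS fS) /I2 /Rintegral; congr fine.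
apply: ae_eq_integral => //.
- by apply/measurable_EFinP; exact: int2_meas If.
- by apply: ae_imply f0 => z h Sz; rewrite h.
Qed.

Lemma eigmode_L2 bc m n : L2 S (eigmode a bc m n).
Proof. by have [h _ _] := bC1_sobolev a0 (eigmode_bC1 a0 bc m n). Qed.

Lemma eigenfunction_L2 bc (l : R) u : eigenfunctions bc S l u -> L2 S u.
Proof. by move=> [_ [ux [uy [du _]]]]; case: bc du => /= [[]|[[]]]. Qed.

Section one_eigenvalue.
Variables (bc : boundary_condition) (M : nat) (l : R).
Hypothesis Ml : forall m n, eigval a m n <= l -> (m < M)%N && (n < M)%N.
Let A : {set 'I_M * 'I_M} := finset (fun p : 'I_M * 'I_M => admissible bc p.1 p.2 && (eigval a p.1 p.2 == l)).
Let f (i : 'I_#|A|) := eigmode a bc (enum_val i).1 (enum_val i).2.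

Let Ai (i : 'I_#|A|) : admissible bc (enum_val i).1 (enum_val i).2 /\ eigval a (enum_val i).1 (enum_val i).2 = l.
Proof. by have := enum_valP i; rewrite inE => /andP[? /eqP]. Qed.

Let f_gram i j : i != j -> I2 S (fun z => f i z * f j z) = 0.
Proof.
move=> ij; apply: eigmode_orthogonal => //; [by case: (Ai i)|by case: (Ai j)|].
apply: contra ij => /eqP[e1 e2]; apply/eqP/enum_val_inj.
by case: (enum_val i) (enum_val j) e1 e2 => [p q] [p' q'] /= /val_inj -> /val_inj ->.
Qed.

Let f_independent : linearly_independent S f.
Proof.
move=> c h j.
have iF (i : 'I_#|A|) : int2 S (fun z => c i * (f i z * f j z)).
  by apply: int2Z => //; apply: L2_mul => //; exact: eigmode_L2.
have : I2 S (fun z => \sum_(i < #|A|) c i * (f i z * f j z)) = 0.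
  apply: I2_ae_eq0; first exact: (int2_sum mS fS).
  apply: ae_imply h => z h Sz.
  transitivity ((\sum_(i < #|A|) c i * f i z) * f j z); last by rewrite h// mul0r.
  by rewrite mulr_suml; apply: eq_bigr => i _; rewrite mulrA.
rewrite (I2_sum mS fS iF) (bigD1 j)//= big1 => [|i ij]; last first.
  by rewrite (I2Z mS) ?f_gram ?mulr0//; apply: L2_mul => //; exact: eigmode_L2.
rewrite addr0 (I2Z mS); last by apply: L2_mul => //; exact: eigmode_L2.
have [ad _] := Ai j; have := eigmode_norm_gt0 a0 ad; rewrite -/(f j) -/S => g0 /eqP.
by rewrite mulf_eq0 (gt_eqF g0) orbF => /eqP.
Qed.

Let card_le n (u : 'I_n -> R * R -> R) : (forall i, eigenfunctions bc S l (u i)) ->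
  linearly_independent S u -> (n <= #|A|)%N.
Proof.
move=> ue ui; rewrite leqNgt; apply/negP => An.
pose G : 'M[R]_(n, #|A|) := \matrix_(i, j) I2 S (fun z => u i z * f j z).
have : kermx G != 0.
  rewrite kermx_eq0 -row_leq_rank -ltnNge; exact: leq_ltn_trans (rank_leq_col _) An.
move=> /rowV0Pn[c /sub_kermxP cG /eqP]; apply; apply/rowP => i; rewrite [RHS]mxE.
move: i; apply: ui.
have uL i : L2 S (u i) by exact: eigenfunction_L2 (ue i).
have iF (g : R * R -> R) : L2 S g -> forall i, int2 S (fun z => c 0 i * (u i z * g z)).
  by move=> Lg i; apply: int2Z => //; exact: L2_mul.
apply: (modes_complete (bc := bc)).
  by apply: L2_int => //; apply: L2_sum => // i; exact: L2Z.
move=> m n' ad.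
transitivity (\sum_(i < n) c 0 i * I2 S (fun z => u i z * eigmode a bc m n' z)).
  have Lm := eigmode_L2 bc m n'.
  transitivity (\sum_(i < n) I2 S (fun z => c 0 i * (u i z * eigmode a bc m n' z))); last first.
    by apply: eq_bigr => i _; rewrite (I2Z mS)//; exact: L2_mul.
  rewrite -(I2_sum mS fS (iF _ Lm)).
  by apply: I2_ext => z _; rewrite mulr_suml; apply: eq_bigr => i _; rewrite mulrA.
have [lE|lE] := eqVneq l (eigval a m n'); last first.
  by rewrite big1// => i _; rewrite (eigen_orthogonal a0 (ue i) lE) mulr0.
have /Ml/andP[mM nM] : eigval a m n' <= l by rewrite lE.
pose p : 'I_M * 'I_M := (Ordinal mM, Ordinal nM).
have pA : p \in A by rewrite inE ad lE eqxx.
have /matrixP/(_ 0 (enum_rank_in pA p)) := cG; rewrite !mxE => cG0; rewrite -[RHS]cG0.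
by apply: eq_bigr => i _; rewrite mxE /f enum_rankK_in.
Qed.

(** The modes with eigenvalue [l] are independent, being orthogonal. Conversely more
    eigenfunctions than that have a nontrivial combination orthogonal to these
    modes; it is orthogonal to the others because the eigenvalues differ, and so it
    vanishes by completeness. *)
Lemma multiplicityE : multiplicity bc S l =
  (\sum_(m < M) \sum_(n < M) (admissible bc m n && (eigval a m n == l))%:R)%:E.
Proof.
rewrite pair_bigA /= (_ : \sum_p _ = #|A|%:R); last first.
  rewrite -sum1_card natr_sum [RHS]big_mkcond; apply: eq_bigr => p _; rewrite inE.
  by case: (_ && _).
apply/eqP; rewrite eq_le; apply/andP; split.
  by apply: ge_ereal_sup => _ [n [u [ue ui]] <-]; rewrite lee_fin ler_nat; exact: card_le ui.
apply: ereal_sup_ubound; exists #|A| => //; exists f; split; last exact: f_independent.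
by move=> i; have [_ <-] := Ai i; exact: eigmode_eigenfunction.
Qed.

End one_eigenvalue.

(** The bound [M] is uniform over the eigenvalues up to [t], so that the sum over the
    eigenvalues is a finite sum of indicators, one for each mode. *)
Lemma eigenvalue_countE bc (M : nat) (t : R) :
  (forall m n, eigval a m n <= t -> (m < M)%N && (n < M)%N) ->
  eigenvalue_count bc S t = \sum_(m < M) \sum_(n < M) (admissible bc m n && (eigval a m n <= t))%R%:R.
Proof.
move=> Mt; rewrite /eigenvalue_count.
rewrite (eq_esum (b := fun l => \sum_(p : 'I_M * 'I_M) (admissible bc p.1 p.2 && (eigval a p.1 p.2 == l))%:R%:E)%E); last first.
  move=> l /= lt; rewrite (@multiplicityE bc M) ?pair_bigA /= ?sumEFin//.
  by move=> m n ml; apply: Mt; exact: le_trans lt.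
rewrite esum_sum; last by move=> i j _ _; rewrite lee_fin.
rewrite pair_bigA /= -[RHS]/(fine (_%:E)) -sumEFin; congr fine; apply: eq_bigr => p _.
rewrite esum_mkcond (eq_esum (b := fun l => if l \in [set eigval a p.1 p.2] then (admissible bc p.1 p.2 && (eigval a p.1 p.2 <= t))%R%:R%:E else 0%E)).
  rewrite -esum_mkcond esum_set1//; by rewrite lee_fin.
move=> l _; have -> : (l \in [set eigval a p.1 p.2]) = (l == eigval a p.1 p.2) by apply/idP/eqP; rewrite inE.
have -> : (l \in [set x | x <= t]) = (l <= t) by apply/idP/idP; rewrite inE.
rewrite eq_sym; have [->|_] := eqVneq (eigval a p.1 p.2) l; last by rewrite andbF; case: ifP.
by rewrite andbT; case: (l <= t); rewrite ?andbT ?andbF.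
Qed.

End multiplicities.

(** * From the triangle to the square lattice *)
Section lattice_sums.
Context {R : realType}.
Implicit Types (r T : R) (m n K M : nat) (bc : boundary_condition).

(** The integral up to [t] of the indicator of [[v, +oo[] is [pos (t - v)]. *)
Definition pos (x : R) : R := Num.max 0 x.

Lemma pos_ge0E x : 0 <= x -> pos x = x.
Proof. by move=> x0; rewrite /pos max_r. Qed.
Lemma pos_le0E x : x <= 0 -> pos x = 0.
Proof. by move=> x0; rewrite /pos max_l. Qed.
Lemma posM c x : 0 <= c -> pos (c * x) = c * pos x.
Proof. by move=> c0; rewrite /pos maxr_pMr// mulr0. Qed.

(** Contribution of the origin, once the two axes and the diagonal have been
    accounted for. *)
Definition corner bc : R := match bc with Neumann => - 8^-1 | Dirichlet => 7 / 8 end.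

Let delta m n : R := (m == n)%:R.

(** An orbit of the symmetry group of the square has eight elements in general; the
    points on the axes and on the diagonals have smaller orbits, which the
    boundary terms correct. *)
Lemma admissible_symmetrized bc m n :
  ((admissible bc m n)%:R + (admissible bc n m)%:R) / 2 = (abs_mult m * abs_mult n) / 8
    + swap_sign bc / 2 * ((delta n 0 + delta m 0) / 2 + delta m n) + corner bc * (delta m 0 * delta n 0) :> R.
Proof.
by rewrite /delta; case: bc; case: m => [|m]; case: n => [|n]; rewrite /admissible /abs_mult /swap_sign /corner ?eqSS ?ltnS /=;
  try (case: (ltngtP m n) => //= _); lra.
Qed.

Lemma triangle_lattice_sum bc K (F : nat -> nat -> R) : (forall m n, F m n = F n m) ->
  \sum_(m < K.+1) \sum_(n < K.+1) (admissible bc m n)%:R * F m n =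
  (\sum_(m < K.+1) \sum_(n < K.+1) abs_mult m * abs_mult n * F m n) / 8
  + swap_sign bc / 2 * (\sum_(m < K.+1) F m 0%N + \sum_(m < K.+1) F m m) + corner bc * F 0%N 0%N.
Proof.
move=> sF.
pose S (c : nat -> nat -> R) := \sum_(m < K.+1) \sum_(n < K.+1) c m n * F m n.
have SL (c : R) f g : S (fun m n => c * f m n + g m n) = c * S f + S g.
  rewrite /S mulr_sumr -big_split; apply: eq_bigr => i _ /=.
  by rewrite mulr_sumr -big_split; apply: eq_bigr => j _ /=; ring.
have ST f : S (fun m n => f n m) = S f.
  rewrite /S exchange_big; apply: eq_bigr => i _; apply: eq_bigr => j _; by rewrite sF.
have SE f g : (forall m n, f m n = g m n) -> S f = S g.
  by move=> fg; rewrite /S; apply: eq_bigr => i _; apply: eq_bigr => j _; rewrite fg.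
have S0 : S (fun=> fun=> 0) = 0 by rewrite /S; apply: big1 => i _; apply: big1 => j _; rewrite mul0r.
have Sn0 : S (fun m n => delta n 0) = \sum_(m < K.+1) F m 0%N.
  rewrite /S; apply: eq_bigr => i _; rewrite (bigD1 ord0)//= big1 ?addr0 => [|j j0]; first by rewrite /delta eqxx mul1r.
  by rewrite /delta (negbTE (_ : (j != 0 :> nat)%N)) ?mul0r// -val_eqE.
have Sm0 : S (fun m n => delta m 0) = \sum_(m < K.+1) F m 0%N by rewrite -Sn0 -[RHS]ST.
have Sd : S delta = \sum_(m < K.+1) F m m.
  rewrite /S; apply: eq_bigr => i _; rewrite (bigD1 i)//= big1 ?addr0 => [|j ji]; first by rewrite /delta eqxx mul1r.
  by rewrite /delta (negbTE (_ : (i != j :> nat)%N)) ?mul0r// eq_sym.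
have S00 : S (fun m n => delta m 0 * delta n 0) = F 0%N 0%N.
  rewrite /S (bigD1 ord0)//= [X in _ + X]big1 ?addr0 => [|i i0]; last first.
    by apply: big1 => j _; rewrite /delta (negbTE (_ : (i != 0 :> nat)%N)) ?mul0r ?mul0r// -val_eqE.
  rewrite (bigD1 ord0)//= big1 ?addr0 => [|j j0]; first by rewrite /delta eqxx !mul1r.
  by rewrite /delta (negbTE (_ : (j != 0 :> nat)%N)) ?mulr0 ?mul0r// -val_eqE.
have -> : \sum_(m < K.+1) \sum_(n < K.+1) (admissible bc m n)%:R * F m n = S (fun m n => (admissible bc m n)%:R) by [].
have -> : S (fun m n => (admissible bc m n)%:R) = S (fun m n => 2^-1 * (admissible bc m n)%:R + (2^-1 * (admissible bc n m)%:R + 0)).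
  by rewrite SL SL S0 (ST (fun m n => (admissible bc m n)%:R)); field.
rewrite (SE _ (fun m n => 8^-1 * (abs_mult m * abs_mult n) + (swap_sign bc / 4 * delta n 0 + (swap_sign bc / 4 * delta m 0
   + (swap_sign bc / 2 * delta m n + (corner bc * (delta m 0 * delta n 0) + 0)))))); last first.
  move=> m n; rewrite (_ : 2^-1 * _ + _ = ((admissible bc m n)%:R + (admissible bc n m)%:R) / 2); last by field.
  by rewrite admissible_symmetrized; field.
by rewrite !SL S0 Sn0 Sm0 Sd S00 /S; field.
Qed.

Lemma sum_truncate (F : nat -> R) K M : (K <= M)%N -> (forall m, (K <= m)%N -> F m = 0) ->
  \sum_(m < M) F m = \sum_(m < K) F m.
Proof.
move=> KM F0; rewrite -!(big_mkord xpredT) (@big_cat_nat _ _ _ K)//= [X in _ + X]big_nat_cond [X in _ + X]big1 ?addr0// => i.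
by rewrite andbT => /andP[/F0].
Qed.

Lemma truncn_lt r m : (Num.truncn r < m)%N -> 0 <= r -> r <= m%:R.
Proof.
move=> rm r0; have /andP[_ h] := truncn_bounds r0; apply: le_trans h _.
by rewrite natr1 ler_nat.
Qed.

Lemma riesz_lattice r : 0 <= r -> let M := (Num.truncn r).+1 in
  riesz r = \sum_(m < M) \sum_(n < M) abs_mult m * abs_mult n * pos (r ^+ 2 - m%:R ^+ 2 - n%:R ^+ 2).
Proof.
move=> r0 /=; rewrite /riesz; apply: eq_bigr => j _.
have jr : j%:R <= r.
  have /andP[h _] := truncn_bounds r0; apply: le_trans h; by rewrite ler_nat -ltnS.
have d0 : 0 <= r ^+ 2 - j%:R ^+ 2 by rewrite subr_ge0 lerXn2r// nnegrE.
set rho := Num.sqrt _; have rho0 : 0 <= rho by exact: sqrtr_ge0.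
have rho2 : rho ^+ 2 = r ^+ 2 - j%:R ^+ 2 by rewrite sqr_sqrtr.
have rr : rho <= r by rewrite -ler_sqr ?nnegrE// rho2 gerBl sqr_ge0.
rewrite /= mulr_sumr -rho2.
rewrite [RHS](@sum_truncate (fun n => abs_mult j * abs_mult n * pos (rho ^+ 2 - n%:R ^+ 2)) (Num.truncn rho).+1).
- apply: eq_bigr => m _; rewrite mulrA pos_ge0E// subr_ge0 lerXn2r// ?nnegrE//.
  have /andP[h _] := truncn_bounds rho0; apply: le_trans h; by rewrite ler_nat -ltnS.
- by rewrite ltnS; exact: le_truncn.
- move=> m /truncn_lt/(_ rho0) h; rewrite pos_le0E ?mulr0// subr_le0 lerXn2r ?nnegrE//.
Qed.

(** Contribution of a line of lattice points: a polynomial in [r] and in its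
    fractional part, in which the coefficients of [r^3] and [r^2] do not depend on
    the latter. *)
Lemma line_sum r M : 1 <= r -> (Num.truncn r < M)%N ->
  `|\sum_(m < M) pos (r ^+ 2 - m%:R ^+ 2) - (2 / 3 * r ^+ 3 + r ^+ 2 / 2)| <= r.
Proof.
move=> r1 rM; have r0 : 0 <= r by lra.
rewrite (@sum_truncate (fun n => pos (r ^+ 2 - n%:R ^+ 2)) (Num.truncn r).+1)//; last first.
  by move=> m /truncn_lt/(_ r0) h; rewrite pos_le0E// subr_le0 lerXn2r ?nnegrE.
have /andP[k1 k2] := truncn_bounds r0; set K := Num.truncn r in k1 k2 *.
have -> : \sum_(m < K.+1) pos (r ^+ 2 - m%:R ^+ 2) =
    (K%:R + 1) * r ^+ 2 - K%:R * (K%:R + 1) * (2 * K%:R + 1) / 6.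
  have F n : \sum_(m < n.+1) (r ^+ 2 - m%:R ^+ 2) = (n%:R + 1) * r ^+ 2 - n%:R * (n%:R + 1) * (2 * n%:R + 1) / 6.
    elim: n => [|n IH]; first by rewrite big_ord_recr big_ord0 /=; ring.
    by rewrite big_ord_recr IH /= -natr1; field.
  rewrite -F; apply: eq_bigr => m _; rewrite pos_ge0E// subr_ge0 lerXn2r// ?nnegrE//.
  by apply: le_trans k1; rewrite ler_nat -ltnS.
move: (K%:R : R) k1 k2 => k k1 k2.
(* The error is [- r (1 - 6 p) / 6 + p (1 - 2 th) / 6] with [p = th (1 - th)]. *)
pose th := r - k; have [t0 t1] : 0 <= th /\ th <= 1 by rewrite /th; lra.
have -> : (k + 1) * r ^+ 2 - k * (k + 1) * (2 * k + 1) / 6 - (2 / 3 * r ^+ 3 + r ^+ 2 / 2)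
  = - r * (1 - 6 * th * (1 - th)) / 6 + th * (1 - th) * (1 - 2 * th) / 6 by rewrite /th; field.
have p0 : 0 <= th * (1 - th) <= 1 by apply/andP; split; nra.
move: p0; set p := th * (1 - th) => /andP[p0 p1].
have -> : 6 * th * (1 - th) = 6 * p by rewrite /p; ring.
have q : `|p * (1 - 2 * th) / 6| <= 1 / 6.
  rewrite normrM normfV [`|6|]ger0_norm// ler_wpM2r// normrM (ger0_norm p0).
  by rewrite -[leRHS]mulr1 ler_pM// ler_norml; lra.
apply: le_trans (ler_normD _ _) _; apply: (@le_trans _ _ (5 / 6 * r + 1 / 6)); last lra.
apply: lerD => //; rewrite -mulrA mulNr normrN normrM (ger0_norm r0) mulrC ler_wpM2r//.
by rewrite ler_norml; lra.
Qed.

End lattice_sums.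

(** * The averaged error *)
Section averages.
Context {R : realType}.
Local Notation mu := (@lebesgue_measure R).
Implicit Types (t v x : R).

Lemma ri_step v t : 0 <= v -> 0 <= t ->
  ri 0 t (fun s => (v <= s)%R%:R) = pos (t - v).
Proof.
move=> v0 t0; rewrite /ri /Rintegral.
transitivity (fine (\int[mu]_(s in `[0%R, t]) (\1_(`[v, +oo[%classic) s)%:E)%E).
  by congr fine; apply: eq_integral => s _; rewrite indicE mem_setE in_itv /= andbT.
rewrite integral_indic//= (_ : _ `&` _ = `[v, t]%classic); last first.
  apply/seteqP; split => s /=; rewrite !in_itv /= ?andbT; first by case=> -> /andP[].
  by move=> /andP[vs st]; rewrite vs st (le_trans v0 vs).
rewrite lebesgue_measure_itv /= lte_fin; case: ltP => [vt|tv] /=.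
  by rewrite pos_ge0E// subr_ge0 ltW.
by rewrite pos_le0E// subr_le0.
Qed.

Lemma step_integrable v t : mu.-integrable `[0, t] (EFin \o (fun s : R => (v <= s)%R%:R)).
Proof.
apply: measurable_bounded_integrable => //.
- by rewrite /= lebesgue_measure_itv /=; case: ifP => // _; rewrite -EFinB ltry.
- rewrite (_ : (fun s => _) = \1_(`[v, +oo[%classic)); first exact: measurable_indic.
  by apply/funext => s; rewrite indicE mem_setE in_itv /= andbT.
- exists 1; split; first exact: num_real.
  by move=> y y1 s _ /=; case: (v <= s); rewrite ?normr1 ?normr0; lra.
Qed.

Lemma ri_step_sum (I : Type) (r : seq I) (c v : I -> R) t : 0 <= t -> (forall i, 0 <= v i) ->
  let f s := \sum_(i <- r) c i * (v i <= s)%R%:R in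
  mu.-integrable `[0, t] (EFin \o f) /\ ri 0 t f = \sum_(i <- r) c i * pos (t - v i).
Proof.
move=> t0 v0 /=; elim: r => [|i r [IH1 IH2]].
  rewrite (_ : (fun s => _) = fun=> 0); last by apply/funext => s; rewrite big_nil.
  by rewrite big_nil ri_cst// mul0r; split => //; exact: (integrable0 _ _).
rewrite (_ : (fun s => _) = fun s => c i * (v i <= s)%R%:R + \sum_(i <- r) c i * (v i <= s)%R%:R); last first.
  by apply/funext => s; rewrite big_cons.
have mI : measurable (`[0, t]%classic : set (measurableTypeR R)) by exact: measurable_itv.
have is1 : mu.-integrable `[0, t] (EFin \o (fun s => c i * (v i <= s)%R%:R)).
  exact: (integrableZl mI (c i) (step_integrable (v i) t)).
split; first exact: (integrableD mI is1 IH1).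
rewrite big_cons -IH2 -(ri_step (v0 i) t0) /ri.
rewrite -RintegralZl//; last exact: step_integrable.
by rewrite -RintegralD.
Qed.

Lemma ri_weyl (al be ga t : R) : 0 <= t ->
  ri 0 t (fun s => al * s + be * Num.sqrt s + ga) = al / 2 * t ^+ 2 + 2 / 3 * be * (t * Num.sqrt t) + ga * t.
Proof.
move=> t0.
have cs : continuous (fun s : R => Num.sqrt s) := @sqrt_continuous R.
have ci : continuous (fun s : R => s) := @cont_id R.
have c1 : continuous (fun s : R => al * s + be * Num.sqrt s + ga).
  exact: (contD (contD (contM (@cont_cst _ _ al) ci) (contM (@cont_cst _ _ be) cs)) (@cont_cst _ _ ga)).
have c2 : continuous (fun s : R => al / 2 * s ^+ 2 + 2 / 3 * be * (s * Num.sqrt s) + ga * s).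
  have e1 : continuous (fun s : R => s ^+ 2) by exact: exprn_continuous.
  have e2 : continuous (fun s : R => s * Num.sqrt s) by exact: (contM ci cs).
  exact: (contD (contD (contM (@cont_cst _ _ (al / 2)) e1) (contM (@cont_cst _ _ (2 / 3 * be)) e2)) (contM (@cont_cst _ _ ga) ci)).
have dd (s : R) : 0 < s < t ->
    is_derive s 1 (fun s : R => al / 2 * s ^+ 2 + 2 / 3 * be * (s * Num.sqrt s) + ga * s) (al * s + be * Num.sqrt s + ga).
  move=> /andP[s0 _]; have q0 : 0 < Num.sqrt s by rewrite sqrtr_gt0.
  have d1 : is_derive s 1 (fun s : R => s) 1 by exact: is_derive_id.
  have ds := der_sqrt s0 d1.
  apply: (der_eq (derD (derD (derM (der_cst (al / 2) s 1) (derX 2 d1)) (derM (der_cst (2 / 3 * be) s 1) (derM d1 ds))) (derM (der_cst ga s 1) d1))).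
  have : s = Num.sqrt s ^+ 2 by rewrite sqr_sqrtr ?ltW.
  move: q0; move: (Num.sqrt s) => q q0 ->; rewrite /=.
  by field; rewrite gt_eqF.
by rewrite (ri_FTC_oo t0 c2 c1 dd) expr0n /= !(mul0r, mulr0, addr0, subr0).
Qed.

Lemma powR_quarter t : 0 <= t -> t `^ (- (1 / 4)) = (Num.sqrt (Num.sqrt t))^-1.
Proof.
move=> t0; rewrite powRN -(powR12_sqrt (sqrtr_ge0 t)) -(powR12_sqrt t0) -powRrM.
by congr ((_ `^ _)^-1); field.
Qed.

Lemma powR_half t : 0 <= t -> t `^ (- (1 / 2)) = (Num.sqrt t)^-1.
Proof. by move=> t0; rewrite powRN -(powR12_sqrt t0) mul1r. Qed.

Variable a : R.
Hypothesis a0 : 0 < a.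
Let S := triangle a.
Let w := pi / a.
Let w0 : 0 < w. Proof. by rewrite divr_gt0// pi_gt0. Qed.

Lemma eigvalE m n : eigval a m n = w ^+ 2 * (m%:R ^+ 2 + n%:R ^+ 2).
Proof. by rewrite /eigval /freq -/w; ring. Qed.

Lemma eigval_lt_trunc m n r t : 0 <= r -> t <= (w * r) ^+ 2 -> eigval a m n <= t ->
  (m < (Num.truncn r).+1)%N && (n < (Num.truncn r).+1)%N.
Proof.
move=> r0 tr et; have : m%:R ^+ 2 + n%:R ^+ 2 <= r ^+ 2.
  rewrite -(ler_pM2l (exprn_gt0 2 w0)) -exprMn -eigvalE; exact: le_trans tr.
have H k : k%:R ^+ 2 <= r ^+ 2 -> (k < (Num.truncn r).+1)%N.
  by rewrite ler_sqr ?nnegrE// => kr; rewrite ltnS truncn_ge_nat.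
move=> h; rewrite !H//; [have := sqr_ge0 (m%:R : R)|have := sqr_ge0 (n%:R : R)]; lra.
Qed.

Lemma count_integral bc r : 0 <= r ->
  mu.-integrable `[0, (w * r) ^+ 2] (EFin \o eigenvalue_count bc S) /\
  ri 0 ((w * r) ^+ 2) (eigenvalue_count bc S) = w ^+ 2 *
    \sum_(m < (Num.truncn r).+1) \sum_(n < (Num.truncn r).+1)
      (admissible bc m n)%:R * pos (r ^+ 2 - m%:R ^+ 2 - n%:R ^+ 2).
Proof.
move=> r0; set M := (Num.truncn r).+1; set t := (w * r) ^+ 2.
pose f (s : R) : R := \sum_(p : 'I_M * 'I_M) (admissible bc p.1 p.2)%:R * (eigval a p.1 p.2 <= s)%R%:R.
have fE (s : R) : 0 <= s <= t -> eigenvalue_count bc S s = f s.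
  move=> /andP[_ st]; rewrite (@eigenvalue_countE _ _ a0 bc M).
    by rewrite pair_bigA; apply: eq_bigr => p _; case: (admissible _ _ _); rewrite ?mul1r ?mul0r.
  by move=> m n; apply: eigval_lt_trunc.
have t0 : 0 <= t by exact: sqr_ge0.
have [h1 h2] := @ri_step_sum _ (index_enum _) (fun p : 'I_M * 'I_M => (admissible bc p.1 p.2)%:R)
  (fun p => eigval a p.1 p.2) t t0 (fun p => addr_ge0 (sqr_ge0 _) (sqr_ge0 _)).
split.
  by apply: eq_integrable h1 => // s; rewrite inE /= in_itv /= => /fE ->.
rewrite (ri_ext fE) h2 pair_bigA mulr_sumr; apply: eq_bigr => p _ /=.
rewrite mulrCA -(posM _ (sqr_ge0 w)) eigvalE /t; congr (_ * pos _); ring.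
Qed.

Section leading_terms.
Variables (g : R -> R) (D : R).
Hypothesis rieszE : forall r, 1 <= r -> `|riesz r - pi * r ^+ 4 / 2 - r * Num.sqrt r * g r| <= D * r.

(** The half-axes contribute [2/3 r^3] and the half-diagonals [sqrt 2 / 3 r^3], which
    together form the perimeter term; their terms in [r^2] and the corner add up to
    [3/8 r^2] for both boundary conditions. *)
Lemma lattice_count bc r : 2 <= r ->
  `|\sum_(m < (Num.truncn r).+1) \sum_(n < (Num.truncn r).+1)
      (admissible bc m n)%:R * pos (r ^+ 2 - m%:R ^+ 2 - n%:R ^+ 2)
    - (pi * r ^+ 4 / 16 + swap_sign bc * (2 + Num.sqrt 2) / 6 * r ^+ 3 + 3 / 8 * r ^+ 2
       + r * Num.sqrt r * g r / 8)| <= (D / 8 + 3 / 2) * r.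
Proof.
move=> r2; have r1 : 1 <= r by lra.
rewrite (@triangle_lattice_sum _ bc (Num.truncn r) (fun m n => pos (r ^+ 2 - m%:R ^+ 2 - n%:R ^+ 2))); last first.
  by move=> m n; congr pos; ring.
rewrite -riesz_lattice; last lra.
rewrite expr0n /= !subr0 pos_ge0E ?sqr_ge0//.
under eq_bigr do rewrite subr0.
set q := Num.sqrt 2; have q2 : q ^+ 2 = 2 by rewrite sqr_sqrtr.
have q0 : 0 < q by rewrite sqrtr_gt0.
have q1 : 1 <= q <= 2 by apply/andP; split; nra.
pose rho := r / q.
have rho1 : 1 <= rho by rewrite ler_pdivlMr//; lra.
have rhor : rho <= r by rewrite ler_pdivrMr//; nra.
have rho2 : 2 * rho ^+ 2 = r ^+ 2 by rewrite /rho exprMn exprVn q2; field.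
have rho3 : 2 * rho ^+ 3 = q / 2 * r ^+ 3.
  have qr : q * rho = r by rewrite /rho mulrCA divff ?mulr1// gt_eqF.
  transitivity (q ^+ 2 / 2 * (r ^+ 2 * rho)); first by rewrite q2 -rho2; field.
  by transitivity (q / 2 * (r ^+ 2 * (q * rho))); [field|rewrite qr; field].
have -> : \sum_(m < (Num.truncn r).+1) pos (r ^+ 2 - m%:R ^+ 2 - m%:R ^+ 2)
   = 2 * \sum_(m < (Num.truncn r).+1) pos (rho ^+ 2 - m%:R ^+ 2).
  rewrite mulr_sumr; apply: eq_bigr => m _; rewrite -posM//; congr pos.
  by rewrite -rho2; ring.
have h1 := rieszE r1.
have h2 := line_sum r1 (ltnSn (Num.truncn r)).
have h3 := @line_sum _ rho (Num.truncn r).+1 rho1 (le_truncn rhor).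
move: h1 h2 h3; move: (riesz r) (\sum_(m < _) pos (r ^+ 2 - _)) (\sum_(m < _) pos (rho ^+ 2 - _)) => X A B.
move: rho2 rho3; set r3 := r ^+ 3; set u3 := rho ^+ 3; set r2' := r ^+ 2; set u2 := rho ^+ 2.
move=> e2 e3; set Y := r * Num.sqrt r * g r; set r4 := pi * r ^+ 4.
by case: bc; rewrite /swap_sign /corner !ler_norml => /andP[h1 h2] /andP[h3 h4] /andP[h5 h6];
  apply/andP; split; lra.
Qed.

(** With [t = (w r)^2] and [w = pi / a], the terms of [lattice_count] other than the
    oscillating one are exactly the integral of [Ntilde]. *)
Lemma average_error_bound bc t : 2 * w <= Num.sqrt t ->
  `|average_error bc a t - (Num.sqrt w / 8 * g (w^-1 * Num.sqrt t)) * t `^ (- (1 / 4))|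
    <= (D / 8 + 3 / 2) * w * t `^ (- (1 / 2)).
Proof.
move=> wt; have st0 : 0 < Num.sqrt t by apply: lt_le_trans wt; rewrite mulr_gt0.
have t0 : 0 <= t by apply: ltW; rewrite -sqrtr_gt0.
pose r := w^-1 * Num.sqrt t.
have stE : Num.sqrt t = w * r by rewrite /r mulVKf// gt_eqF.
have r2 : 2 <= r by rewrite -(ler_pM2l w0) -stE mulrC.
have r0 : 0 <= r by lra.
have tE : t = (w * r) ^+ 2 by rewrite -stE sqr_sqrtr.
rewrite (powR_quarter t0) (powR_half t0) -/r.
have [h1 h2] := count_integral bc r0.
have ci : continuous (fun s : R => s) := @cont_id R.
pose be := swap_sign bc * ((2 + Num.sqrt 2) / (4 * pi) * a).
have NE s : Ntilde bc a s = a ^+ 2 / (8 * pi) * s + be * Num.sqrt s + 3 / 8.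
  by rewrite /Ntilde /be /swap_sign; case: bc {h1 h2 be}; ring.
have h3 : mu.-integrable `[0, t] (EFin \o Ntilde bc a).
  apply: cont_integrable; rewrite (_ : Ntilde bc a = fun s => a ^+ 2 / (8 * pi) * s + be * Num.sqrt s + 3 / 8); last exact/funext.
  exact: (contD (contD (contM (@cont_cst _ _ (a ^+ 2 / (8 * pi))) ci) (contM (@cont_cst _ _ be) (@sqrt_continuous R))) (@cont_cst _ _ (3 / 8))).
have -> : average_error bc a t = t^-1 * (ri 0 t (eigenvalue_count bc S) - ri 0 t (Ntilde bc a)).
  by rewrite /average_error RintegralB//; rewrite tE.
have -> : ri 0 t (Ntilde bc a) = ri 0 t (fun s => a ^+ 2 / (8 * pi) * s + be * Num.sqrt s + 3 / 8).
  by apply: ri_ext => s _; exact: NE.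
rewrite ri_weyl// {2}tE h2.
have := lattice_count bc r2; set X := \sum_(m < _) _; rewrite stE tE.
have -> : Num.sqrt (w * r) = Num.sqrt w * Num.sqrt r by rewrite sqrtrM// ltW.
have u0 : 0 < Num.sqrt r by rewrite sqrtr_gt0; lra.
have v0 : 0 < Num.sqrt w by rewrite sqrtr_gt0.
have uE : r = Num.sqrt r ^+ 2 by rewrite sqr_sqrtr.
set L := (X in `|_ - X|); move=> XL.
have aE : a = pi / w by rewrite /w invfM invrK mulrA divff ?mul1r// gt_eqF// pi_gt0.
have wn : w != 0 by rewrite gt_eqF.
have rn : r != 0 by rewrite gt_eqF//; lra.
have -> : ((w * r) ^+ 2)^-1 * (w ^+ 2 * X - (a ^+ 2 / (8 * pi) / 2 * ((w * r) ^+ 2) ^+ 2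
    + 2 / 3 * be * ((w * r) ^+ 2 * (w * r)) + 3 / 8 * (w * r) ^+ 2))
    - Num.sqrt w / 8 * g r * (Num.sqrt w * Num.sqrt r)^-1 = (X - L) / r ^+ 2.
  rewrite /be /L aE; have : (pi : R) != 0 by rewrite gt_eqF// pi_gt0.
  have un : Num.sqrt r != 0 by rewrite gt_eqF.
  have vn : Num.sqrt w != 0 by rewrite gt_eqF.
  move: wn rn un vn uE; clear; move: (Num.sqrt 2) (pi : R) (g r) (swap_sign bc) X (Num.sqrt w) w => q p G s X v w' wn rn un vn.
  move: (Num.sqrt r) un => u un uE pn.
  have -> : r * u * G / 8 = u ^+ 3 * G / 8 by rewrite uE; ring.
  move: rn; rewrite uE => rn; field.
  by rewrite wn un vn pn.
rewrite normrM normfV (ger0_norm (sqr_ge0 r)) ler_pdivrMr ?exprn_gt0//; last lra.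
apply: le_trans XL _; rewrite le_eqVlt; apply/orP; left; apply/eqP; field.
by rewrite wn rn.
Qed.

End leading_terms.
End averages.

Theorem theorem2p4 (R : realType) (a : R) (ha : 0 < a) :
  exists g : R -> R,
    [/\ almost_periodic g, has_mean_value g 0 &
        forall bc : boundary_condition,
          exists C : R, \forall t \near +oo,
            `|average_error bc a t - g (Num.sqrt t) * t `^ (- (1 / 4))|
              <= C * t `^ (- (1 / 2))].
Proof.
have [g og [D rieszE]] := @riesz_asymptotics R.
pose w := pi / a; have w0 : 0 < w by rewrite divr_gt0// pi_gt0.
have og' : osc_limit (fun x => Num.sqrt w / 8 * g (w^-1 * x)).
  by apply: osc_limit_scale => //; rewrite invr_eq0 gt_eqF.
exists (fun x => Num.sqrt w / 8 * g (w^-1 * x)); split.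
- exact: osc_limit_almost_periodic.
- exact: osc_limit_mean.
- move=> bc; exists ((D / 8 + 3 / 2) * w); near=> t.
  apply: (average_error_bound ha rieszE bc).
  have wt : (2 * w) ^+ 2 <= t by near: t; exact: nbhs_pinfty_ge (num_real _).
  have w2 : 0 <= 2 * w by rewrite mulr_ge0// ltW.
  by rewrite -(ger0_norm w2) -sqrtr_sqr ler_wsqrtr.
Unshelve. all: by end_near. Qed.
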